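(* Let $(\omega^1,\dots,\omega^8;u)$, $u$ nowhere zero, be a Monge structure on an 8-dimensional manifold $M$ satisfying (U) of the context with $I_1\neq0$ and $I_2=0$. It defines a unique local reduction of its 11-dimensional structural bundle $H\to\mathcal G^{11}\to M$ to a 10-dimensional principal fiber bundle $H_0\to Q\to M$ with a uniquely defined principal $\mathfrak h_0$-valued connection $$(\Gamma^i{}_j)=\begin{pmatrix} -2\Omega_1&-\Theta&0&0&0&0&0&0\\0&-2\Omega_1&0&0&0&0&0&0\\-2\Theta&0&-2\Omega_1&0&0&0&0&0\\0&0&0&-2\Omega_1&-\Theta&0&0&0\\0&0&0&0&-2\Omega_1&0&0&0\\0&0&0&2\Omega_1&0&0&-\Theta&0\\0&0&0&0&2\Omega_1&0&0&0\\ 0&0&0&0&0&0&0&-2\Omega_1 \end{pmatrix}.$$ Its torsion $T^i=d\theta^i+\Gamma^i{}_j\wedge\theta^j$ is $$\begin{aligned} T^1&=S_4(\theta^1\wedge\theta^5+\theta^1\wedge\theta^7-\theta^2\wedge\theta^4-\theta^2\wedge\theta^6)-\theta^4\wedge\theta^7-\theta^5\wedge\theta^6,\\ T^2&=-2\theta^5\wedge\theta^7,\\ T^3&=2S_4(-\theta^1\wedge\theta^4-\theta^1\wedge\theta^6+\theta^3\wedge\theta^5+\theta^3\wedge\theta^7)+\theta^2\wedge\theta^5+\theta^2\wedge\theta^7-2\theta^4\wedge\theta^6,\\ T^4&=S_4(-\theta^4\wedge\theta^7-\theta^5\wedge\theta^6)+\epsilon(\theta^1\wedge\theta^5+\theta^1\wedge\theta^7)+\theta^4\wedge\theta^8+\theta^6\wedge\theta^8,\\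 T^5&=-2S_4\theta^5\wedge\theta^7+\epsilon(\theta^2\wedge\theta^5+\theta^2\wedge\theta^7)+\theta^5\wedge\theta^8+\theta^7\wedge\theta^8,\\ T^6&=S_4(4\theta^4\wedge\theta^5+5\theta^4\wedge\theta^7-3\theta^5\wedge\theta^6+4\theta^6\wedge\theta^7)-\epsilon(\theta^1\wedge\theta^5+\theta^1\wedge\theta^7)-\theta^4\wedge\theta^8-\theta^6\wedge\theta^8,\\ T^7&=2S_4\theta^5\wedge\theta^7-\epsilon(\theta^2\wedge\theta^5+\theta^2\wedge\theta^7)-\theta^5\wedge\theta^8-\theta^7\wedge\theta^8,\\ T^8&=4S_4(\theta^5\wedge\theta^8+\theta^7\wedge\theta^8)+2\epsilon\theta^5\wedge\theta^7, \end{aligned}$$ and its curvature $K^i{}_j=d\Gamma^i{}_j+\Gamma^i{}_k\wedge\Gamma^k{}_j$ has as only nonzero entries $$K^1{}_2=K^4{}_5=K^6{}_7=\tfrac12K^3{}_1=-S_5(\theta^4\wedge\theta^5+\theta^4\wedge\theta^7-\theta^5\wedge\theta^6+\theta^6\wedge\theta^7).$$ Here the invariant $\epsilon=\mathrm{sign}(I_1)=\pm1$, and the functions $S_4$ and $S_5$ are $$S_4=\frac{9I_1v_2-15v_2^3+8u^2z_4}{2\sqrt{\epsilon I_1^3}},$$ $$S_5=\frac{64I_1u^3z_9-22I_1^3-9I_1^2v_2^2-180I_1v_2^4+675v_2^6-16I_1u^2v_2z_4-720u^2v_2^3z_4+192u^4z_4^2}{4\epsilon I_1^3}.$$ The torsion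 $(T^i)$ and the curvature $(K^i{}_j)$ of the principal connection $(\Gamma^i{}_j)$ define the system of all fundamental invariants of the structures with $I_1\neq0$ and $I_2=0$. In particular $$dS_4=(\epsilon+3S_4^2+S_5)(\theta^5+\theta^7),$$ so that all the invariants are obtained in terms of the differentiation of $S_4$.
   Context: Structure equations (U) (the normal form of Monge structures whose main invariant, a quintic polynomial, is nonzero with a root of multiplicity five): $$d\omega^1=-\omega^4\wedge\omega^7-\omega^5\wedge\omega^6,\quad d\omega^2=-2\omega^5\wedge\omega^7,\quad d\omega^3=u\,\omega^2\wedge\omega^7-2\omega^4\wedge\omega^6,$$ $$d\omega^4=\omega^6\wedge\omega^8,\quad d\omega^5=\omega^7\wedge\omega^8,\quad d\omega^6=d\omega^7=d\omega^8=0.$$ They imply the existence of functions with $$du=v_1\omega^2+v_2\omega^7,\ dv_1=w_1\omega^2+w_2\omega^7,\ dv_2=w_2\omega^2+2v_1\omega^5+w_3\omega^7,$$ $$dw_2=z_2\omega^2+2w_1\omega^5+z_3\omega^7,\quad dw_3=z_3\omega^2+4w_2\omega^5+z_4\omega^7+2v_1\omega^8,\quad dz_4=z_8\omega^2+6z_3\omega^5+z_9\omega^7+6w_2\omega^8.$$ Invariants: $I_1=5v_2^2-4uw_3$, $I_2=v_1$. The structural bundle $\mathcal G^{11}$ is (locally) $M\times H$, where $H$ has coordinates $(a,b,c)$, $ab\ne0$, carrying the forms $$\begin{gathered}\theta^1=a^5b(\bar\omega^1+c\bar\omega^2),\ \theta^2=a^4b\,\bar\omega^2,\ \theta^3=a^6b(2c\bar\omega^1+c^2\bar\omega^2+\bar\omega^3),\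 \theta^4=a^3b(\bar\omega^4+c\bar\omega^5),\ \theta^5=a^2b\,\bar\omega^5,\\ \theta^6=a^3(1-b)(\bar\omega^4+c\bar\omega^5)+a^3(\bar\omega^6+c\bar\omega^7),\ \theta^7=a^2(1-b)\bar\omega^5+a^2\bar\omega^7,\ \theta^8=b\,\bar\omega^8,\end{gathered}$$ $$\begin{gathered}\bar\omega^1=-u\omega^1,\ \bar\omega^2=-u\omega^2,\ \bar\omega^3=-u\omega^3,\ \bar\omega^4=-\omega^4-\tfrac{v_2}{4u}\omega^1,\ \bar\omega^5=-\omega^5-\tfrac{v_2}{4u}\omega^2,\\ \bar\omega^6=u\omega^6+\omega^4+\tfrac{v_2}{4u}\omega^1,\ \bar\omega^7=u\omega^7+\omega^5+\tfrac{v_2}{4u}\omega^2,\ \bar\omega^8=-\tfrac1u\omega^8-\tfrac{v_2}{2u^2}\omega^5-\tfrac{v_2^2}{16u^3}\omega^2.\end{gathered}$$ ($H$ is the group of $8\times8$ matrices $\mathcal A$ with $\theta^i=\mathcal A^i{}_j\bar\omega^j$.) The reduction is the hypersurface $Q=\{a=(\epsilon I_1)^{1/4}/(2u)\}\subset M\times H$, with the forms $\theta^i$ restricted to $Q$; $\Omega_1,\Theta$ are 1-forms on $Q$, and $(\theta^1,\dots,\theta^8,\Omega_1,\Theta)$ is a coframe on $Q$. $H_0$ is a Lie group with Lie algebra $\mathfrak h_0\subset\mathfrak{gl}(8,\mathbb R)$ the set of matrices having, for $B,C\in\mathbb R$, diagonal $(B,B,B,B,B,0,0,B)$, entries $C$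 at positions $(1,2),(4,5),(6,7)$, entry $2C$ at $(3,1)$, entries $-B$ at $(6,4),(7,5)$, and zeros elsewhere.
   Formalization: In S_4 the root √(εI_1³) is taken with the sign of I_1 (with the positive root the torsion and dS_4 formulas fail for I_1<0, S_4≠0), and the reduction Q is shown unique up to a ↦ −a, since this reflection with Θ ↦ −Θ preserves the torsion form. *)

(* Defs.v *)
From HB Require Import structures.
From mathcomp Require Import all_boot all_order all_algebra.
From mathcomp Require Import ring.
From mathcomp Require Import all_classical all_reals all_analysis.
Set Implicit Arguments.
Unset Strict Implicit.
Unset Printing Implicit Defensive.
Import Order.TTheory GRing.Theory Num.Theory.
Import numFieldNormedType.Exports.
Local Open Scope classical_set_scope.
Local Open Scope ring_scope.

Reserved Notation "a ∧ b" (at level 34, no associativity).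
Reserved Notation "w ^[ k ]" (at level 2, k at level 200, format "w ^[ k ]").

(** * Calculus on open subsets of R^n

    A covector at a point is a row vector, a 2-covector is the antisymmetric
    matrix of its values on pairs of coordinate vectors; no factor 1/2 is used:
    (a ∧ b)(X, Y) = a(X) b(Y) - a(Y) b(X) and
    da(X, Y) = X(a(Y)) - Y(a(X)) for coordinate fields X, Y. *)
Section Calculus.
Variable R : realType.

Definition partial (n : nat) (k : 'I_n) (f : 'rV[R]_n -> R) (x : 'rV[R]_n) : R :=
  'D_(delta_mx 0 k) f x.

Fixpoint Ck (m n : nat) (U : set 'rV[R]_n) (f : 'rV[R]_n -> R) : Prop :=
  match m with
  | 0 => forall x, U x -> {for x, continuous f}
  | m'.+1 => (forall x, U x -> differentiable f x) /\
             forall k : 'I_n, Ck m' U (partial k f)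
  end.

(* meant for open U *)
Definition smooth_on (n : nat) (U : set 'rV[R]_n) (f : 'rV[R]_n -> R) : Prop :=
  forall m, Ck m U f.

Definition wedge (n : nat) (a b : 'rV[R]_n) : 'M[R]_n := a^T *m b - b^T *m a.

Definition dfun (n : nat) (f : 'rV[R]_n -> R) (x : 'rV[R]_n) : 'rV[R]_n :=
  \row_k partial k f x.

Definition dform (n : nat) (a : 'rV[R]_n -> 'rV[R]_n) (x : 'rV[R]_n) : 'M[R]_n :=
  \matrix_(k, l) (partial k (fun y => a y 0 l) x - partial l (fun y => a y 0 k) x).

(* In MathComp-Analysis the differential of g at x is v |-> v *m jacobian g x. *)
Definition pull (n m : nat) (g : 'rV[R]_n -> 'rV[R]_m)
    (a : 'rV[R]_m -> 'rV[R]_m) (x : 'rV[R]_n) : 'rV[R]_n :=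
  a (g x) *m (jacobian g x)^T.

End Calculus.

Notation "a ∧ b" := (wedge a b) : ring_scope.

(** * Manifolds

    [charted R n] is a space with a family of candidate n-dimensional charts;
    [is_manifold] says that they form a smooth atlas of the open subset
    [carrier].  Allowing the carrier to be a proper open subset of the ambient
    space makes products with open subsets of R^k immediate. *)
Record charted (R : realType) (n : nat) := Charted {
  pt :> topologicalType;
  ix : Type;
  dom : ix -> set pt;
  phi : ix -> pt -> 'rV[R]_n;
  psi : ix -> 'rV[R]_n -> pt }.

Section Manifolds.
Variable R : realType.

Definition carrier (n : nat) (X : charted R n) : set X :=
  [set p | exists i, dom i p].
Definition img (n : nat) (X : charted R n) (i : ix X) : set 'rV[R]_n :=
  @phi R n X i @` dom i.

Definition is_manifold (n : nat) (X : charted R n) : Prop :=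
  [/\ hausdorff_space X, @second_countable X,
      (forall i : ix X, open (dom i) /\ open (img i)),
      (forall (i : ix X) p, dom i p ->
         psi i (phi i p) = p /\ {for p, continuous (@phi R n X i)}) /\
      (forall (i : ix X) x, img i x -> {for x, continuous (@psi R n X i)}) &
      forall (i j : ix X) (k : 'I_n),
        smooth_on (@phi R n X i @` (dom i `&` dom j))
                  (fun x => phi j (psi i x) 0 k)].

Definition smooth_fun (n : nat) (X : charted R n) (f : X -> R) : Prop :=
  forall i : ix X, smooth_on (img i) (fun x => f (psi i x)).

Definition smooth_map (n m : nat) (X : charted R n) (Y : charted R m)
    (F : X -> Y) : Prop :=
  (forall p, carrier p -> carrier (F p) /\ {for p, continuous F}) /\
  forall (i : ix X) (j : ix Y) (k : 'I_m),
    smooth_on [set x | img i x /\ dom j (F (psi i x))]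
              (fun x => phi j (F (psi i x)) 0 k).

(* The coordinate expressions of a 1-form, one per chart; only the values on
   [img i] are meaningful. *)
Definition form1 (n : nat) (X : charted R n) : Type :=
  ix X -> 'rV[R]_n -> 'rV[R]_n.

Definition is_pullback (n m : nat) (X : charted R n) (Y : charted R m)
    (F : X -> Y) (a : form1 Y) (b : form1 X) : Prop :=
  forall (i : ix X) (j : ix Y) x, img i x -> dom j (F (psi i x)) ->
    b i x = pull (fun y => phi j (F (psi i y))) (a j) x.

(* The second condition is the compatibility of the coordinate expressions. *)
Definition smooth_form (n : nat) (X : charted R n) (a : form1 X) : Prop :=
  (forall (i : ix X) k, smooth_on (img i) (fun x => a i x 0 k)) /\
  is_pullback (@idfun X) a a.

Definition form_eq (n : nat) (X : charted R n) (a b : form1 X) : Prop :=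
  forall (i : ix X) x, img i x -> a i x = b i x.

Definition coframe_mx (n : nat) (X : charted R n) (eta : 'I_n -> form1 X)
    (i : ix X) (x : 'rV[R]_n) : 'M[R]_n :=
  \matrix_(k, l) eta k i x 0 l.
Definition coframe (n : nat) (X : charted R n) (eta : 'I_n -> form1 X) : Prop :=
  forall (i : ix X) x, img i x -> coframe_mx eta i x \in unitmx.

(* X x V for V an open subset of R^k; the last k coordinates are those of V. *)
Definition prod_charted (n k : nat) (X : charted R n) (V : set 'rV[R]_k) :
    charted R (n + k) :=
  @Charted R (n + k) (X * 'rV[R]_k)%type (ix X)
    (fun i => dom i `*` V)
    (fun i q => row_mx (phi i q.1) q.2)
    (fun i y => (psi i (lsubmx y), rsubmx y)).

(** ** Invariants of a coframe *)

(* coefficients c of  a = sum_k c_k eta^k  and  t = sum_(k<l) c_kl eta^k ∧ eta^l *)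
Definition coefs1 (n : nat) (N : 'M[R]_n) (a : 'rV[R]_n) : 'rV[R]_n :=
  a *m invmx N.
Definition coefs2 (n : nat) (N : 'M[R]_n) (t : 'M[R]_n) : 'M[R]_n :=
  (invmx N)^T *m t *m invmx N.

Definition is_coefficient (n : nat) (X : charted R n) (eta : 'I_n -> form1 X)
    (t : ix X -> 'rV[R]_n -> 'M[R]_n) (f : X -> R) : Prop :=
  exists k l, forall (i : ix X) x, img i x ->
    f (psi i x) = coefs2 (coframe_mx eta i x) (t i x) k l.

Definition structure_function (n : nat) (X : charted R n)
    (eta : 'I_n -> form1 X) (f : X -> R) : Prop :=
  exists k, is_coefficient eta (fun i => dform (eta k i)) f.

Definition is_coframe_derivative (n : nat) (X : charted R n)
    (eta : 'I_n -> form1 X) (k : 'I_n) (f g : X -> R) : Prop :=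
  forall (i : ix X) x, img i x ->
    g (psi i x) =
    coefs1 (coframe_mx eta i x) (dfun (fun y => f (psi i y)) x) 0 k.

(* The algebra of functions obtained from those in S by algebraic operations
   and successive differentiation along the coframe. *)
Inductive generated (n : nat) (X : charted R n) (eta : 'I_n -> form1 X)
    (S : (X -> R) -> Prop) : (X -> R) -> Prop :=
| gen_base f : S f -> generated eta S f
| gen_const (r : R) : generated eta S (fun=> r)
| gen_add f g : generated eta S f -> generated eta S g ->
    generated eta S (fun p => f p + g p)
| gen_mul f g : generated eta S f -> generated eta S g ->
    generated eta S (fun p => f p * g p)
| gen_deriv k f g : generated eta S f -> is_coframe_derivative eta k f g ->
    generated eta S g
| gen_ext f g : generated eta S f -> (forall p, carrier p -> f p = g p) ->
    generated eta S g.

End Manifolds.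

(** * Monge structures

    Families indexed by 'I_8 start at 0; w^[k], for 1 <= k <= 8, is the member
    called w^k in mathematical notation. *)

Definition nr (T : Type) (w : 'I_8 -> T) (k : nat) : T := w (inord k.-1).
Notation "w ^[ k ]" := (nr w k%N) : ring_scope.

Section Monge.
Variable R : realType.

Definition monge_U (M : charted R 8) (om : 'I_8 -> form1 M) (u : M -> R) : Prop :=
  [/\ is_manifold M,
      (forall k, smooth_form (om k)) /\ coframe om,
      smooth_fun u,
      (forall p, carrier p -> u p != 0) &
      forall (i : ix M) x, img i x ->
        let U := u (psi i x) in
        let w := (fun k => om k i x) in
        forall k : 'I_8, dform (om k i) x = nth 0
          [:: - (w^[4] ∧ w^[7]) - w^[5] ∧ w^[6];
              - 2 *: (w^[5] ∧ w^[7]);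
              U *: (w^[2] ∧ w^[7]) - 2 *: (w^[4] ∧ w^[6]);
              w^[6] ∧ w^[8];
              w^[7] ∧ w^[8];
              0; 0; 0] k].

Record derived (T : Type) := Derived {
  v1 : T -> R; v2 : T -> R;
  w1 : T -> R; w2 : T -> R; w3 : T -> R;
  z2 : T -> R; z3 : T -> R; z4 : T -> R; z8 : T -> R; z9 : T -> R }.

Definition derived_eqs (M : charted R 8) (om : 'I_8 -> form1 M) (u : M -> R)
    (D : derived M) : Prop :=
  (forall f, List.In f [:: v1 D; v2 D; w1 D; w2 D; w3 D; z2 D; z3 D; z4 D; z8 D; z9 D] ->
     smooth_fun f) /\
  forall (i : ix M) x, img i x ->
    let p := psi i x in
    let w := (fun k => om k i x) in
    let d f := dfun (fun y => f (psi i y)) x in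
    [/\ d u = v1 D p *: w^[2] + v2 D p *: w^[7],
        d (v1 D) = w1 D p *: w^[2] + w2 D p *: w^[7],
        d (v2 D) = w2 D p *: w^[2] + (2 * v1 D p) *: w^[5] + w3 D p *: w^[7] &
    [/\ d (w2 D) = z2 D p *: w^[2] + (2 * w1 D p) *: w^[5] + z3 D p *: w^[7],
        d (w3 D) = z3 D p *: w^[2] + (4 * w2 D p) *: w^[5] + z4 D p *: w^[7]
                   + (2 * v1 D p) *: w^[8] &
        d (z4 D) = z8 D p *: w^[2] + (6 * z3 D p) *: w^[5] + z9 D p *: w^[7]
                   + (6 * w2 D p) *: w^[8]]].

Definition I1 (M : charted R 8) (u : M -> R) (D : derived M) (p : M) : R :=
  5 * v2 D p ^+ 2 - 4 * u p * w3 D p.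
Definition I2 (M : charted R 8) (D : derived M) (p : M) : R := v1 D p.

Definition monge_I1_I2 (M : charted R 8) (om : 'I_8 -> form1 M) (u : M -> R)
    (D : derived M) : Prop :=
  [/\ monge_U om u, derived_eqs om u D,
      (forall p, carrier p -> I1 u D p != 0) &
      (forall p, carrier p -> I2 D p = 0)].

Definition eps (M : charted R 8) (u : M -> R) (D : derived M) (p : M) : R :=
  Num.sg (I1 u D p).

(* The radical sqrt(eps I1^3) is the root I1 sqrt(eps I1), of the sign of I1:
   with the positive root the torsion formulas fail where I1 < 0. *)
Definition S4 (M : charted R 8) (u : M -> R) (D : derived M) (p : M) : R :=
  let e := eps u D p in let I := I1 u D p in
  (9 * I * v2 D p - 15 * v2 D p ^+ 3 + 8 * u p ^+ 2 * z4 D p)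
  / (2 * (e * Num.sqrt (e * I ^+ 3))).

Definition S5 (M : charted R 8) (u : M -> R) (D : derived M) (p : M) : R :=
  let e := eps u D p in let I := I1 u D p in
  let U := u p in let V := v2 D p in let Z := z4 D p in
  (64 * I * U ^+ 3 * z9 D p - 22 * I ^+ 3 - 9 * I ^+ 2 * V ^+ 2
   - 180 * I * V ^+ 4 + 675 * V ^+ 6 - 16 * I * U ^+ 2 * V * Z
   - 720 * U ^+ 2 * V ^+ 3 * Z + 192 * U ^+ 4 * Z ^+ 2)
  / (4 * e * I ^+ 3).

(* The value of the coordinate a on the hypersurface Q. *)
Definition aQ (M : charted R 8) (u : M -> R) (D : derived M) (p : M) : R :=
  (eps u D p * I1 u D p) `^ (4^-1) / (2 * u p).

(** ** The structural bundle M x H *)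

Definition table8 (V : nmodType) (rows : seq (seq V)) (i j : 'I_8) : V :=
  nth 0 (nth [::] rows i) j.

Definition H_mx (a b c : R) : 'M[R]_8 := \matrix_(i, j) table8
  [:: [:: a ^+ 5 * b; a ^+ 5 * b * c];
      [:: 0; a ^+ 4 * b];
      [:: a ^+ 6 * b * (2 * c); a ^+ 6 * b * c ^+ 2; a ^+ 6 * b];
      [:: 0; 0; 0; a ^+ 3 * b; a ^+ 3 * b * c];
      [:: 0; 0; 0; 0; a ^+ 2 * b];
      [:: 0; 0; 0; a ^+ 3 * (1 - b); a ^+ 3 * (1 - b) * c; a ^+ 3; a ^+ 3 * c];
      [:: 0; 0; 0; 0; a ^+ 2 * (1 - b); 0; a ^+ 2];
      [:: 0; 0; 0; 0; 0; 0; 0; b]] i j.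

Lemma H_mx_mul (a b c a' b' c' : R) : a' != 0 ->
  H_mx a b c *m H_mx a' b' c' = H_mx (a * a') (b * b') (c' + c / a').
Proof.
move=> a0; apply/matrixP => i j; rewrite !mxE.
rewrite !big_ord_recl big_ord0 !mxE /table8.
case: i => -[|[|[|[|[|[|[|[|//]]]]]]]] ?;
  case: j => -[|[|[|[|[|[|[|[|//]]]]]]]] ? /=; by field.
Qed.

Definition bar (M : charted R 8) (om : 'I_8 -> form1 M) (u : M -> R)
    (D : derived M) : 'I_8 -> form1 M := fun k i x =>
  let U := u (psi i x) in let V := v2 D (psi i x) in
  let w := (fun k => om k i x) in
  nth 0
    [:: - U *: w^[1];
        - U *: w^[2];
        - U *: w^[3];
        - w^[4] - (V / (4 * U)) *: w^[1];
        - w^[5] - (V / (4 * U)) *: w^[2];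
        U *: w^[6] + w^[4] + (V / (4 * U)) *: w^[1];
        U *: w^[7] + w^[5] + (V / (4 * U)) *: w^[2];
        - U^-1 *: w^[8] - (V / (2 * U ^+ 2)) *: w^[5]
          - (V ^+ 2 / (16 * U ^+ 3)) *: w^[2]] k.

(* coordinates (a, b, c) *)
Definition H_dom : set 'rV[R]_3 := [set h | h 0 0 * h 0 1 != 0].
Definition H_coord (h : 'rV[R]_3) : 'M[R]_8 := H_mx (h 0 0) (h 0 1) (h 0 2).

Definition G11 (M : charted R 8) : charted R (8 + 3) := prod_charted M H_dom.

Definition theta_G (M : charted R 8) (om : 'I_8 -> form1 M) (u : M -> R)
    (D : derived M) : 'I_8 -> form1 (G11 M) := fun k i y =>
  \sum_l H_coord (rsubmx y) k l *: row_mx (bar om u D l i (lsubmx y)) 0.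

(** ** Reductions to H_0

    H_0 is the subgroup {a = 1} of H, the kernel of a : H -> R^*, with
    coordinates (b, c).  So the H_0-subbundles of M x H are the hypersurfaces
    {a = f}, f : M -> R^* smooth; such a hypersurface is parametrized by
    M x {(b, c) | b <> 0} through [incl f]. *)
Definition H0_dom : set 'rV[R]_2 := [set h | h 0 0 != 0].
Definition H0_coord (h : 'rV[R]_2) : 'M[R]_8 := H_mx 1 (h 0 0) (h 0 1).
Definition pair_rv (b c : R) : 'rV[R]_2 := \row_k (if k == 0 then b else c).

Definition Q10 (M : charted R 8) : charted R (8 + 2) := prod_charted M H0_dom.

Definition incl (M : charted R 8) (f : M -> R) (q : Q10 M) : G11 M :=
  (q.1, row_mx (\row_(k < 1) f q.1) q.2).

Definition theta (M : charted R 8) (om : 'I_8 -> form1 M) (u : M -> R)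
    (D : derived M) (f : M -> R) : 'I_8 -> form1 (Q10 M) := fun k i =>
  pull (fun y : 'rV[R]_(8 + 2) =>
          @phi R _ (G11 M) i (incl f (@psi R _ (Q10 M) i y)))
       (theta_G om u D k i).

(* H_0 acts on coframes by A |-> h^-1 A; in the coordinates of {a = f},
   H_mx 1 b' c' ^-1 H_mx f b c = H_mx f (b / b') (c - c' / f). *)
Definition ract (M : charted R 8) (f : M -> R) (h : 'rV[R]_2) (q : Q10 M) : Q10 M :=
  (q.1, pair_rv (q.2 0 0 / h 0 0) (q.2 0 1 - h 0 1 / f q.1)).

Definition is_H0_reduction (M : charted R 8) (f : M -> R) : Prop :=
  [/\ smooth_fun f, (forall p, carrier p -> f p != 0),
      (forall (h : 'rV[R]_2) (q : Q10 M), H0_dom h -> carrier q ->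
         carrier (ract f h q) /\
         H_coord (incl f (ract f h q)).2 =
           invmx (H0_coord h) *m H_coord (incl f q).2) &
      forall q r : Q10 M, carrier q -> carrier r -> q.1 = r.1 ->
        exists! h, H0_dom h /\ ract f h q = r].

Definition h0_mx (B C : R) : 'M[R]_8 := \matrix_(i, j) table8
  [:: [:: B; C];
      [:: 0; B];
      [:: 2 * C; 0; B];
      [:: 0; 0; 0; B; C];
      [:: 0; 0; 0; 0; B];
      [:: 0; 0; 0; - B; 0; 0; C];
      [:: 0; 0; 0; 0; - B; 0; 0];
      [:: 0; 0; 0; 0; 0; 0; 0; B]] i j.

(* t |-> exp (t h0_mx B C), in the coordinates of H_0: a one-parameter group
   since H_mx 1 b c H_mx 1 b' c' = H_mx 1 (b b') (c + c'). *)
Definition exp_h0 (B C t : R) : 'rV[R]_2 := pair_rv (expR (t * B)) (t * C).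

Definition fundamental (M : charted R 8) (f : M -> R) (B C : R)
    (i : ix (Q10 M)) (y : 'rV[R]_(8 + 2)) : 'rV[R]_(8 + 2) :=
  derive1 (fun t : R => phi i (ract f (exp_h0 B C t) (psi i y))) 0.

(* Connection on the principal bundle {a = f}: an h_0-valued 1-form reproducing
   the generators of fundamental vector fields, with R_h^* G = Ad(h^-1) G. *)
Definition principal_connection (M : charted R 8) (f : M -> R)
    (G : 'I_8 -> 'I_8 -> form1 (Q10 M)) : Prop :=
  let ev (i : ix (Q10 M)) y (X : 'rV[R]_(8 + 2)) : 'M[R]_8 :=
    \matrix_(k, l) (G k l i y *m X^T) 0 0 in
  [/\ forall k l, smooth_form (G k l),
      (forall (i : ix (Q10 M)) y, img i y -> forall X, exists B C,
         ev i y X = h0_mx B C),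
      (forall (i : ix (Q10 M)) y, img i y -> forall B C,
         ev i y (fundamental f B C i y) = h0_mx B C) &
      forall h : 'rV[R]_2, H0_dom h -> forall k l,
        is_pullback (ract f h) (G k l) (fun i y =>
          \sum_r \sum_s
            (invmx (H0_coord h) k r * H0_coord h s l) *: G r s i y)].

Definition Gamma (M : charted R 8) (Om Th : form1 (Q10 M)) :
    'I_8 -> 'I_8 -> form1 (Q10 M) := fun k l i y =>
  let O := Om i y in let T := Th i y in
  table8
    [:: [:: - 2 *: O; - T];
        [:: 0; - 2 *: O];
        [:: - 2 *: T; 0; - 2 *: O];
        [:: 0; 0; 0; - 2 *: O; - T];
        [:: 0; 0; 0; 0; - 2 *: O];
        [:: 0; 0; 0; 2 *: O; 0; 0; - T];
        [:: 0; 0; 0; 0; 2 *: O; 0; 0];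
        [:: 0; 0; 0; 0; 0; 0; 0; - 2 *: O]] k l.

Definition coframe_Q (M : charted R 8) (th : 'I_8 -> form1 (Q10 M))
    (Om Th : form1 (Q10 M)) : 'I_(8 + 2) -> form1 (Q10 M) := fun k =>
  match fintype.split k with
  | inl k' => th k'
  | inr k' => if k' == 0 then Om else Th
  end.

(** ** Torsion and curvature *)

Definition torsion (M : charted R 8) (th : 'I_8 -> form1 (Q10 M))
    (G : 'I_8 -> 'I_8 -> form1 (Q10 M)) (k : 'I_8)
    (i : ix (Q10 M)) (y : 'rV[R]_(8 + 2)) : 'M[R]_(8 + 2) :=
  dform (th k i) y + \sum_l G k l i y ∧ th l i y.

Definition curvature (M : charted R 8) (G : 'I_8 -> 'I_8 -> form1 (Q10 M))
    (k l : 'I_8) (i : ix (Q10 M)) (y : 'rV[R]_(8 + 2)) : 'M[R]_(8 + 2) :=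
  dform (G k l i) y + \sum_r G k r i y ∧ G r l i y.

Definition torsion_table (n : nat) (e s : R) (t : 'I_8 -> 'rV[R]_n) (k : 'I_8) :
    'M[R]_n :=
  nth 0
  [:: s *: (t^[1] ∧ t^[5] + t^[1] ∧ t^[7] - t^[2] ∧ t^[4] - t^[2] ∧ t^[6])
        - t^[4] ∧ t^[7] - t^[5] ∧ t^[6];
      - 2 *: (t^[5] ∧ t^[7]);
      (2 * s) *: (- (t^[1] ∧ t^[4]) - t^[1] ∧ t^[6] + t^[3] ∧ t^[5] + t^[3] ∧ t^[7])
        + t^[2] ∧ t^[5] + t^[2] ∧ t^[7] - 2 *: (t^[4] ∧ t^[6]);
      s *: (- (t^[4] ∧ t^[7]) - t^[5] ∧ t^[6]) + e *: (t^[1] ∧ t^[5] + t^[1] ∧ t^[7])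
        + t^[4] ∧ t^[8] + t^[6] ∧ t^[8];
      - (2 * s) *: (t^[5] ∧ t^[7]) + e *: (t^[2] ∧ t^[5] + t^[2] ∧ t^[7])
        + t^[5] ∧ t^[8] + t^[7] ∧ t^[8];
      s *: (4 *: (t^[4] ∧ t^[5]) + 5 *: (t^[4] ∧ t^[7]) - 3 *: (t^[5] ∧ t^[6])
            + 4 *: (t^[6] ∧ t^[7]))
        - e *: (t^[1] ∧ t^[5] + t^[1] ∧ t^[7]) - t^[4] ∧ t^[8] - t^[6] ∧ t^[8];
      (2 * s) *: (t^[5] ∧ t^[7]) - e *: (t^[2] ∧ t^[5] + t^[2] ∧ t^[7])
        - t^[5] ∧ t^[8] - t^[7] ∧ t^[8];
      (4 * s) *: (t^[5] ∧ t^[8] + t^[7] ∧ t^[8]) + (2 * e) *: (t^[5] ∧ t^[7])] k.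

Definition has_torsion (M : charted R 8) (th : 'I_8 -> form1 (Q10 M))
    (G : 'I_8 -> 'I_8 -> form1 (Q10 M)) (e s : Q10 M -> R) : Prop :=
  forall (i : ix (Q10 M)) y, img i y -> forall k,
    torsion th G k i y =
    torsion_table (e (psi i y)) (s (psi i y)) (fun l => th l i y) k.

Definition curvature_table (n : nat) (s : R) (t : 'I_8 -> 'rV[R]_n) (k l : 'I_8) :
    'M[R]_n :=
  let K := - s *: (t^[4] ∧ t^[5] + t^[4] ∧ t^[7] - t^[5] ∧ t^[6] + t^[6] ∧ t^[7]) in
  table8
    [:: [:: 0; K];
        [::];
        [:: 2 *: K];
        [:: 0; 0; 0; 0; K];
        [::];
        [:: 0; 0; 0; 0; 0; 0; K];
        [::];
        [::]] k l.

Definition has_curvature (M : charted R 8) (th : 'I_8 -> form1 (Q10 M))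
    (G : 'I_8 -> 'I_8 -> form1 (Q10 M)) (s : Q10 M -> R) : Prop :=
  forall (i : ix (Q10 M)) y, img i y -> forall k l,
    curvature G k l i y =
    curvature_table (s (psi i y)) (fun r => th r i y) k l.

(* The components of torsion and curvature in the coframe eta. *)
Definition torsion_or_curvature_function (M : charted R 8)
    (th : 'I_8 -> form1 (Q10 M)) (G : 'I_8 -> 'I_8 -> form1 (Q10 M))
    (eta : 'I_(8 + 2) -> form1 (Q10 M)) (f : Q10 M -> R) : Prop :=
  (exists k, is_coefficient eta (torsion th G k) f) \/
  (exists k l, is_coefficient eta (curvature G k l) f).

(** ** Equivalence of structures

    F is a (local) equivalence if it respects the structural bundles M x H;
    it is then a local diffeomorphism, H_mx being invertible on H. *)
Definition equivalence (M M' : charted R 8)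
    (om : 'I_8 -> form1 M) (u : M -> R) (D : derived M)
    (om' : 'I_8 -> form1 M') (u' : M' -> R) (D' : derived M')
    (F : M -> M') : Prop :=
  exists a b c : M -> R,
    [/\ smooth_fun a, smooth_fun b, smooth_fun c,
        (forall p, carrier p -> a p * b p != 0) &
        forall k, is_pullback F (bar om' u' D' k) (fun i x =>
          \sum_l H_mx (a (psi i x)) (b (psi i x)) (c (psi i x)) k l
                   *: bar om u D l i x)].

(* F lifts to a map of the reductions preserving the coframe
   (theta, Omega_1, Theta), up to the reflection H_mx (-1) 1 0 of H, under which
   Theta changes sign and the form of torsion and curvature is unchanged. *)
Definition lifts_to_Q (M M' : charted R 8)
    (th : 'I_8 -> form1 (Q10 M)) (Om Th : form1 (Q10 M))
    (th' : 'I_8 -> form1 (Q10 M')) (Om' Th' : form1 (Q10 M'))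
    (F : M -> M') : Prop :=
  exists (s : M -> R) (L : Q10 M -> Q10 M'),
    [/\ smooth_fun s /\ (forall p, carrier p -> s p = 1 \/ s p = -1),
        smooth_map L /\ (forall q, carrier q -> (L q).1 = F q.1),
        (forall k, is_pullback L (th' k) (fun i y =>
           \sum_l H_mx (s (psi i y).1) 1 0 k l *: th l i y)),
        is_pullback L Om' Om &
        is_pullback L Th' (fun i y => s (psi i y).1 *: Th i y)].

End Monge.

(* Main.v *)
Require Import Defs.
From HB Require Import structures.
From mathcomp Require Import all_boot all_order all_algebra.
From mathcomp Require Import ring lra.
From mathcomp Require Import all_classical all_reals all_analysis.
Set Implicit Arguments.
Unset Strict Implicit.
Unset Printing Implicit Defensive.
Import Order.TTheory GRing.Theory Num.Theory.
Import numFieldNormedType.Exports.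
Local Open Scope classical_set_scope.
Local Open Scope ring_scope.

(** When I_2 = v1 vanishes, the equations for du, ..., dz4 make w1, w2, z2, z3 and
    z8 vanish too.  Then u, v2, w3, z4 and all functions built from them have
    differentials proportional to the closed form omega^7: they are functions of
    one parameter t with dt = omega^7 and u' = v2, v2' = w3, w3' = z4, z4' = z9
    ([ode]).  The differential identities of the theorem become identities between
    rational functions, once I1, w3 and z4 are expressed by u, v2, S_4, eps and the
    function a = aQ, for which 16 a^4 u^4 = eps I1.

    The functions v1, ..., z9 exist because of the commutators of the frame fields
    X_k dual to omega^k.  X_3 is central and [X_2, X_7] = - u X_3, so that the Jacobi
    identity for X_k, X_2, X_7 makes X_k u vanish unless k is 2 or 7 ([chart_du0]);
    the other equations follow by commuting derivatives ([derived_exists]).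

    On the section b = 1, c = 0 of Q the forms theta restrict to forms tau on M.
    There the torsion equations hold with Omega_1 a multiple of omega^7 and Theta a
    multiple of omega^6 ([dform_tau]).  The group H_0 is abelian, and the torsion
    table is equivariant under it, so that the torsion equations extend to all of Q
    when db / 2b is added to Omega_1 and d(ac) to Theta ([dform_theta]).  The
    curvature is then linear in dTheta, since dOmega_1 = 0 and h_0 is abelian.

    Uniqueness is linear algebra in the torsion equations.  If the hypersurface
    {a = f} has torsion of the required form, the coefficient of theta^5 ∧ theta^7 in
    the eighth equation gives eps = e' r^4 for r = f / aQ, hence r is 1 or -1
    ([torsion_ratio]); and for given forms theta and given eps the equations
    determine Omega_1, Theta and S_4 ([torsion_unique]).  The fifth torsion form
    shows eps and S_4, whose derivative yields S_5, and all coefficients of the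
    structure equations are affine in these three functions.

    An equivalence F : M -> M' prolongs to a map Q -> Q' under which theta' pulls back
    to the forms of some hypersurface {a = f} over M.  As d commutes with pull-backs,
    the two uniqueness results apply to the pulled back equations: r = f / aQ is a
    sign, the invariants agree, and the prolongation is a lift in the sense of
    [lifts_to_Q] ([pulled_connection]).  Conversely, a lift restricted to b = 1, c = 0
    shows that F respects the structural bundles ([descent_equivalence]). *)

(** * Partial derivatives *)

Section Calculus.
Variable R : realType.

(** Differentiability depends on the germ only: g - f vanishes near x, so that its
    differential is zero. *)
Lemma near_eq_differentiable (V W : normedModType R) (f g : V -> W) (x : V) :
  (\near x, f x = g x) -> differentiable f x -> differentiable g x.
Proof.
move=> fg df.
have fgx : f x = g x by exact: (nbhs_singleton fg).
pose h y := g y - f y; pose z : {linear V -> W} := \0.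
have hE : h \o shift x = cst (h x) + (z : V -> W) +o_ 0 id.
  apply/eqaddoP => _/posnumP[e]; near=> y.
  rewrite /h /= !fctE /= fgx subrr add0r /cst subr0.
  have <- : f (y + x) = g (y + x).
    near: y; move: fg; rewrite (near_shift 0); apply: filterS => y.
    by rewrite /= subr0.
  by rewrite subrr normr0 mulr_ge0.
have zc : continuous (z : V -> W) by move=> y; exact: cst_continuous.
have dh : differentiable h x.
  by apply/diff_locallyP; rewrite (diff_unique zc hE).
rewrite (_ : g = h + f); first exact: differentiableD.
by apply/funext => y; rewrite /h !fctE subrK.
Unshelve. all: by end_near. Qed.

Section Partial.
Variable n : nat.
Implicit Types (f g : 'rV[R]_n -> R) (x : 'rV[R]_n) (k : 'I_n).

Lemma near_partial f g x k : (\near x, f x = g x) -> partial k f x = partial k g x.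
Proof. exact: near_eq_derive. Qed.

Lemma partial_cst c k x : partial k (fun=> c) x = 0.
Proof. exact: derive_cst. Qed.

Lemma partialD f g x k : differentiable f x -> differentiable g x ->
  partial k (fun y => f y + g y) x = partial k f x + partial k g x.
Proof. by move=> df dg; apply: deriveD; exact: diff_derivable. Qed.

Lemma partialM f g x k : differentiable f x -> differentiable g x ->
  partial k (fun y => f y * g y) x = f x * partial k g x + g x * partial k f x.
Proof. by move=> df dg; apply: deriveM; exact: diff_derivable. Qed.

Lemma partialV f x k : f x != 0 -> differentiable f x ->
  partial k (fun y => (f y)^-1) x = - (f x) ^- 2 * partial k f x.
Proof. by move=> f0 df; apply: deriveV => //; exact: diff_derivable. Qed.

Lemma partial_coord (j k : 'I_n) x : partial k (fun y => y 0 j) x = (j == k)%:R.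
Proof.
rewrite /partial deriveE; last exact: differentiable_coord.
pose c (y : 'rV[R]_n) := y 0 j.
have lc : linear c by move=> a u v; rewrite /c !mxE.
pose cM := GRing.isLinear.Build _ _ _ _ _ lc.
pose cL : {linear 'rV[R]_n -> R} := HB.pack c cM.
rewrite (_ : (fun y : 'rV_n => _) = cL) // diff_lin; last exact: coord_continuous.
by rewrite /cL /= /c mxE eqxx.
Qed.

End Partial.

Lemma differentiable_rV (V : normedModType R) (n : nat) (g : V -> 'rV[R]_n) x :
  (forall l, differentiable (fun y => g y 0 l) x) -> differentiable g x.
Proof.
move=> dg.
have -> : g = \sum_l (fun y => g y 0 l *: delta_mx 0 l).
  apply/funext => y; rewrite fct_sumE; apply/rowP => j.
  rewrite summxE (bigD1 j)//= big1 ?addr0 ?mxE ?eqxx ?mulr1// => l lj.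
  by rewrite !mxE eq_sym (negbTE lj) mulr0.
by apply: differentiable_sum => l; apply: differentiableZl.
Qed.

Lemma differentiable_comp_coord (V : normedModType R) (n : nat)
    (g : V -> 'rV[R]_n) x l :
  differentiable g x -> differentiable (fun y => g y 0 l) x.
Proof.
move=> dg; exact: (@differentiable_comp _ _ _ _ g (fun v : 'rV_n => v 0 l) x dg
  (differentiable_coord _ _ _)).
Qed.

Lemma partial_comp n m (g : 'rV[R]_n -> 'rV[R]_m) (f : 'rV[R]_m -> R) x k :
  differentiable g x -> differentiable f (g x) ->
  partial k (f \o g) x = \sum_l partial l f (g x) * partial k (fun y => g y 0 l) x.
Proof.
move=> dg df; rewrite /partial deriveE; last exact: differentiable_comp.
rewrite diff_comp//= -(deriveE _ dg) derive_mx; last exact: diff_derivable.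
rewrite [X in 'd f _ X]row_sum_delta linear_sum/=; apply: eq_bigr => l _.
by rewrite linearZ mxE -deriveE// mulrC.
Qed.

Lemma jacobianE n m (g : 'rV[R]_n -> 'rV[R]_m) x k l :
  differentiable g x -> jacobian g x k l = partial k (fun y => g y 0 l) x.
Proof.
move=> dg; rewrite /jacobian /partial mxE -(deriveE _ dg).
by rewrite derive_mx ?mxE//; exact: diff_derivable.
Qed.

End Calculus.

(** * Symmetry of the second partial derivatives *)

Section Schwarz.
Variable R : realType.

Lemma is_derive_line (V : normedModType R) (f : V -> R) (v w : V) (s : R) :
  differentiable f (s *: v + w) ->
  is_derive s 1 (fun t => f (t *: v + w)) ('D_v f (s *: v + w)).
Proof.
move=> df; have dv : derivable f (s *: v + w) v by exact: diff_derivable.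
have E : (fun h : R => h^-1 *: (f ((h *: 1 + s) *: v + w) - f (s *: v + w))) =
   (fun h : R => h^-1 *: (f (h *: v + (s *: v + w)) - f (s *: v + w))).
  by apply/funext => h; rewrite [h *: 1]mulr1 scalerDl addrA.
by apply: DeriveDef; rewrite /derivable /derive /= E.
Qed.

Lemma continuous_near_lt n (g : 'rV[R]_n -> R) x e : {for x, continuous g} ->
  0 < e -> \forall y \near x, `|g x - g y| < e.
Proof. by move=> cg e0; have /cvgrPdist_lt := cg; apply. Qed.

Lemma dist_half_le (a b c e : R) :
  `|a - c| < e / 2 -> `|b - c| < e / 2 -> `|a - b| <= e.
Proof.
move=> h1 h2; rewrite -(subrKA c) (le_trans (ler_normD _ _))//.
by rewrite [leRHS]splitr lerD ?ltW// distrC.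
Qed.

Variables (n : nat) (U : set 'rV[R]_n) (f : 'rV[R]_n -> R).

(** The mean value theorem, applied in the direction k and then in the direction l,
    turns the second difference over a square of side t into a mixed derivative
    at some point of the square. *)
Lemma second_difference (k l : 'I_n) x (t : R) : 0 < t ->
  (forall s r, 0 <= s <= t -> 0 <= r <= t ->
     differentiable f (s *: delta_mx 0 k + (r *: delta_mx 0 l + x)) /\
     differentiable (partial k f) (s *: delta_mx 0 k + (r *: delta_mx 0 l + x))) ->
  exists s r, [/\ 0 <= s <= t, 0 <= r <= t &
    f (t *: delta_mx 0 k + (t *: delta_mx 0 l + x))
    - f (t *: delta_mx 0 k + x) - (f (t *: delta_mx 0 l + x) - f x)
    = partial l (partial k f) (s *: delta_mx 0 k + (r *: delta_mx 0 l + x)) * t * t].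
Proof.
move=> t0 D; set a := delta_mx 0 k; set b := delta_mx 0 l.
pose F s := f (s *: a + (t *: b + x)) - f (s *: a + (0 *: b + x)).
have tt : 0 <= t <= t by rewrite lexx ltW.
have t00 : 0 <= (0 : R) <= t by rewrite lexx ltW.
have dF s : 0 <= s <= t -> is_derive s 1 F
    (partial k f (s *: a + (t *: b + x)) - partial k f (s *: a + (0 *: b + x))).
  move=> st; have [D1 _] := D s t st tt; have [D2 _] := D s 0 st t00.
  by apply: is_deriveB; exact: is_derive_line.
have [s] : exists2 s, s \in `]0, t[ & F t - F 0 =
   (partial k f (s *: a + (t *: b + x)) - partial k f (s *: a + (0 *: b + x)))
    * (t - 0).
  apply: (@MVT _ F (fun s => partial k f (s *: a + (t *: b + x))
                             - partial k f (s *: a + (0 *: b + x)))).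
  - exact: t0.
  - by move=> s; rewrite in_itv/= => /andP[s0 st]; apply: dF; rewrite !ltW.
  - apply: derivable_within_continuous => s; rewrite in_itv/= => st.
    by have [] := dF s st.
rewrite in_itv/= subr0 => /andP[s0 st] EF.
have sst : 0 <= s <= t by rewrite !ltW.
pose G r := partial k f (r *: b + (s *: a + x)).
have swp r : s *: a + (r *: b + x) = r *: b + (s *: a + x) by rewrite addrCA.
have dG r : 0 <= r <= t -> is_derive r 1 G
    (partial l (partial k f) (r *: b + (s *: a + x))).
  move=> rt; have [_ D2] := D s r sst rt.
  by apply: is_derive_line; rewrite -swp.
have [r] : exists2 r, r \in `]0, t[ & G t - G 0 =
   partial l (partial k f) (r *: b + (s *: a + x)) * (t - 0).
  apply: (@MVT _ G (fun r => partial l (partial k f) (r *: b + (s *: a + x)))).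
  - exact: t0.
  - by move=> r; rewrite in_itv/= => /andP[r0 rt]; apply: dG; rewrite !ltW.
  - apply: derivable_within_continuous => r; rewrite in_itv/= => rt.
    by have [] := dG r rt.
rewrite in_itv/= subr0 => /andP[r0 rt] EG.
exists s, r; split=> //; first by rewrite !ltW.
rewrite swp -EG; move: EF; rewrite /F /G !swp !scale0r !add0r => <-.
by ring.
Qed.

(** The second difference does not depend on the order of the two directions, so
    that the two mixed derivatives agree at points arbitrarily close to x;
    continuity concludes. *)
Lemma partialC (k l : 'I_n) x : open U -> U x -> Ck 2 U f ->
  partial k (partial l f) x = partial l (partial k f) x.
Proof.
move=> oU Ux [df d2f].
have cont i j : {for x, continuous (partial i (partial j f))}.
  by have [_ /(_ i) /=] := d2f j; apply.
apply/eqP; rewrite -subr_eq0 -normr_le0; apply/ler_addgt0Pr => e e0.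
rewrite add0r; have e2 : 0 < e / 2 by rewrite divr_gt0.
have : \forall y \near x, [/\ U y,
    `|partial k (partial l f) x - partial k (partial l f) y| < e / 2 &
    `|partial l (partial k f) x - partial l (partial k f) y| < e / 2].
  have n1 : \forall y \near x, U y by apply: open_nbhs_nbhs; split.
  have n2 := continuous_near_lt (cont k l) e2.
  have n3 := continuous_near_lt (cont l k) e2.
  by apply: filterS3 n1 n2 n3 => y; split.
case/nbhs_ballP => d /= d0 B.
set a : 'rV[R]_n := delta_mx 0 k; set b : 'rV[R]_n := delta_mx 0 l.
(* with this t the square of side t at x lies in the ball of radius d *)
pose N := `|a| + `|b| + 1; have N0 : 0 < N by rewrite ltr_wpDl// addr_ge0.
pose t := d / N; have t0 : 0 < t by rewrite divr_gt0.
have inB s r : 0 <= s <= t -> 0 <= r <= t -> ball x d (s *: a + (r *: b + x)).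
  move=> /andP[s0 st] /andP[r0 rt].
  rewrite -ball_normE /= addrA opprD [X in _ + X]addrC addrA subrr sub0r normrN.
  apply: le_lt_trans (ler_normD _ _) _; rewrite !normrZ !ger0_norm//.
  apply: (@le_lt_trans _ _ (t * `|a| + t * `|b|)).
    by rewrite lerD// ler_wpM2r.
  rewrite -mulrDr /t mulrAC ltr_pdivrMr// ltr_pM2l// /N.
  by rewrite ltrDl.
have Dkl i j s r : 0 <= s <= t -> 0 <= r <= t ->
    i = a /\ j = b \/ i = b /\ j = a -> U (s *: i + (r *: j + x)).
  move=> st rt [] [-> ->]; last rewrite addrCA.
    by have [] := B _ (inB s r st rt).
  by have [] := B _ (inB r s rt st).
have [s [r [st rt E1]]] := @second_difference k l x t t0 (fun s r st rt =>
   conj (df _ (Dkl _ _ s r st rt (or_introl (conj erefl erefl))))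
     (proj1 (d2f k) _ (Dkl _ _ s r st rt (or_introl (conj erefl erefl))))).
have [s' [r' [st' rt' E2]]] := @second_difference l k x t t0 (fun s r st rt =>
   conj (df _ (Dkl _ _ s r st rt (or_intror (conj erefl erefl))))
     (proj1 (d2f l) _ (Dkl _ _ s r st rt (or_intror (conj erefl erefl))))).
have E : partial k (partial l f) (s' *: b + (r' *: a + x))
       = partial l (partial k f) (s *: a + (r *: b + x)).
  apply: (mulIf (lt0r_neq0 t0)); apply: (mulIf (lt0r_neq0 t0)).
  apply: etrans (esym E2) _; apply: etrans _ E1.
  rewrite [t *: b + (t *: a + x)]addrCA.
  move: (f _) (f _) (f _) (f _) => f1 f2 f3 f4.
  by rewrite !opprB addrACA [RHS]addrACA; congr (_ + _); rewrite addrC.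
have [_ _ B1] := B _ (inB _ _ st rt).
have [_ B2 _] := B _ (inB _ _ rt' st').
rewrite addrCA E in B2.
exact: dist_half_le B2 B1.
Qed.
End Schwarz.

(** * Stability of smoothness *)

Section Smoothness.
Variable R : realType.

Section Ck.
Variable n : nat.
Implicit Types (f g : 'rV[R]_n -> R) (x : 'rV[R]_n) (k : 'I_n).
Implicit Types U V : set 'rV[R]_n.

Lemma near_open U (P : 'rV[R]_n -> Prop) x : open U -> U x ->
  (forall y, U y -> P y) -> \near x, P x.
Proof.
move=> oU Ux UP; have : nbhs x U by apply: open_nbhs_nbhs.
exact: filterS.
Qed.

Lemma Ck_sub m U V f : (forall x, V x -> U x) -> Ck m U f -> Ck m V f.
Proof.
move=> VU; elim: m f => [|m IH] f /= C; first by move=> x /VU; exact: C.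
by case: C => df Cf; split=> [x /VU|k]; [exact: df|exact: IH].
Qed.

Lemma Ck_local m U f :
  (forall x, U x -> exists2 V, V x & Ck m V f) -> Ck m U f.
Proof.
elim: m f => [|m IH] f H; first by move=> x /H[V Vx c]; exact: c.
split=> [x Ux|k]; first by have [V Vx [df _]] := H x Ux; exact: df.
by apply: IH => x /H[V Vx [_ C]]; exists V => //; exact: C.
Qed.

Lemma Ck_ext m U f g : open U -> (forall x, U x -> f x = g x) ->
  Ck m U f -> Ck m U g.
Proof.
move=> oU; elim: m f g => [|m IH] f g fg /=.
  move=> cf x Ux; have c := cf x Ux.
  rewrite /prop_for /continuous_at -(fg x Ux).
  have E : \forall y \near nbhs x, f y = g y by exact: (near_open oU Ux).
  exact: cvg_trans (near_eq_cvg (F := nbhs x) E) c.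
move=> [df Cf]; split=> [x Ux|k].
  by apply: near_eq_differentiable (df x Ux); exact: near_open oU Ux fg.
apply: IH (Cf k) => x Ux; apply: near_partial; exact: near_open oU Ux fg.
Qed.

Lemma CkW m U f : Ck m.+1 U f -> Ck m U f.
Proof.
elim: m f => [|m IH] f [df Cf].
  by move=> x Ux; apply: differentiable_continuous; exact: df.
by split=> // k; exact: IH.
Qed.

Lemma Ck_cst m U c : Ck m U (fun=> c).
Proof.
elim: m c => [|m IH] c /=; first by move=> x _; exact: cst_continuous.
split=> [x _|k]; first exact: differentiable_cst.
suff -> : partial k (fun=> c) = fun=> 0 by [].
by apply/funext => x; rewrite partial_cst.
Qed.

Section OpenSet.
Variable U : set 'rV[R]_n.
Hypothesis oU : open U.

Lemma Ck_add m f g : Ck m U f -> Ck m U g -> Ck m U (fun x => f x + g x).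
Proof.
elim: m f g => [|m IH] f g /=.
  by move=> cf cg x Ux; apply: continuousD; [exact: cf|exact: cg].
move=> [df Cf] [dg Cg]; split=> [x Ux|k].
  by apply: differentiableD; [exact: df|exact: dg].
apply: Ck_ext (IH _ _ (Cf k) (Cg k)) => // x Ux.
by rewrite partialD//; [exact: df|exact: dg].
Qed.

Lemma Ck_mul m f g : Ck m U f -> Ck m U g -> Ck m U (fun x => f x * g x).
Proof.
elim: m f g => [|m IH] f g.
  by move=> cf cg x Ux; apply: continuousM; [exact: cf|exact: cg].
move=> Hf Hg; have [df Cf] := Hf; have [dg Cg] := Hg; split=> [x Ux|k].
  by apply: differentiableM; [exact: df|exact: dg].
have C := Ck_add (IH _ _ (CkW Hf) (Cg k)) (IH _ _ (CkW Hg) (Cf k)).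
apply: Ck_ext C => // x Ux.
by rewrite partialM//; [exact: df|exact: dg].
Qed.

Lemma Ck_inv m f : (forall x, U x -> f x != 0) ->
  Ck m U f -> Ck m U (fun x => (f x)^-1).
Proof.
move=> f0; elim: m => [|m IH].
  by move=> cf x Ux; apply: continuousV; [exact: f0|exact: cf].
move=> Hf; have [df Cf] := Hf; split=> [x Ux|k].
  by apply: differentiableV; [exact: df|exact: f0].
have IHf := IH (CkW Hf).
apply: Ck_ext (Ck_mul (Ck_mul (Ck_mul (Ck_cst m U (-1)) IHf) IHf) (Cf k)) => //.
move=> x Ux; rewrite partialV//; [|exact: f0|exact: df].
by rewrite mulN1r mulNr -invfM -expr2.
Qed.

Lemma differentiable_powR f r x : 0 < f x -> differentiable f x ->
  differentiable (fun y => f y `^ r) x.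
Proof.
move=> f0 df; apply: (@differentiable_comp _ _ _ _ f (fun t => t `^ r)) => //.
by apply/derivable1_diffP; have [] := is_derive1_powR r f0.
Qed.

Lemma partial_powR f r x k : 0 < f x -> differentiable f x ->
  partial k (fun y => f y `^ r) x = r * f x `^ (r - 1) * partial k f x.
Proof.
move=> f0 df; rewrite /partial deriveE; last exact: differentiable_powR.
have D : differentiable (fun t : R => t `^ r) (f x).
  by apply/derivable1_diffP; have [] := is_derive1_powR r f0.
rewrite (@diff_comp _ _ _ _ f (fun t => t `^ r))//= -(deriveE _ df).
rewrite (diff1E D) derive1E.
have [_ ->] := is_derive1_powR r f0.
exact: mulrC.
Qed.

Lemma Ck_powR m r f : (forall x, U x -> 0 < f x) ->
  Ck m U f -> Ck m U (fun x => f x `^ r).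
Proof.
move=> f0; elim: m r => [|m IH] r.
  move=> cf x Ux; apply: (@continuous_comp _ _ _ f (fun t => t `^ r)).
    exact: cf.
  apply/differentiable_continuous/derivable1_diffP.
  by have [] := is_derive1_powR r (f0 x Ux).
move=> Hf; have [df Cf] := Hf; split=> [x Ux|k].
  by apply: differentiable_powR; [exact: f0|exact: df].
apply: Ck_ext (Ck_mul (Ck_mul (Ck_cst m U r) (IH (r - 1) (CkW Hf))) (Cf k)) => //.
by move=> x Ux; rewrite partial_powR//; [exact: f0|exact: df].
Qed.

Lemma Ck_sum m (I : Type) (s : seq I) (P : pred I) (F : I -> 'rV[R]_n -> R) :
  (forall i, P i -> Ck m U (F i)) -> Ck m U (fun x => \sum_(i <- s | P i) F i x).
Proof.
move=> H; elim: s => [|i s IH].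
  by apply: Ck_ext (Ck_cst m U 0) => // x _; rewrite big_nil.
case Pi: (P i).
  by apply: Ck_ext (Ck_add (H i Pi) IH) => // x _; rewrite big_cons Pi.
by apply: Ck_ext IH => // x _; rewrite big_cons Pi.
Qed.

Lemma Ck_prod m (I : Type) (s : seq I) (P : pred I) (F : I -> 'rV[R]_n -> R) :
  (forall i, P i -> Ck m U (F i)) -> Ck m U (fun x => \prod_(i <- s | P i) F i x).
Proof.
move=> H; elim: s => [|i s IH].
  by apply: Ck_ext (Ck_cst m U 1) => // x _; rewrite big_nil.
case Pi: (P i).
  by apply: Ck_ext (Ck_mul (H i Pi) IH) => // x _; rewrite big_cons Pi.
by apply: Ck_ext IH => // x _; rewrite big_cons Pi.
Qed.

Lemma Ck_coord m (j : 'I_n) : Ck m U (fun x => x 0 j).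
Proof.
case: m => [|m]; first by move=> x _; exact: coord_continuous.
split=> [x _|k]; first exact: differentiable_coord.
by apply: Ck_ext (Ck_cst m U (j == k)%:R) => // x _; rewrite partial_coord.
Qed.

End OpenSet.
End Ck.

(** By the chain rule the partial derivatives of the composite are sums of products
    of f' o g with derivatives of g, where f' is a partial derivative of f: the
    induction needs all smooth f at once. *)
Lemma Ck_comp m n p (U : set 'rV[R]_n) (V : set 'rV[R]_p)
    (g : 'rV[R]_n -> 'rV[R]_p) (f : 'rV[R]_p -> R) : open U ->
  (forall x, U x -> V (g x)) -> (forall l, smooth_on U (fun x => g x 0 l)) ->
  smooth_on V f -> Ck m U (fun x => f (g x)).
Proof.
move=> oU UV sg; have dg x : U x -> differentiable g x.
  by move=> Ux; apply: differentiable_rV => l; have [d _] := sg l 1%N; exact: d.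
elim: m f => [|m IH] f sf.
  move=> x Ux; apply: continuous_comp; last exact: (sf 0%N) (UV _ Ux).
  exact/differentiable_continuous/dg.
have [df _] := sf 1%N; split=> [x Ux|k].
  by apply: (@differentiable_comp _ _ _ _ g f); [exact: dg|exact/df/UV].
have sdf l : smooth_on V (partial l f) by move=> q; have [_ C] := sf q.+1; exact: C.
have C l := Ck_mul oU (IH _ (sdf l)) (proj2 (sg l m.+1) k).
apply: Ck_ext (@Ck_sum _ _ oU m _ (index_enum 'I_p) xpredT _ (fun l _ => C l)) => //.
by move=> x Ux; rewrite (@partial_comp _ _ _ g f)//; [exact: dg|exact/df/UV].
Qed.

End Smoothness.

(** * Exterior calculus on open sets *)

Local Opaque partial.
Section SmoothOn.
Variables (R : realType) (n : nat) (U : set 'rV[R]_n).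
Hypothesis oU : open U.
Implicit Types f g : 'rV[R]_n -> R.

Lemma smooth_ext f g : (forall x, U x -> f x = g x) ->
  smooth_on U f -> smooth_on U g.
Proof. by move=> fg sf m; exact: Ck_ext fg (sf m). Qed.

Lemma smooth_cst c : smooth_on U (fun=> c).
Proof. by move=> m; exact: Ck_cst. Qed.

Lemma smooth_add f g : smooth_on U f -> smooth_on U g ->
  smooth_on U (fun x => f x + g x).
Proof. by move=> sf sg m; exact: Ck_add. Qed.

Lemma smooth_mul f g : smooth_on U f -> smooth_on U g ->
  smooth_on U (fun x => f x * g x).
Proof. by move=> sf sg m; exact: Ck_mul. Qed.

Lemma smooth_opp f : smooth_on U f -> smooth_on U (fun x => - f x).
Proof.
move=> sf; apply: smooth_ext (smooth_mul (smooth_cst (-1)) sf) => x _.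
by rewrite mulN1r.
Qed.

Lemma smooth_inv f : (forall x, U x -> f x != 0) ->
  smooth_on U f -> smooth_on U (fun x => (f x)^-1).
Proof. by move=> f0 sf m; exact: Ck_inv. Qed.

Lemma smooth_exp f k : smooth_on U f -> smooth_on U (fun x => f x ^+ k).
Proof.
move=> sf; elim: k => [|k IH].
  by apply: smooth_ext (smooth_cst 1) => x _; rewrite expr0.
by apply: smooth_ext (smooth_mul sf IH) => x _; rewrite exprS.
Qed.

Lemma smooth_powR r f : (forall x, U x -> 0 < f x) ->
  smooth_on U f -> smooth_on U (fun x => f x `^ r).
Proof. by move=> f0 sf m; exact: Ck_powR. Qed.

Lemma smooth_sum (I : Type) (s : seq I) (P : pred I) (F : I -> 'rV[R]_n -> R) :
  (forall i, P i -> smooth_on U (F i)) ->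
  smooth_on U (fun x => \sum_(i <- s | P i) F i x).
Proof. by move=> H m; apply: Ck_sum => // i /H. Qed.

Lemma smooth_prod (I : Type) (s : seq I) (P : pred I) (F : I -> 'rV[R]_n -> R) :
  (forall i, P i -> smooth_on U (F i)) ->
  smooth_on U (fun x => \prod_(i <- s | P i) F i x).
Proof. by move=> H m; apply: Ck_prod => // i /H. Qed.

Lemma smooth_coord j : smooth_on U (fun x => x 0 j).
Proof. by move=> m; exact: Ck_coord. Qed.

Lemma smooth_differentiable f x : smooth_on U f -> U x -> differentiable f x.
Proof. by move=> sf Ux; have [df _] := sf 1%N; exact: df. Qed.

Lemma smooth_partial f k : smooth_on U f -> smooth_on U (partial k f).
Proof. by move=> sf m; have [_ C] := sf m.+1; exact: C. Qed.

Lemma smooth_sub (V : set 'rV[R]_n) f : (forall x, V x -> U x) ->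
  smooth_on U f -> smooth_on V f.
Proof. by move=> VU sf m; exact: Ck_sub (sf m). Qed.

Lemma smooth_local f :
  (forall x, U x -> exists2 V, V x & smooth_on V f) -> smooth_on U f.
Proof.
move=> H m; apply: Ck_local => x /H[V Vx sf].
by exists V => //; exact: sf.
Qed.

Lemma smooth_comp p (V : set 'rV[R]_p) (g : 'rV[R]_n -> 'rV[R]_p)
    (f : 'rV[R]_p -> R) :
  (forall x, U x -> V (g x)) -> (forall l, smooth_on U (fun x => g x 0 l)) ->
  smooth_on V f -> smooth_on U (fun x => f (g x)).
Proof. by move=> UV sg sf m; exact: Ck_comp UV sg sf. Qed.

Lemma smooth_rV_differentiable p (g : 'rV[R]_n -> 'rV[R]_p) x : U x ->
  (forall l, smooth_on U (fun y => g y 0 l)) -> differentiable g x.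
Proof.
by move=> Ux sg; apply: differentiable_rV => l; exact: smooth_differentiable.
Qed.

Lemma smooth_det p (A : 'rV[R]_n -> 'M[R]_p) :
  (forall i j, smooth_on U (fun x => A x i j)) -> smooth_on U (fun x => \det (A x)).
Proof.
move=> sA; apply: smooth_sum => s _; apply: smooth_mul; first exact: smooth_cst.
by apply: smooth_prod => i _.
Qed.

(** By Cramer's rule the inverse is the adjugate divided by the determinant. *)
Lemma smooth_invmx p (A : 'rV[R]_n -> 'M[R]_p) :
  (forall x, U x -> A x \in unitmx) ->
  (forall i j, smooth_on U (fun x => A x i j)) ->
  forall i j, smooth_on U (fun x => invmx (A x) i j).
Proof.
move=> uA sA i j.
have s : smooth_on U (fun x => (\det (A x))^-1 * \adj (A x) i j).
  apply: smooth_mul; first apply: smooth_inv.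
  - by move=> x /uA; rewrite unitmxE unitfE.
  - exact: smooth_det.
  - apply: (@smooth_ext (fun x => (-1) ^+ (j + i) * \det (row' j (col' i (A x))))).
      by move=> x _; rewrite mxE.
    apply: smooth_mul; first exact: smooth_cst.
    apply: smooth_det => k l; apply: (@smooth_ext (fun x => A x (lift j k) (lift i l))).
      by move=> x _; rewrite !mxE.
    exact: sA.
apply: smooth_ext s => x Ux.
by rewrite /invmx (uA x Ux) [RHS]mxE.
Qed.

End SmoothOn.

Section Wedge.
Variables (R : realType) (n : nat).
Implicit Types (a b c : 'rV[R]_n) (r : R).

Lemma wedgeE a b k l : (a ∧ b) k l = a 0 k * b 0 l - b 0 k * a 0 l.
Proof. by rewrite !mxE !big_ord1 !mxE. Qed.

Lemma wedgeDl a b c : (a + b) ∧ c = a ∧ c + b ∧ c.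
Proof. by apply/matrixP => k l; rewrite wedgeE [RHS]mxE !wedgeE !mxE; ring. Qed.

Lemma wedgeDr a b c : c ∧ (a + b) = c ∧ a + c ∧ b.
Proof. by apply/matrixP => k l; rewrite wedgeE [RHS]mxE !wedgeE !mxE; ring. Qed.

Lemma wedgeZl r a c : (r *: a) ∧ c = r *: (a ∧ c).
Proof. by apply/matrixP => k l; rewrite wedgeE [RHS]mxE !wedgeE !mxE; ring. Qed.

Lemma wedgeZr r a c : c ∧ (r *: a) = r *: (c ∧ a).
Proof. by apply/matrixP => k l; rewrite wedgeE [RHS]mxE !wedgeE !mxE; ring. Qed.

Lemma wedgeC a b : a ∧ b = - (b ∧ a).
Proof. by apply/matrixP => k l; rewrite wedgeE [RHS]mxE !wedgeE; ring. Qed.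

Lemma wedgexx a : a ∧ a = 0.
Proof. by apply/matrixP => k l; rewrite wedgeE [RHS]mxE; ring. Qed.

Lemma wedgeNl a b : (- a) ∧ b = - (a ∧ b).
Proof. by rewrite -scaleN1r wedgeZl scaleN1r. Qed.

Lemma wedgeNr a b : b ∧ (- a) = - (b ∧ a).
Proof. by rewrite -scaleN1r wedgeZr scaleN1r. Qed.

Lemma wedge0l a : 0 ∧ a = 0.
Proof. by rewrite -(scale0r 0) wedgeZl scale0r. Qed.

Lemma wedge_mulmx m a b (P : 'M[R]_(n, m)) :
  (a *m P) ∧ (b *m P) = P^T *m (a ∧ b) *m P.
Proof. by rewrite /wedge !trmx_mul mulmxBr mulmxBl !mulmxA. Qed.

End Wedge.

Section Forms.
Variables (R : realType) (n : nat).
Implicit Types (f g : 'rV[R]_n -> R) (x : 'rV[R]_n) (a b : 'rV[R]_n -> 'rV[R]_n).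

Lemma near_dfun f g x : (\near x, f x = g x) -> dfun f x = dfun g x.
Proof. by move=> fg; apply/rowP => k; rewrite !mxE; exact: near_partial. Qed.

Lemma dfun_cst c x : dfun (fun=> c) x = 0.
Proof. by apply/rowP => k; rewrite !mxE partial_cst. Qed.

Lemma dfunD f g x : differentiable f x -> differentiable g x ->
  dfun (fun y => f y + g y) x = dfun f x + dfun g x.
Proof. by move=> df dg; apply/rowP => k; rewrite !mxE partialD. Qed.

Lemma dfunM f g x : differentiable f x -> differentiable g x ->
  dfun (fun y => f y * g y) x = f x *: dfun g x + g x *: dfun f x.
Proof. by move=> df dg; apply/rowP => k; rewrite !mxE partialM. Qed.

Lemma dfunV f x : f x != 0 -> differentiable f x ->
  dfun (fun y => (f y)^-1) x = - (f x) ^- 2 *: dfun f x.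
Proof. by move=> f0 df; apply/rowP => k; rewrite !mxE partialV. Qed.

Lemma dfun_powR f r x : 0 < f x -> differentiable f x ->
  dfun (fun y => f y `^ r) x = (r * f x `^ (r - 1)) *: dfun f x.
Proof. by move=> f0 df; apply/rowP => k; rewrite !mxE partial_powR. Qed.

Lemma dfun_coord j x : dfun (fun y => y 0 j) x = delta_mx 0 j.
Proof. by apply/rowP => k; rewrite !mxE partial_coord eqxx eq_sym. Qed.

Lemma dfun_comp m (h : 'rV[R]_n -> 'rV[R]_m) (f : 'rV[R]_m -> R) x :
  differentiable h x -> differentiable f (h x) ->
  dfun (fun y => f (h y)) x = dfun f (h x) *m (jacobian h x)^T.
Proof.
move=> dh df; apply/rowP => k; rewrite !mxE (partial_comp _ dh df).
by apply: eq_bigr => l _; rewrite !mxE -jacobianE// mxE.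
Qed.

Lemma jacobian_comp m p (h : 'rV[R]_n -> 'rV[R]_m) (f : 'rV[R]_m -> 'rV[R]_p) x :
  differentiable h x -> differentiable f (h x) ->
  jacobian (fun y => f (h y)) x = jacobian h x *m jacobian f (h x).
Proof.
move=> dh df; apply/matrixP => k l; rewrite jacobianE; last first.
  exact: (@differentiable_comp _ _ _ _ h f).
have dfl : differentiable (fun z => f z 0 l) (h x).
  exact: differentiable_comp_coord.
rewrite (@partial_comp _ _ _ h (fun z => f z 0 l) _ _ dh dfl) mxE.
by apply: eq_bigr => j _; rewrite mulrC !jacobianE.
Qed.

Lemma near_jacobian m (h h' : 'rV[R]_n -> 'rV[R]_m) x :
  differentiable h x ->
  (\forall y \near x, h y = h' y) -> jacobian h x = jacobian h' x.
Proof.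
move=> dh E; have dh' := near_eq_differentiable E dh.
apply/matrixP => k l; apply: etrans (jacobianE k l dh) _.
apply: etrans _ (esym (jacobianE k l dh')).
apply: near_partial.
by apply: filterS E => y ->.
Qed.

Lemma near_dform a b x : (\forall y \near x, a y = b y) -> dform a x = dform b x.
Proof.
move=> ab; apply/matrixP => k l; rewrite !mxE.
by congr (_ - _); apply: near_partial; apply: filterS ab => y ->.
Qed.

Lemma dformD a b x : differentiable a x -> differentiable b x ->
  dform (fun y => a y + b y) x = dform a x + dform b x.
Proof.
move=> da db; apply/matrixP => k l; rewrite !mxE.
have E i j : partial i (fun y => (a y + b y) 0 j) x =
    partial i (fun y => a y 0 j) x + partial i (fun y => b y 0 j) x.
  rewrite -partialD//; [|exact: differentiable_comp_coord..].
  by apply: near_partial; apply: filterE => y; rewrite mxE.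
by rewrite !E; ring.
Qed.

Lemma dformZ f a x : differentiable f x -> differentiable a x ->
  dform (fun y => f y *: a y) x = dfun f x ∧ a x + f x *: dform a x.
Proof.
move=> df da; apply/matrixP => k l; rewrite [RHS]mxE wedgeE !mxE.
have E i j : partial i (fun y => (f y *: a y) 0 j) x =
    f x * partial i (fun y => a y 0 j) x + a x 0 j * partial i f x.
  rewrite -partialM//; last exact: differentiable_comp_coord.
  by apply: near_partial; apply: filterE => y; rewrite mxE.
by rewrite !E; ring.
Qed.

Lemma dform_cst c x : dform (fun=> c) x = 0.
Proof. by apply/matrixP => k l; rewrite !mxE !partial_cst subrr. Qed.

Lemma dform_sum m (F : 'I_m -> 'rV[R]_n -> 'rV[R]_n) x :
  (forall i, differentiable (F i) x) ->
  dform (fun y => \sum_(i < m) F i y) x = \sum_(i < m) dform (F i) x.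
Proof.
move=> dF; elim: m F dF => [|m IH] F dF.
  rewrite big_ord0 -(dform_cst 0 x); apply: near_dform; apply: filterE => y.
  by rewrite big_ord0.
rewrite big_ord_recr/= -(IH (fun i => F (widen_ord (leqnSn m) i)))// -dformD//.
  by apply: near_dform; apply: filterE => y; rewrite big_ord_recr.
rewrite (_ : (fun y => _) = \sum_(i < m) F (widen_ord (leqnSn m) i)).
  exact: differentiable_sum.
by apply/funext => y; rewrite fct_sumE.
Qed.

(** This is the symmetry of the second partial derivatives. *)
Lemma dform_dfun (U : set 'rV[R]_n) f x : open U -> U x -> smooth_on U f ->
  dform (dfun f) x = 0.
Proof.
move=> oU Ux sf; apply/matrixP => k l; rewrite !mxE.
have E i j : partial i (fun y => dfun f y 0 j) x = partial i (partial j f) x.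
  by apply: near_partial; apply: filterE => y; rewrite mxE.
by rewrite !E (partialC k l oU Ux (sf 2%N)) subrr.
Qed.

End Forms.

Section Pull.
Variables (R : realType) (n m : nat).

Lemma pullE (g : 'rV[R]_n -> 'rV[R]_m) (a : 'rV[R]_m -> 'rV[R]_m) x :
  differentiable g x ->
  pull g a x = \sum_l a (g x) 0 l *: dfun (fun y => g y 0 l) x.
Proof.
move=> dg; apply/rowP => k; rewrite summxE mxE; apply: eq_bigr => l _.
rewrite [RHS]mxE; congr (_ * _); rewrite [LHS]mxE [RHS]mxE.
exact: jacobianE.
Qed.

(** The pull-back is the sum of the (a_l o g) dg_l.  As d(dg_l) = 0, only the terms
    d(a_l o g) ∧ dg_l remain, and the chain rule expresses them by the Jacobian. *)
Lemma dform_pull (U : set 'rV[R]_n) (V : set 'rV[R]_m)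
    (g : 'rV[R]_n -> 'rV[R]_m) (a : 'rV[R]_m -> 'rV[R]_m) x :
  open U -> U x -> (forall y, U y -> V (g y)) ->
  (forall l, smooth_on U (fun y => g y 0 l)) ->
  (forall l, smooth_on V (fun y => a y 0 l)) ->
  (forall y, V y -> differentiable a y) ->
  dform (pull g a) x = jacobian g x *m dform a (g x) *m (jacobian g x)^T.
Proof.
move=> oU Ux UV sg sa da.
have dg y : U y -> differentiable g y.
  by move=> Uy; apply: (smooth_rV_differentiable Uy).
have sag l : smooth_on U (fun y => a (g y) 0 l).
  exact: (smooth_comp oU UV sg (sa l)).
have sdg l k : smooth_on U (fun y => dfun (fun y => g y 0 l) y 0 k).
  apply: (smooth_ext oU _ (smooth_partial k (sg l))) => y _.
  by rewrite mxE.
rewrite (@near_dform _ _ _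
  (fun y => \sum_l a (g y) 0 l *: dfun (fun y => g y 0 l) y)); last first.
  by apply: (near_open oU Ux) => y Uy; rewrite pullE//; exact: dg.
have dag l : differentiable (fun y => a (g y) 0 l) x.
  exact: (smooth_differentiable (sag l) Ux).
have ddg l : differentiable (dfun (fun y => g y 0 l)) x.
  exact: (smooth_rV_differentiable Ux (sdg l)).
rewrite dform_sum; last first.
  move=> l; apply: (smooth_rV_differentiable Ux) => k.
  apply: (smooth_ext oU _ (smooth_mul oU (sag l) (sdg l k))) => y _.
  by rewrite [RHS]mxE.
under eq_bigr => l _.
  rewrite dformZ// (dform_dfun oU Ux (sg l)) scaler0 addr0.
  rewrite (@dfun_comp _ _ _ g (fun z => a z 0 l) x (dg x Ux)); last first.
    by apply: differentiable_comp_coord; apply/da/UV.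
  over.
under eq_bigr => l _.
  have -> : dfun (fun y => g y 0 l) x = (col l (jacobian g x))^T.
    apply/rowP => k; rewrite [LHS]mxE [RHS]mxE [RHS]mxE.
    by apply: esym; exact: jacobianE (dg x Ux).
  over.
move: (jacobian g x) (g x) => J z.
rewrite /dform.
apply/matrixP => i j; rewrite summxE.
under eq_bigr do rewrite wedgeE !mxE.
have E p q (M : 'M[R]_(p, q)) (A : 'M[R]_q) i' j' :
    (M *m A *m M^T) i' j' = \sum_k \sum_l M i' k * A k l * M j' l.
  rewrite mxE exchange_big/=; apply: eq_bigr => l _.
  by rewrite mxE big_distrl/=; apply: eq_bigr => k _; rewrite mxE.
rewrite E sumrB.
under [RHS]eq_bigr => k _.
  under eq_bigr => l _ do rewrite mxE mulrBr mulrBl.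
  rewrite sumrB; over.
rewrite sumrB [in RHS]exchange_big/=; congr (_ - _); apply: eq_bigr => l _.
  rewrite mulr_suml; apply: eq_bigr => k _; rewrite !mxE; ring.
rewrite mulr_sumr; apply: eq_bigr => k _; rewrite !mxE; ring.
Qed.
End Pull.

(** * Functions and forms in charts *)

Section Charts.
Variable R : realType.

(** What local computations use of an atlas; it passes to products with open sets. *)
Definition chart_ok n (X : charted R n) : Prop :=
  (forall i : ix X, open (img i)) /\
  (forall (i : ix X) p, dom i p -> psi i (@phi R n X i p) = p).

(** Smoothness read in charts, where the openness of the overlaps takes the place
    of continuity. *)
Definition chart_smooth n m (X : charted R n) (Y : charted R m) (F : X -> Y) :=
  forall (i : ix X) (j : ix Y),
    open [set x | img i x /\ dom j (F (psi i x))] /\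
    forall k, smooth_on [set x | img i x /\ dom j (F (psi i x))]
                (fun x => phi j (F (psi i x)) 0 k).

Section OneSpace.
Variables (n : nat) (X : charted R n).
Hypothesis okX : chart_ok X.

Lemma img_open (i : ix X) : open (img i).
Proof. by case: okX. Qed.

Lemma psiK (i : ix X) p : dom i p -> psi i (@phi R n X i p) = p.
Proof. by case: okX => _; apply. Qed.

Lemma img_phi (i : ix X) p : dom i p -> img i (phi i p).
Proof. by exists p. Qed.

Lemma img_dom (i : ix X) x : img i x -> dom i (psi i x).
Proof. by move=> [p dp <-]; rewrite psiK. Qed.

Lemma phiK (i : ix X) x : img i x -> phi i (psi i x) = x.
Proof. by move=> [p dp <-]; rewrite psiK. Qed.

Lemma carrier_psi (i : ix X) x : img i x -> carrier (psi i x).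
Proof. by move=> /img_dom dx; exists i. Qed.

Lemma carrierE (p : X) : carrier p -> exists (i : ix X) x, img i x /\ psi i x = p.
Proof.
by move=> [i dp]; exists i, (phi i p); split; [exact: img_phi|exact: psiK].
Qed.

Lemma smooth_fun_ext (f g : X -> R) : (forall p, carrier p -> f p = g p) ->
  smooth_fun f -> smooth_fun g.
Proof.
move=> fg sf i; apply: (smooth_ext (@img_open i) _ (sf i)) => x ix.
by rewrite fg//; exact: carrier_psi.
Qed.

Lemma smooth_fun_cst c : smooth_fun (fun=> c : R) (X := X).
Proof. by move=> i; exact: smooth_cst. Qed.

Lemma smooth_funD (f g : X -> R) : smooth_fun f -> smooth_fun g ->
  smooth_fun (fun p => f p + g p).
Proof. by move=> sf sg i; apply: (smooth_add (@img_open i)); [exact: sf|exact: sg]. Qed.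

Lemma smooth_funM (f g : X -> R) : smooth_fun f -> smooth_fun g ->
  smooth_fun (fun p => f p * g p).
Proof. by move=> sf sg i; apply: (smooth_mul (@img_open i)); [exact: sf|exact: sg]. Qed.

Lemma smooth_funN (f : X -> R) : smooth_fun f -> smooth_fun (fun p => - f p).
Proof. by move=> sf i; apply: (smooth_opp (@img_open i)); exact: sf. Qed.

Lemma smooth_funX (f : X -> R) k : smooth_fun f -> smooth_fun (fun p => f p ^+ k).
Proof. by move=> sf i; apply: (smooth_exp (@img_open i)); exact: sf. Qed.

Lemma smooth_funV (f : X -> R) : (forall p, carrier p -> f p != 0) ->
  smooth_fun f -> smooth_fun (fun p => (f p)^-1).
Proof.
move=> f0 sf i; apply: (smooth_inv (@img_open i)); last exact: sf.
by move=> x /carrier_psi; exact: f0.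
Qed.

Lemma smooth_fun_powR (f : X -> R) r : (forall p, carrier p -> 0 < f p) ->
  smooth_fun f -> smooth_fun (fun p => f p `^ r).
Proof.
move=> f0 sf i; apply: (smooth_powR (@img_open i)); last exact: sf.
by move=> x /carrier_psi; exact: f0.
Qed.

Lemma smooth_fun_diff (f : X -> R) (i : ix X) x : smooth_fun f -> img i x ->
  differentiable (fun y => f (psi i y)) x.
Proof. by move=> sf ix; exact: smooth_differentiable (sf i) ix. Qed.

(** The sign of f is f (f^2)^(-1/2). *)
Lemma smooth_fun_sg (f : X -> R) : (forall p, carrier p -> f p != 0) ->
  smooth_fun f -> smooth_fun (fun p => Num.sg (f p)).
Proof.
move=> f0 sf; have s2 := smooth_funX 2 sf.
have f2 p : carrier p -> 0 < f p ^+ 2 by move=> /f0; rewrite exprn_even_gt0.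
apply: smooth_fun_ext (smooth_funM sf (smooth_fun_powR (- 2^-1) f2 s2)) => p cp.
rewrite powRN powR12_sqrt ?sqr_ge0// sqrtr_sqr.
by rewrite {1}[f p]numEsg mulfK// normr_eq0; exact: f0.
Qed.

Definition dF (f : X -> R) : form1 X := fun i x => dfun (fun y => f (psi i y)) x.

(** Indeed 0 = d(e^2) = 2 e de. *)
Lemma dF_sqr1 (e : X -> R) : smooth_fun e -> (forall p, carrier p -> e p ^+ 2 = 1) ->
  forall (i : ix X) x, img i x -> dF e i x = 0.
Proof.
move=> se e1 i x xi; have de := smooth_fun_diff se xi.
have : dfun (fun y => e (psi i y) * e (psi i y)) x = 0.
  rewrite -(dfun_cst 1 x); apply: near_dfun; apply: (near_open (@img_open i) xi).
  by move=> y /carrier_psi /e1; rewrite expr2.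
rewrite dfunM// -scalerDl => /eqP; rewrite scaler_eq0.
case/orP => [|/eqP //]; rewrite -mulr2n mulrn_eq0/= => /eqP E; have := e1 _ (carrier_psi xi).
by rewrite E expr2 mul0r => /eqP; rewrite eq_sym oner_eq0.
Qed.

End OneSpace.
Arguments img_open {n X} okX i.

Section Pullback.
Variables (n m : nat) (X : charted R n) (Y : charted R m) (F : X -> Y).
Hypotheses (okX : chart_ok X) (okY : chart_ok Y).
Implicit Types (a b : form1 Y).

Lemma is_pullback_eq a a' (b b' : form1 X) : form_eq a a' -> form_eq b b' ->
  is_pullback F a b -> is_pullback F a' b'.
Proof.
move=> aa bb h i j x xi xj; rewrite -bb// (h i j)// /pull aa//.
exact: img_phi.
Qed.

Lemma is_pullbackD a a' (b b' : form1 X) : is_pullback F a b -> is_pullback F a' b' ->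
  is_pullback F (fun j z => a j z + a' j z) (fun i x => b i x + b' i x).
Proof.
by move=> h h' i j x xi xj; rewrite (h i j)// (h' i j)// /pull mulmxDl.
Qed.

Lemma is_pullbackM a (b : form1 X) (f : Y -> R) : is_pullback F a b ->
  is_pullback F (fun j z => f (psi j z) *: a j z) (fun i x => f (F (psi i x)) *: b i x).
Proof.
move=> h i j x xi xj; rewrite (h i j)// /pull scalemxAl psiK//.
Qed.

Lemma is_pullback_sum k (a : 'I_k -> form1 Y) (b : 'I_k -> form1 X) :
  (forall l, is_pullback F (a l) (b l)) ->
  is_pullback F (fun j z => \sum_l a l j z) (fun i x => \sum_l b l i x).
Proof.
move=> h i j x xi xj; rewrite /pull mulmx_suml; apply: eq_bigr => l _.
by rewrite (h l i j).
Qed.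

Hypothesis sF : chart_smooth F.

Lemma chart_smooth_diff (i : ix X) (j : ix Y) x : img i x -> dom j (F (psi i x)) ->
  differentiable (fun y => phi j (F (psi i y))) x.
Proof.
by move=> xi xj; have [_ s] := sF i j; exact: (smooth_rV_differentiable _ s).
Qed.

Lemma is_pullback_dF (f : Y -> R) : smooth_fun f ->
  is_pullback F (dF f) (dF (fun p => f (F p))).
Proof.
move=> sf i j x xi xj; have [oW s] := sF i j.
have xj' := img_phi xj.
rewrite /pull /dF -(@dfun_comp _ _ _ _ (fun y => f (psi j y))).
- apply: near_dfun; apply: (near_open oW (conj xi xj)) => y [yi yj].
  by rewrite psiK.
- exact: chart_smooth_diff.
- exact: smooth_fun_diff.
Qed.

Lemma smooth_fun_comp (f : Y -> R) : (forall p, carrier p -> carrier (F p)) ->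
  smooth_fun f -> smooth_fun (fun p => f (F p)).
Proof.
move=> cF sf i; apply: smooth_local => x xi.
have [j xj] := cF _ (carrier_psi okX xi); have [oW s] := sF i j.
exists [set x | img i x /\ dom j (F (psi i x))] => //.
apply: (smooth_ext oW _ (smooth_comp oW _ s (sf j))) => y [yi yj].
  by rewrite psiK.
exact: img_phi.
Qed.

Lemma dform_is_pullback a (b : form1 X) (i : ix X) (j : ix Y) x :
  (forall j k, smooth_on (img j) (fun z => a j z 0 k)) -> is_pullback F a b ->
  img i x -> dom j (F (psi i x)) ->
  let J := jacobian (fun y => phi j (F (psi i y))) x in
  dform (b i) x = J *m dform (a j) (phi j (F (psi i x))) *m J^T.
Proof.
move=> sa h xi xj J; have [oW s] := sF i j.
rewrite -(@dform_pull _ _ _ _ (img j) _ _ _ oW (conj xi xj) _ s (sa j)).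
- apply: near_dform; apply: (near_open oW (conj xi xj)) => y [yi yj].
  exact: h.
- by move=> y [yi yj]; exact: img_phi.
- move=> y yj; apply: (smooth_rV_differentiable yj) => k; exact: sa.
Qed.

End Pullback.

Section SmoothForm.
Variables (n : nat) (X : charted R n).
Hypotheses (okX : chart_ok X) (idX : chart_smooth (@idfun X)).
Implicit Types (a b : form1 X).

Lemma smooth_form_eq a b : form_eq a b -> smooth_form a -> smooth_form b.
Proof.
move=> ab [sa ca]; split; last exact: is_pullback_eq ca.
move=> i k; apply: (smooth_ext (img_open okX _) _ (sa i k)) => x xi.
by rewrite ab.
Qed.

Lemma smooth_formD a b : smooth_form a -> smooth_form b ->
  smooth_form (fun i x => a i x + b i x).
Proof.
move=> [sa ca] [sb cb]; split; last exact: is_pullbackD.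
move=> i k; apply: (smooth_ext (img_open okX _) _ (smooth_add (img_open okX _) (sa i k) (sb i k))).
by move=> x xi; rewrite mxE.
Qed.

Lemma smooth_formM (f : X -> R) a : smooth_fun f -> smooth_form a ->
  smooth_form (fun i x => f (psi i x) *: a i x).
Proof.
move=> sf [sa ca]; split; last exact: is_pullbackM.
move=> i k; apply: (smooth_ext (img_open okX _) _ (smooth_mul (img_open okX _) (sf i) (sa i k))).
by move=> x xi; rewrite mxE.
Qed.

Lemma smooth_form_dF (f : X -> R) : smooth_fun f -> smooth_form (dF f).
Proof.
move=> sf; split; last exact: (is_pullback_dF okX idX sf).
move=> i k; apply: (smooth_ext (img_open okX _) _ (smooth_partial k (sf i))) => x xi.
by rewrite mxE.
Qed.

Lemma smooth_form_diff a (i : ix X) x : smooth_form a -> img i x ->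
  differentiable (a i) x.
Proof. by move=> [sa _] xi; apply: (smooth_rV_differentiable xi) => k; exact: sa. Qed.

Lemma dform_dF (f : X -> R) (i : ix X) x : smooth_fun f -> img i x ->
  dform (dF f i) x = 0.
Proof. by move=> sf xi; apply: (dform_dfun (img_open okX _) xi (sf i)). Qed.

Lemma near_form_eq a b (i : ix X) x : form_eq a b -> img i x ->
  dform (a i) x = dform (b i) x.
Proof.
move=> ab xi; apply: near_dform; apply: (near_open (img_open okX _) xi) => y yi.
exact: ab.
Qed.

End SmoothForm.

Section ExteriorDerivative.
Variables (n : nat) (X : charted R n).
Hypothesis okX : chart_ok X.
Implicit Types b c : form1 X.

Definition has_dform b (db : ix X -> 'rV[R]_n -> 'M[R]_n) : Prop :=
  smooth_form b /\ forall (i : ix X) x, img i x -> dform (b i) x = db i x.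

Lemma has_dformD b c db dc : has_dform b db -> has_dform c dc ->
  has_dform (fun i x => b i x + c i x) (fun i x => db i x + dc i x).
Proof.
move=> [sb hb] [sc hc]; split; first exact: smooth_formD.
move=> i x xi; rewrite dformD ?hb ?hc//; exact: smooth_form_diff.
Qed.

Lemma has_dformM (f : X -> R) b db : smooth_fun f -> has_dform b db ->
  has_dform (fun i x => f (psi i x) *: b i x)
            (fun i x => dF f i x ∧ b i x + f (psi i x) *: db i x).
Proof.
move=> sf [sb hb]; split; first exact: smooth_formM.
move=> i x xi; rewrite dformZ ?hb//; first exact: smooth_fun_diff sf xi.
exact: smooth_form_diff.
Qed.

Lemma has_dform_ext b c db dc : form_eq b c ->
  (forall (i : ix X) x, img i x -> db i x = dc i x) -> has_dform b db -> has_dform c dc.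
Proof.
move=> bc dd [sb hb]; split; first exact: smooth_form_eq bc sb.
by move=> i x xi; rewrite -dd// -hb//; apply/esym/(near_form_eq okX bc xi).
Qed.

End ExteriorDerivative.

End Charts.
Arguments img_open {R n X} okX i : rename.

(** * Products with an open subset of R^k *)

Section ManifoldCharts.
Variable R : realType.

Lemma manifold_chart_ok n (X : charted R n) : is_manifold X -> chart_ok X.
Proof.
case=> _ _ o [p _] _; split=> [i|i q dq]; first by case: (o i).
by have [] := p i q dq.
Qed.

Lemma open_overlap n m (X : charted R n) (Y : charted R m) (F : X -> Y)
    (i : ix X) (j : ix Y) : is_manifold X -> is_manifold Y ->
  (forall p, carrier p -> {for p, continuous F}) ->
  open [set x | img i x /\ dom j (F (psi i x))].
Proof.
move=> mX mY cF; have okX := manifold_chart_ok mX.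
have [_ _ _ [_ cpsi] _] := mX; have [_ _ oY _ _] := mY.
rewrite openE => x [xi xj]; rewrite /interior.
have c : {for x, continuous (F \o @psi R n X i)}.
  by apply: continuous_comp; [exact: cpsi|exact/cF/(carrier_psi okX)].
have n1 : nbhs x (img i) by apply: open_nbhs_nbhs; split => //; exact: img_open.
have n2 : nbhs x ((F \o @psi R n X i) @^-1` dom j).
  by apply: c; apply: open_nbhs_nbhs; split => //; case: (oY j).
exact: filterI n1 n2.
Qed.

Lemma smooth_map_charts n m (X : charted R n) (Y : charted R m) (F : X -> Y) :
  is_manifold X -> is_manifold Y -> smooth_map F -> chart_smooth F.
Proof.
move=> mX mY [cF sF] i j; split; last exact: sF.
by apply: open_overlap => // p /cF[].
Qed.

Lemma chart_smooth_id n (X : charted R n) : is_manifold X -> chart_smooth (@idfun X).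
Proof.
move=> mX i j; split.
  by apply: open_overlap => // p _; move=> A; exact: id.
move=> k; have [_ _ _ _ t] := mX; apply: smooth_sub (t i j k) => x [xi xj].
have okX := manifold_chart_ok mX.
exists (psi i x); last exact: phiK.
by split => //; exact: img_dom.
Qed.

Section Product.
Variables (n k : nat) (X : charted R n) (V : set 'rV[R]_k).
Hypotheses (okX : chart_ok X) (oV : open V).
Let P : charted R (n + k) := prod_charted X V.

Lemma img_prod (i : ix P) y :
  img i y <-> @img R n X i (lsubmx y) /\ V (rsubmx y).
Proof.
split=> [[[p v] [/= dp Vv] <-]|[[p dp pE] Vy]].
  by rewrite row_mxKl row_mxKr; split=> //; exists p.
by exists (p, rsubmx y) => //=; rewrite pE hsubmxK.
Qed.

Lemma open_lsubmx_preimage (A : set 'rV[R]_n) : open A ->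
  open [set y : 'rV[R]_(n + k) | A (lsubmx y)].
Proof. by move=> oA; apply: (open_comp _ oA) => y _; exact: continuous_lsubmx. Qed.

Lemma open_rsubmx_preimage (A : set 'rV[R]_k) : open A ->
  open [set y : 'rV[R]_(n + k) | A (rsubmx y)].
Proof. by move=> oA; apply: (open_comp _ oA) => y _; exact: continuous_rsubmx. Qed.

Lemma prod_chart_ok : chart_ok P.
Proof.
split=> [i|i [p v] [/= dp _]]; last by rewrite row_mxKl row_mxKr psiK.
rewrite (_ : img i = [set y | @img R n X i (lsubmx y)] `&` [set y | V (rsubmx y)]).
  by apply: openI; [apply: open_lsubmx_preimage; exact: img_open|exact: open_rsubmx_preimage].
by apply/seteqP; split=> y /img_prod.
Qed.

Lemma carrier_prod (q : P) : carrier q <-> @carrier R n X q.1 /\ V q.2.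
Proof.
split=> [[i [/= d v]]|[[i d] v]]; last by exists i.
by split=> //; exists i.
Qed.

Lemma jacobian_lsubmx (y : 'rV[R]_(n + k)) :
  jacobian (lsubmx : _ -> 'rV[R]_n) y = col_mx 1%:M 0.
Proof.
apply/matrixP => a b; rewrite (jacobianE _ _ (differentiable_lsubmx y)).
rewrite (_ : (fun y => _) = fun y : 'rV[R]_(n + k) => y 0 (lshift k b)); last first.
  by apply/funext => z; rewrite mxE.
rewrite partial_coord; case: (split_ordP a) => c ->.
  by rewrite col_mxEu mxE (inj_eq (@lshift_inj _ _)) eq_sym.
by rewrite col_mxEd mxE eq_lrshift.
Qed.

Lemma smooth_lsubmx (U : set 'rV[R]_(n + k)) (l : 'I_n) : open U ->
  smooth_on U (fun y => lsubmx y 0 l).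
Proof.
move=> oU; apply: (smooth_ext oU _ (smooth_coord oU (lshift k l))) => y _.
by rewrite mxE.
Qed.

Lemma smooth_rsubmx (U : set 'rV[R]_(n + k)) (l : 'I_k) : open U ->
  smooth_on U (fun y => rsubmx y 0 l).
Proof.
move=> oU; apply: (smooth_ext oU _ (smooth_coord oU (rshift n l))) => y _.
by rewrite mxE.
Qed.

Lemma smooth_fun_fst (f : X -> R) : smooth_fun f -> smooth_fun (fun q : P => f q.1).
Proof.
move=> sf i; have oi := img_open prod_chart_ok i.
apply: (smooth_comp oi _ _ (sf i)) => [y /img_prod[]|l] //.
exact: smooth_lsubmx.
Qed.

Lemma smooth_fun_snd (l : 'I_k) : smooth_fun (fun q : P => q.2 0 l).
Proof. move=> i; exact: (smooth_rsubmx l (img_open prod_chart_ok i)). Qed.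

(** The pull-back of a form by the projection to the first factor. *)
Definition lift_form (a : form1 X) : form1 P := fun i y => row_mx (a i (lsubmx y)) 0.

Lemma liftE a i y : lift_form a i y = a i (lsubmx y) *m (col_mx 1%:M 0)^T.
Proof. by rewrite tr_col_mx trmx1 trmx0 mul_mx_row mulmx1 mulmx0. Qed.

Lemma lift_sum m (a : 'I_m -> form1 X) i y :
  lift_form (fun i x => \sum_l a l i x) i y = \sum_l lift_form (a l) i y.
Proof.
by rewrite liftE mulmx_suml; apply: eq_bigr => l _; rewrite liftE.
Qed.

Lemma dform_lift a (i : ix P) y : smooth_form a -> img i y ->
  dform (lift_form a i) y = col_mx 1%:M 0 *m dform (a i) (lsubmx y) *m (col_mx 1%:M 0)^T.
Proof.
move=> [sa _] yi; have oi := img_open prod_chart_ok i; rewrite -(jacobian_lsubmx y).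
rewrite -(@dform_pull _ _ _ _ (@img _ _ X i) _ _ _ oi yi _ _ (sa i)).
- apply: near_dform; apply: filterE => z.
  by rewrite liftE /pull jacobian_lsubmx.
- by move=> z /img_prod[].
- by move=> l; exact: smooth_lsubmx.
- by move=> z zi; apply: (smooth_rV_differentiable zi).
Qed.

Lemma dF_fst (f : X -> R) (i : ix P) y : smooth_fun f -> img i y ->
  dF (fun q : P => f q.1) i y = lift_form (dF f) i y.
Proof.
move=> sf yi; rewrite liftE -(jacobian_lsubmx y) /dF.
have [yi' _] := (img_prod _ _).1 yi.
rewrite -(@dfun_comp _ _ _ _ (fun x => f (@psi R n X i x)))//.
  exact: differentiable_lsubmx.
exact: smooth_fun_diff.
Qed.

End Product.

Section ProductMap.
Variables (n k m l : nat) (X : charted R n) (V : set 'rV[R]_k).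
Variables (Y : charted R m) (W : set 'rV[R]_l).
Hypotheses (okX : chart_ok X) (oV : open V) (okY : chart_ok Y) (oW : open W).
Variables (F : X -> Y) (L : prod_charted X V -> prod_charted Y W).
Hypothesis sF : chart_smooth F.
Hypothesis cL : forall q, carrier q -> carrier (L q).
Hypothesis LF : forall q, carrier q -> (L q).1 = F q.1.

Lemma prod_overlapE i j y : img i y /\ dom j (L (psi i y)) <->
  img i y /\ @dom R m Y j (F (@psi R n X i (lsubmx y))).
Proof.
have okP := prod_chart_ok okX oV.
split=> -[yi d]; have cy := carrier_psi okP yi; split=> //.
  have d1 : @dom R m Y j (L (psi i y)).1 by case: d.
  by rewrite (LF cy) in d1.
split; first by rewrite /= (LF cy).
by have /carrier_prod[] := cL cy.
Qed.

Let P := prod_charted X V.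
Let Q := prod_charted Y W.

(** L covers F, so that the overlap is the preimage of an overlap of F. *)
Lemma open_prod_overlap i j : open [set y | img i y /\ dom j (L (psi i y))].
Proof.
have okP := prod_chart_ok okX oV; have [oF _] := sF i j.
have -> : [set y | img i y /\ dom j (L (psi i y))] =
  img i `&` [set y : 'rV[R]_(n + k) |
    [set x | @img R n X i x /\ @dom R m Y j (F (@psi R n X i x))] (lsubmx y)].
  apply/seteqP; split=> y.
    move=> /prod_overlapE[yi d]; split=> //; split=> //.
    by move: yi => /img_prod[].
  by case=> yi [_ d]; apply/prod_overlapE.
by apply: openI; [exact: img_open okP i|exact: open_lsubmx_preimage].
Qed.

Lemma prod_smooth_map_charts : smooth_map L -> chart_smooth L.
Proof. by move=> [_ sL] i j; split; [exact: open_prod_overlap|exact: sL]. Qed.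

Lemma prod_chart_smooth : (forall a, smooth_fun (fun q : P => (L q).2 0 a)) ->
  chart_smooth L.
Proof.
move=> sL i j; have okP := prod_chart_ok okX oV.
have [oF smF] := sF i j; have oU := @open_prod_overlap i j.
split=> // a; case: (split_ordP a) => b ->.
  apply: (smooth_ext oU _ (smooth_comp (V := [set x | @img R n X i x /\ @dom R m Y j (F (@psi R n X i x))])
    (g := lsubmx) oU _ (fun l => smooth_lsubmx l oU) (smF b))) => [y [yi _]|y].
    by rewrite /= row_mxEl (LF (carrier_psi okP yi)).
  by move=> /prod_overlapE[/img_prod[yi _] d].
apply: (smooth_ext oU _ (smooth_sub _ (sL b i))) => [y _|y []//].
by rewrite /= row_mxEr.
Qed.

(** The projections to X and Y intertwine L and F. *)
Lemma pull_lift (a : form1 Y) (i : ix P) (j : ix Q) y : chart_smooth L ->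
  img i y -> dom j (L (psi i y)) ->
  pull (fun z => phi j (L (psi i z))) (lift_form a j) y =
  row_mx (pull (fun x => @phi R m Y j (F (@psi R n X i x))) (a j) (lsubmx y)) 0.
Proof.
move=> sL yi yj; have okP := prod_chart_ok okX oV.
have [_ yj'] := (prod_overlapE i j y).1 (conj yi yj).
have [yi' _] := (img_prod i y).1 yi.
pose g := fun y : 'rV_(n + k) => @phi R _ Q j (L (@psi R _ P i y)).
pose h := fun x => @phi R m Y j (F (@psi R n X i x)).
have dg : differentiable g y := chart_smooth_diff sL yi yj.
have dh : differentiable h (lsubmx y) := chart_smooth_diff sF yi' yj'.
have dl (p q : nat) z : differentiable (lsubmx : 'rV[R]_(p + q) -> 'rV[R]_p) z.
  exact: differentiable_lsubmx.
have E : {near y, (fun z => lsubmx (g z)) =1 (fun z : 'rV_(n + k) => h (lsubmx z))}.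
  apply: (near_open (img_open okP i) yi) => z zi.
  by rewrite /g /= row_mxKl (LF (carrier_psi okP zi)).
rewrite -[row_mx _ 0]/(lift_form (fun i x => pull h (a j) x) i y) liftE.
rewrite /pull -/g liftE -/h -[LHS]mulmxA -[RHS]mulmxA -!trmx_mul.
rewrite -(jacobian_lsubmx y) -(jacobian_lsubmx (g y)).
rewrite -(jacobian_comp dg (dl _ _ _)) -(jacobian_comp (dl _ _ _) dh).
rewrite (near_jacobian (differentiable_comp dg (dl _ _ _)) E).
by rewrite (nbhs_singleton E).
Qed.

Lemma is_pullback_lift (a : form1 Y) (b : form1 X) : chart_smooth L ->
  is_pullback F a b -> is_pullback L (lift_form a : form1 Q) (lift_form b : form1 P).
Proof.
move=> sL h i j y yi yj; rewrite pull_lift//.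
have [_ yj'] := (prod_overlapE i j y).1 (conj yi yj).
have [yi' _] := (img_prod i y).1 yi.
by rewrite /lift_form (h i j).
Qed.

End ProductMap.

End ManifoldCharts.

(** * Derivatives along a coframe *)

Section FrameAlgebra.
Variables (R : realType) (n : nat).
Implicit Types (N : 'M[R]_n) (v w : 'rV[R]_n).

Lemma coefs1K N v : N \in unitmx -> coefs1 N (v *m N) = v.
Proof. by move=> uN; rewrite /coefs1 mulmxK. Qed.

Lemma coefs1E N v : N \in unitmx -> coefs1 N v *m N = v.
Proof. by move=> uN; rewrite /coefs1 mulmxKV. Qed.

Lemma coefs2_wedge N v w : N \in unitmx ->
  coefs2 N ((v *m N) ∧ (w *m N)) = v ∧ w.
Proof.
move=> uN; rewrite wedge_mulmx /coefs2 !mulmxA -trmx_mul mulmxV// trmx1 mul1mx.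
by rewrite mulmxK.
Qed.

Lemma coefs2_wedge_coefs N v w : N \in unitmx ->
  coefs2 N (v ∧ w) = coefs1 N v ∧ coefs1 N w.
Proof.
by move=> uN; rewrite -[in LHS](coefs1E v uN) -[in LHS](coefs1E w uN) coefs2_wedge.
Qed.

Lemma coefs1_row N k : N \in unitmx -> coefs1 N (row k N) = delta_mx 0 k.
Proof. by move=> uN; rewrite rowE coefs1K. Qed.

Lemma coefs2D N (s t : 'M[R]_n) : coefs2 N (s + t) = coefs2 N s + coefs2 N t.
Proof. by rewrite /coefs2 mulmxDr mulmxDl. Qed.

Lemma coefs2Z N r (t : 'M[R]_n) : coefs2 N (r *: t) = r *: coefs2 N t.
Proof. by rewrite /coefs2 -scalemxAr -scalemxAl. Qed.

Lemma coefs2N N (t : 'M[R]_n) : coefs2 N (- t) = - coefs2 N t.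
Proof. by rewrite /coefs2 mulmxN mulNmx. Qed.

Lemma coefs20 N : coefs2 N 0 = 0.
Proof. by rewrite /coefs2 mulmx0 mul0mx. Qed.

Lemma coefs2_sum N (I : Type) (s : seq I) (P : pred I) (F : I -> 'M[R]_n) :
  coefs2 N (\sum_(i <- s | P i) F i) = \sum_(i <- s | P i) coefs2 N (F i).
Proof. by rewrite /coefs2 mulmx_sumr mulmx_suml. Qed.

Lemma coefs1D N v w : coefs1 N (v + w) = coefs1 N v + coefs1 N w.
Proof. by rewrite /coefs1 mulmxDl. Qed.

Lemma coefs1Z N r v : coefs1 N (r *: v) = r *: coefs1 N v.
Proof. by rewrite /coefs1 -scalemxAl. Qed.

Lemma coefs1_comp N v (J : 'M[R]_n) : N *m J \in unitmx ->
  coefs1 (N *m J) (v *m J) = coefs1 N v.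
Proof.
rewrite unitmx_mul => /andP[uN uJ]; rewrite /coefs1.
have -> : invmx (N *m J) = invmx J *m invmx N.
  have uNJ : N *m J \in unitmx by rewrite unitmx_mul uN.
  apply: (can_inj (mulKmx uNJ)); rewrite mulmxV//.
  by rewrite mulmxA mulmxK// mulmxV.
by rewrite mulmxA mulmxK.
Qed.

End FrameAlgebra.

Section Frame.
Variables (R : realType) (n : nat) (O : set 'rV[R]_n).
Variable N : 'rV[R]_n -> 'M[R]_n.
Hypotheses (oO : open O) (uN : forall x, O x -> N x \in unitmx).
Hypothesis sN : forall i j, smooth_on O (fun x => N x i j).
Implicit Types (f g : 'rV[R]_n -> R).

(** The derivative along the a-th vector field of the frame dual to the rows of N. *)
Definition fder (a : 'I_n) f x : R := coefs1 (N x) (dfun f x) 0 a.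

Lemma dfun_fder f x : O x -> dfun f x = \sum_a fder a f x *: row a (N x).
Proof.
by move=> Ox; rewrite -(coefs1E (dfun f x) (uN Ox)) mulmx_sum_row.
Qed.

Lemma fder_ext a f g : (forall x, O x -> f x = g x) ->
  forall x, O x -> fder a f x = fder a g x.
Proof.
by move=> fg x Ox; rewrite /fder (near_dfun (near_open oO Ox fg)).
Qed.

Lemma smooth_fder a f : smooth_on O f -> smooth_on O (fder a f).
Proof.
move=> sf; have s := @smooth_sum _ _ _ oO _ (index_enum 'I_n) xpredT _
  (fun j _ => smooth_mul oO (smooth_partial j sf) (smooth_invmx oO uN sN j a)).
apply: (smooth_ext oO _ s) => x _.
rewrite /fder /coefs1 mxE; apply: eq_bigr => j _; by rewrite mxE.
Qed.

Lemma fderM a f g x : smooth_on O f -> smooth_on O g -> O x ->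
  fder a (fun y => f y * g y) x = f x * fder a g x + g x * fder a f x.
Proof.
move=> sf sg Ox; rewrite /fder dfunM; [|exact: smooth_differentiable sf Ox|
  exact: smooth_differentiable sg Ox].
by rewrite coefs1D !coefs1Z !mxE.
Qed.

Lemma fderD a f g x : smooth_on O f -> smooth_on O g -> O x ->
  fder a (fun y => f y + g y) x = fder a f x + fder a g x.
Proof.
move=> sf sg Ox; rewrite /fder dfunD; [|exact: smooth_differentiable sf Ox|
  exact: smooth_differentiable sg Ox].
by rewrite coefs1D !mxE.
Qed.

Lemma fder_cst a c x : fder a (fun=> c) x = 0.
Proof. by rewrite /fder dfun_cst /coefs1 mul0mx mxE. Qed.

Lemma fder_coord a j x : fder a (fun y => y 0 j) x = invmx (N x) j a.
Proof. by rewrite /fder dfun_coord /coefs1 -rowE mxE. Qed.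

(** Apply d to df = sum_k (X_k f) N^k and evaluate on (X_a, X_b): this is
    [X_a, X_b] = - sum_k dN^k(X_a, X_b) X_k. *)
Lemma fder_bracket a b f x : smooth_on O f -> O x ->
  fder a (fder b f) x - fder b (fder a f) x =
  - \sum_k fder k f x * coefs2 (N x) (dform (fun y => row k (N y)) x) a b.
Proof.
move=> sf Ox.
have dr k : differentiable (fun y => row k (N y)) x.
  apply: (smooth_rV_differentiable (U := O)) => // l.
  by apply: (smooth_ext oO _ (sN k l)) => y _; rewrite mxE.
have dk k : differentiable (fder k f) x.
  exact: smooth_differentiable (smooth_fder k sf) Ox.
have drk k : differentiable (fun y => fder k f y *: row k (N y)) x.
  apply: (smooth_rV_differentiable (U := O)) => // l.
  apply: (smooth_ext oO _ (smooth_mul oO (smooth_fder k sf) (sN k l))) => y _.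
  by rewrite !mxE.
have E : dform (fun y => \sum_k fder k f y *: row k (N y)) x = 0.
  rewrite -(dform_dfun oO Ox sf); apply: near_dform.
  by apply: (near_open oO Ox) => y Oy; rewrite dfun_fder.
rewrite dform_sum// in E.
have /matrixP/(_ a b) := congr1 (coefs2 (N x)) E.
rewrite coefs20 coefs2_sum summxE [RHS]mxE.
under eq_bigr => k _.
  rewrite dformZ// coefs2D coefs2Z coefs2_wedge_coefs ?uN// coefs1_row ?uN//.
  rewrite mxE [X in _ + X]mxE wedgeE -/(fder a _ _) -/(fder b _ _).
  rewrite [X in _ * X - _]mxE [X in _ - X * _]mxE eqxx/=.
  over.
rewrite big_split/= => /eqP; rewrite addr_eq0 => /eqP <-.
rewrite sumrB (bigD1 b)//= eqxx mulr1 big1 ?addr0 => [|i /negbTE]; last first.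
  by rewrite eq_sym => ->; rewrite mulr0.
rewrite (bigD1 a)//= eqxx mul1r big1 ?addr0 => [//|i /negbTE].
by rewrite eq_sym => ->; rewrite mul0r.
Qed.

End Frame.

Section FrameDerivative.
Variables (R : realType) (n : nat) (X : charted R n) (om : 'I_n -> form1 X).
Hypotheses (mX : is_manifold X) (som : forall k, smooth_form (om k)).
Hypothesis cX : coframe om.

Lemma row_coframe_mx k (i : ix X) x : row k (coframe_mx om i x) = om k i x.
Proof. by apply/rowP => a; rewrite !mxE. Qed.

(** The value at p is computed in a chosen chart around p; by [frame_derE] every
    chart gives the same value. *)
Definition frame_der (k : 'I_n) (f : X -> R) (p : X) : R :=
  match pselect (exists i : ix X, dom i p) with
  | left h => let i := projT1 (cid h) in
              coefs1 (coframe_mx om i (phi i p)) (dF f i (phi i p)) 0 k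
  | right _ => 0
  end.

Let okX := manifold_chart_ok mX.
Let idX := chart_smooth_id mX.

(** A change of charts multiplies the coframe and df by the same Jacobian matrix. *)
Lemma frame_derE k f (i : ix X) x : smooth_fun f -> img i x ->
  frame_der k f (psi i x) = coefs1 (coframe_mx om i x) (dF f i x) 0 k.
Proof.
move=> sf xi; rewrite /frame_der; case: pselect => [h|[]]; last first.
  by exists i; exact: img_dom.
case: (cid h) => j /= dj; set z := phi j (psi i x).
have [_ cf] := smooth_form_dF okX idX sf.
pose J := (jacobian (fun y => @phi R n X j (@psi R n X i y)) x)^T.
have EN : coframe_mx om i x = coframe_mx om j z *m J.
  apply/row_matrixP => l; rewrite row_mul.
  have [_ co] := som l; have := co i j x xi dj; rewrite /pull => E.
  by rewrite !row_coframe_mx.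
have u : coframe_mx om j z *m J \in unitmx by rewrite -EN; exact: cX.
by rewrite EN (cf i j x xi dj) /pull coefs1_comp.
Qed.

Lemma smooth_coframe_mx (i : ix X) k l :
  smooth_on (img i) (fun x => coframe_mx om i x k l).
Proof.
have [s _] := som k; apply: (smooth_ext (img_open okX i) _ (s i l)) => x _.
by rewrite mxE.
Qed.

Lemma frame_der_fder k f (i : ix X) x : smooth_fun f -> img i x ->
  frame_der k f (psi i x) = fder (coframe_mx om i) k (fun y => f (psi i y)) x.
Proof. exact: frame_derE. Qed.

Lemma smooth_frame_der k f : smooth_fun f -> smooth_fun (frame_der k f).
Proof.
move=> sf i; have oi := img_open okX i.
have s := smooth_fder oi (cX (i := i)) (smooth_coframe_mx i) k (sf i).
by apply: (smooth_ext oi _ s) => x xi; rewrite frame_der_fder.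
Qed.

Lemma dF_frame_der f (i : ix X) x : smooth_fun f -> img i x ->
  dF f i x = \sum_k frame_der k f (psi i x) *: om k i x.
Proof.
move=> sf xi; rewrite /dF (dfun_fder (cX (i := i)))//; apply: eq_bigr => k _.
by rewrite row_coframe_mx frame_der_fder.
Qed.

Lemma frame_der_ext k f g : smooth_fun f -> smooth_fun g ->
  (forall p, carrier p -> f p = g p) ->
  forall p, carrier p -> frame_der k f p = frame_der k g p.
Proof.
move=> sf sg fg p /(carrierE okX)[i [x [xi <-]]]; rewrite !frame_der_fder//.
apply: (@fder_ext _ _ _ _ (img_open okX i)) xi => y yi.
by apply: fg; exact: carrier_psi.
Qed.

End FrameDerivative.

Section MatrixEntries.
Variables (V : zmodType) (m n : nat).
Implicit Types A B : 'M[V]_(m, n).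
Lemma mx_addE A B i j : (A + B) i j = A i j + B i j. Proof. by rewrite mxE. Qed.
Lemma mx_oppE A i j : (- A) i j = - A i j. Proof. by rewrite mxE. Qed.
Lemma mx_0E i j : (0 : 'M[V]_(m, n)) i j = 0. Proof. by rewrite mxE. Qed.
End MatrixEntries.

Lemma mx_scaleE (R : nzRingType) m n (c : R) (A : 'M[R]_(m, n)) i j :
  (c *: A) i j = c * A i j.
Proof. by rewrite mxE. Qed.

Ltac mx_entries := apply/matrixP => ? ?;
  rewrite !(wedgeE, mx_addE, mx_oppE, mx_scaleE, mx_0E).

(** Leaves identities that are linear in the entries of the wedge products of the forms
    at hand, these products being taken as unknowns. *)
Ltac wedge_entries :=
  rewrite ?(wedgeDl, wedgeDr, wedgeZl, wedgeZr, wedgeNl, wedgeNr, wedgexx);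
  repeat match goal with |- context [wedge ?a ?b] =>
    rewrite ?(wedgeC b a); generalize (wedge a b); intro end;
  apply/matrixP => ? ?; rewrite !(mx_addE, mx_oppE, mx_scaleE, mx_0E).

Section MongeBracket.
Variables (R : realType) (M : charted R 8) (om : 'I_8 -> form1 M) (u : M -> R).
Hypothesis mU : monge_U om u.

Definition o8 k : 'I_8 := inord k.-1.

(** The coefficient of omega^p ∧ omega^q on the pair (X_a, X_b) of frame fields. *)
Definition pairing (p q : nat) (a b : 'I_8) : R :=
  ((a == p.-1 :> nat) && (b == q.-1 :> nat))%:R
  - ((b == p.-1 :> nat) && (a == q.-1 :> nat))%:R.

Lemma coefs2_nr (i : ix M) x p q a b : img i x -> (0 < p <= 8)%N -> (0 < q <= 8)%N ->
  coefs2 (coframe_mx om i x)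
    ((fun k => om k i x)^[p] ∧ (fun k => om k i x)^[q]) a b = pairing p q a b.
Proof.
move=> xi hp hq; have [_ [_ co] _ _ _] := mU.
rewrite coefs2_wedge_coefs ?co// /nr -!row_coframe_mx !coefs1_row ?co//.
have E k j : (0 < k <= 8)%N -> (delta_mx 0 (inord k.-1) : 'rV[R]_8) 0 j = (j == k.-1 :> nat)%:R.
  case: k => // k /= k8; rewrite mxE eqxx /= -(inj_eq val_inj)/= inordK//.
by rewrite wedgeE !E// /pairing -!mulnb !natrM; congr (_ - _); rewrite mulrC.
Qed.

Lemma monge_bracket (i : ix M) f x (a b : 'I_8) : smooth_on (img i) f -> img i x ->
  let X k := fder (coframe_mx om i) (o8 k) in
  fder (coframe_mx om i) a (fder (coframe_mx om i) b f) x
  - fder (coframe_mx om i) b (fder (coframe_mx om i) a f) x =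
    (pairing 4 7 a b + pairing 5 6 a b) * X 1%N f x
    + 2 * pairing 5 7 a b * X 2%N f x
    - (u (psi i x) * pairing 2 7 a b - 2 * pairing 4 6 a b) * X 3%N f x
    - pairing 6 8 a b * X 4%N f x - pairing 7 8 a b * X 5%N f x.
Proof.
move=> sf xi X; have [mM [so co] _ _ eqs] := mU.
have okM := manifold_chart_ok mM.
rewrite (fder_bracket (img_open okM i) (co i) (smooth_coframe_mx mM so i) a b sf xi).
have E k : dform (fun y => row k (coframe_mx om i y)) x = dform (om k i) x.
  by apply: near_dform; apply: filterE => y; rewrite row_coframe_mx.
under eq_bigr do rewrite E.
rewrite !big_ord_recl big_ord0 !eqs //=.
have oE k (h : (k < 8)%N) (j : 'I_8) : val j = k -> j = o8 k.+1.
  by move=> jk; apply/val_inj; rewrite jk /= inordK.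
have h p q hp hq := @coefs2_nr i x p q a b xi hp hq.
move: (h 4%N 7%N isT isT) (h 5%N 6%N isT isT) (h 5%N 7%N isT isT).
move: (h 2%N 7%N isT isT) (h 4%N 6%N isT isT) (h 6%N 8%N isT isT) (h 7%N 8%N isT isT).
do 7!(set W := (_ ∧ _); move: W => ?).
move=> h1 h2 h3 h4 h5 h6 h7.
rewrite !(coefs2D, coefs2N, coefs2Z, coefs20).
rewrite !(mx_addE, mx_oppE, mx_scaleE, mx_0E) h1 h2 h3 h4 h5 h6 h7.
rewrite /X -(oE 0%N _ ord0)// -(oE 1%N _ (lift ord0 ord0))//.
rewrite -(oE 2%N _ (lift ord0 (lift ord0 ord0)))//.
rewrite -(oE 3%N _ (lift ord0 (lift ord0 (lift ord0 ord0))))//.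
rewrite -(oE 4%N _ (lift ord0 (lift ord0 (lift ord0 (lift ord0 ord0)))))//.
by ring.
Qed.

End MongeBracket.

(** * The derived functions of a Monge structure *)

(** The Jacobi identity for X_k, X_2, X_7 applied to a function f, the iterated
    derivatives of f being unknowns; P stands for X_k u and d for X_3 f. *)
Lemma jacobi_cancel (R : comNzRingType) (U P d A B c k72 k27 b2k7 b27k b72k b7k2 q2 b2q : R) :
  k72 - k27 = U * A + d * P -> b2k7 - b27k = c * b2q ->
  b27k - b72k = - U * B -> k72 - b7k2 = c * q2 -> k27 = b2k7 -> A = B ->
  q2 = b2q -> b7k2 = b72k -> P * d = 0.
Proof.
move=> E1 E2 F1 F2 kb AB qb bb; rewrite AB kb in E1; rewrite qb in F2; rewrite bb in F2.
rewrite mulrC -[d * P](addKr (U * B)) -E1.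
rewrite -[k72](subrK b72k) F2 -[b2k7](subrK b27k) E2.
rewrite -[b27k](subrK b72k) F1; ring.
Qed.

Lemma unitmx_col_neq0 (F : fieldType) n (A : 'M[F]_n) k : A \in unitmx ->
  exists j, invmx A j k != 0.
Proof.
move=> uA; have [/existsP // | /existsPn h] := boolP [exists j, invmx A j k != 0].
have := congr1 (fun B : 'M[F]_n => B k k) (mulmxV uA).
rewrite [LHS]mxE [RHS]mxE eqxx big1 => [/eqP|j _]; first by rewrite eq_sym oner_eq0.
by have := h j; rewrite negbK => /eqP ->; rewrite mulr0.
Qed.

Section MongeDerivatives.
Variables (R : realType) (M : charted R 8) (om : 'I_8 -> form1 M) (u : M -> R).
Hypothesis mU : monge_U om u.

Let mM : is_manifold M. Proof. by case: mU. Qed.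
Let okM := manifold_chart_ok mM.
Let som k : smooth_form (om k). Proof. by case: mU => _ []. Qed.
Let co : coframe om. Proof. by case: mU => _ []. Qed.
Let su : smooth_fun u. Proof. by case: mU. Qed.

Section OneChart.
Variable i : ix M.
Let N := coframe_mx om i.
Let D k := fder N (o8 k).
Let sD k f : smooth_on (img i) f -> smooth_on (img i) (D k f).
Proof. exact: (smooth_fder (img_open okM i) (co (i := i)) (smooth_coframe_mx mM som i)). Qed.

Lemma chart_bracket27 f x : smooth_on (img i) f -> img i x ->
  D 2 (D 7 f) x - D 7 (D 2 f) x = - u (psi i x) * D 3 f x.
Proof.
move=> sf xi; rewrite /D (monge_bracket mU (o8 2) (o8 7) sf xi).
rewrite /pairing /o8 !inordK//=; ring.
Qed.

Lemma chart_bracket_2 k f x : (0 < k <= 8)%N -> k != 7%N ->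
  smooth_on (img i) f -> img i x ->
  D k (D 2 f) x = D 2 (D k f) x.
Proof.
move=> k8 k7 sf xi; apply/eqP; rewrite -subr_eq0; apply/eqP.
rewrite /D (monge_bracket mU (o8 k) (o8 2) sf xi).
case: k k8 k7 => [|[|[|[|[|[|[|[|[|//]]]]]]]]] // _ _;
  rewrite /pairing /o8 !inordK//=; ring.
Qed.

Lemma chart_bracket_3 k f x : (0 < k <= 8)%N ->
  smooth_on (img i) f -> img i x ->
  D k (D 3 f) x = D 3 (D k f) x.
Proof.
move=> k8 sf xi; apply/eqP; rewrite -subr_eq0; apply/eqP.
rewrite /D (monge_bracket mU (o8 k) (o8 3) sf xi).
case: k k8 => [|[|[|[|[|[|[|[|[|//]]]]]]]]] // _;
  rewrite /pairing /o8 !inordK//=; ring.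
Qed.

(** Each [X_k, X_7] is a multiple of a single frame field: the first list gives the
    factor, the second one the index. *)
Lemma chart_bracket_7 k f x : (0 < k <= 8)%N -> k != 2%N ->
  smooth_on (img i) f -> img i x ->
  D k (D 7 f) x - D 7 (D k f) x =
    nth 0 [:: 0; 0; 0; 1; 2; 0; 0; 1] k.-1 * D (nth 1 [:: 1; 1; 1; 1; 2; 1; 1; 5] k.-1)%N f x.
Proof.
move=> k8 k2 sf xi.
rewrite /D (monge_bracket mU (o8 k) (o8 7) sf xi).
case: k k8 k2 => [|[|[|[|[|[|[|[|[|//]]]]]]]]] // _ _;
  rewrite /pairing /o8 !inordK//=; ring.
Qed.

(** X_3 is central and [X_2, X_7] = - u X_3, while X_2 commutes with X_k and with
    [X_k, X_7].  The Jacobi identity then says (X_k u) X_3 = 0, and X_3 does not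
    annihilate all coordinate functions. *)
Lemma chart_du0 k x : (0 < k <= 8)%N -> k != 2%N -> k != 7%N -> img i x ->
  D k (fun y => u (psi i y)) x = 0.
Proof.
move=> k8 k2 k7 xi; have oi := img_open okM i.
set U := fun y => u (psi i y); have sU : smooth_on (img i) U := su i.
have key f : smooth_on (img i) f -> D k U x * D 3 f x = 0.
  move=> sf; pose c : R := nth 0 [:: 0; 0; 0; 1; 2; 0; 0; 1] k.-1.
  pose q := nth 1%N [:: 1; 1; 1; 1; 2; 1; 1; 5]%N k.-1.
  have q8 : (0 < q <= 8)%N && (q != 7%N).
    by rewrite /q; case: k k8 {k2 k7 c q} => [|[|[|[|[|[|[|[|[|//]]]]]]]]].
  case/andP: q8 => q8 q7.
  have sDD a b : smooth_on (img i) (D a (D b f)) by do 2!apply: sD.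
  have e1 y : img i y -> U y * D 3 f y = D 7 (D 2 f) y - D 2 (D 7 f) y.
    by move=> yi; rewrite -opprB chart_bracket27// mulNr opprK.
  have e2 y : img i y -> c * D q f y = D k (D 7 f) y - D 7 (D k f) y.
    by move=> yi; rewrite chart_bracket_7.
  have sub a f1 f2 : smooth_on (img i) f1 -> smooth_on (img i) f2 ->
      D a (fun y => f1 y - f2 y) x = D a f1 x - D a f2 x.
    move=> s1 s2; rewrite /D (fderD N (o8 a) s1 (smooth_opp oi s2) xi); congr (_ + _).
    have := fderM N (o8 a) (smooth_cst (img i) (-1)) s2 xi.
    rewrite fder_cst mulr0 addr0 mulN1r => <-.
    by apply: (@fder_ext _ _ _ _ oi) xi => y yi; rewrite mulN1r.
  have E1 := fderM N (o8 k) sU (sD 3 sf) xi.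
  rewrite (@fder_ext _ _ _ N oi (o8 k) _ _ e1 x xi) -/(D k) sub// in E1.
  have E2 := fderM N (o8 2) (smooth_cst (img i) c) (sD q sf) xi.
  rewrite fder_cst mulr0 addr0 in E2.
  rewrite (@fder_ext _ _ _ N oi (o8 2) _ _ e2 x xi) -/(D 2) sub// in E2.
  have F1 := chart_bracket27 (sD k sf) xi.
  have F2 := chart_bracket_7 k8 k2 (sD 2 sf) xi.
  rewrite -/c -/q in F2.
  have swp a : smooth_on (img i) (D a f) -> D a (D k (D 2 f)) x = D a (D 2 (D k f)) x.
    move=> _; apply: (@fder_ext _ _ _ N oi) xi => y yi.
    exact: chart_bracket_2.
  have G2 := chart_bracket_2 k8 k7 (sD 7 sf) xi.
  have G3 := chart_bracket_3 k8 sf xi.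
  have Gq := chart_bracket_2 q8 q7 sf xi.
  have G7 := swp 7%N (sD 7 sf).
  exact: jacobi_cancel E1 E2 F1 F2 G2 G3 Gq G7.
(* X_3 of the j-th coordinate is an entry of the inverse coframe matrix *)
have [j nz] := unitmx_col_neq0 (o8 3) (co xi).
have := key _ (smooth_coord oi j); rewrite /D fder_coord => /eqP.
by rewrite mulf_eq0 (negbTE nz) orbF => /eqP.
Qed.

End OneChart.

Local Notation X k := (frame_der om (o8 k)).
Let sX k f : smooth_fun f -> smooth_fun (X k f).
Proof. by move=> sf; exact: (smooth_frame_der mM som co). Qed.

Lemma frame_der_fder2 a b f (i : ix M) x : smooth_fun f -> img i x ->
  X a (X b f) (psi i x) =
  fder (coframe_mx om i) (o8 a) (fder (coframe_mx om i) (o8 b) (fun y => f (psi i y))) x.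
Proof.
move=> sf xi; rewrite (frame_der_fder mM som co)//; last exact: sX.
apply: (@fder_ext _ _ _ _ (img_open okM i)) xi => y yi.
by rewrite (frame_der_fder mM som co).
Qed.

Lemma du0 k p : (0 < k <= 8)%N -> k != 2%N -> k != 7%N -> carrier p -> X k u p = 0.
Proof.
move=> k8 k2 k7 /(carrierE okM)[i [x [xi <-]]].
by rewrite (frame_der_fder mM som co)//; exact: chart_du0.
Qed.

Lemma bracket27 f p : smooth_fun f -> carrier p ->
  X 2 (X 7 f) p = X 7 (X 2 f) p - u p * X 3 f p.
Proof.
move=> sf /(carrierE okM)[i [x [xi <-]]]; rewrite !frame_der_fder2//.
rewrite (frame_der_fder mM som co)//; have := chart_bracket27 (sf i) xi.
by move=> /eqP; rewrite subr_eq mulNr addrC => /eqP.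
Qed.

Lemma bracket_2 k f p : (0 < k <= 8)%N -> k != 7%N -> smooth_fun f -> carrier p ->
  X k (X 2 f) p = X 2 (X k f) p.
Proof.
move=> k8 k7 sf /(carrierE okM)[i [x [xi <-]]]; rewrite !frame_der_fder2//.
exact: chart_bracket_2.
Qed.

Lemma bracket_7 k f p : (0 < k <= 8)%N -> k != 2%N -> smooth_fun f -> carrier p ->
  X k (X 7 f) p = X 7 (X k f) p +
    nth 0 [:: 0; 0; 0; 1; 2; 0; 0; 1] k.-1 * X (nth 1 [:: 1; 1; 1; 1; 2; 1; 1; 5] k.-1)%N f p.
Proof.
move=> k8 k2 sf /(carrierE okM)[i [x [xi <-]]]; rewrite !frame_der_fder2//.
rewrite (frame_der_fder mM som co)//; have := chart_bracket_7 k8 k2 (sf i) xi.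
by move=> /eqP; rewrite subr_eq addrC => /eqP.
Qed.

Lemma frame_derZ a c f g p : smooth_fun f -> smooth_fun g ->
  (forall p, carrier p -> f p = c * g p) -> carrier p -> X a f p = c * X a g p.
Proof.
move=> sf sg fg cp.
have sc : smooth_fun (X := M) (fun=> c) by exact: smooth_fun_cst.
 have scg := smooth_funM okM sc sg.
rewrite (frame_der_ext mM som co _ sf scg fg cp).
have [i [x [xi <-]]] := carrierE okM cp; rewrite !(frame_der_fder mM som co)//.
by rewrite (fderM _ _ (sc i) (sg i) xi) fder_cst mulr0 addr0.
Qed.

Definition derived_of : derived R M :=
  let v1 := X 2 u in let v2 := X 7 u in
  let w1 := X 2 v1 in let w2 := X 7 v1 in let w3 := X 7 v2 in
  let z4 := X 7 w3 in
  Derived v1 v2 w1 w2 w3 (X 2 w2) (X 7 w2) z4 (X 2 z4) (X 7 z4).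

Lemma dF_nr f (i : ix M) x : smooth_fun f -> img i x ->
  dF f i x = let w := fun k => om k i x in let p := psi i x in
    X 1 f p *: w^[1] + X 2 f p *: w^[2] + X 3 f p *: w^[3] + X 4 f p *: w^[4]
    + X 5 f p *: w^[5] + X 6 f p *: w^[6] + X 7 f p *: w^[7] + X 8 f p *: w^[8].
Proof.
move=> sf xi; rewrite (dF_frame_der mM som co)// !big_ord_recl big_ord0 /= addr0 !addrA.
do 7?congr (_ + _).
all: by rewrite /nr; congr (frame_der om _ _ _ *: om _ _ _); apply/val_inj; rewrite /= inordK.
Qed.

Lemma frame_der0 a f p : smooth_fun f -> (forall p, carrier p -> f p = 0) ->
  carrier p -> X a f p = 0.
Proof.
move=> sf f0 cp; rewrite (@frame_derZ a 0 f f)// ?mul0r// => q cq.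
by rewrite f0// mul0r.
Qed.

(** All functions are iterated derivatives of u along X_2 and X_7.  Their other
    derivatives follow from those of u by commuting X_k past X_2 and X_7. *)
Lemma derived_exists : derived_eqs om u derived_of.
Proof.
pose v1 := X 2 u; pose v2 := X 7 u.
pose w1 := X 2 v1; pose w2 := X 7 v1; pose w3 := X 7 v2.
pose z2 := X 2 w2; pose z3 := X 7 w2; pose z4 := X 7 w3.
have sv1 : smooth_fun v1 by exact: sX.
have sv2 : smooth_fun v2 by exact: sX.
have sw1 : smooth_fun w1 by exact: sX.
have sw2 : smooth_fun w2 by exact: sX.
have sw3 : smooth_fun w3 by exact: sX.
have sz2 : smooth_fun z2 by exact: sX.
have sz3 : smooth_fun z3 by exact: sX.
have sz4 : smooth_fun z4 by exact: sX.
have v1_0 k p : (0 < k <= 8)%N -> k != 2%N -> k != 7%N -> carrier p -> X k v1 p = 0.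
  move=> k8 k2 k7 cp; rewrite /v1 bracket_2// frame_der0//; first exact: sX.
  by move=> q cq; exact: du0.
have b7 k f p : (0 < k <= 8)%N -> k != 2%N -> k != 7%N -> smooth_fun f -> carrier p ->
    (forall q, carrier q -> X k f q = 0) ->
    X k (X 7 f) p = nth 0 [:: 0; 0; 0; 1; 2; 0; 0; 1] k.-1
       * X (nth 1 [:: 1; 1; 1; 1; 2; 1; 1; 5] k.-1)%N f p.
  move=> k8 k2 k7 sf cp h; rewrite bracket_7//.
  by rewrite (@frame_der0 _ (X k f))// ?add0r//; exact: sX.
have v2_2 p : carrier p -> X 2 v2 p = w2 p.
  by move=> cp; rewrite /v2 bracket27// du0// mulr0 subr0.
have v2_5 p : carrier p -> X 5 v2 p = 2 * v1 p.
  by move=> cp; rewrite /v2 b7//= => q cq; exact: du0.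
have v2_0 k p : (0 < k <= 8)%N -> k != 2%N -> k != 7%N -> k != 5%N -> carrier p -> X k v2 p = 0.
  move=> k8 k2 k7 k5 cp; rewrite /v2 b7//; last by move=> q cq; exact: du0.
  case: k k8 k2 k7 k5 => [|[|[|[|[|[|[|[|[|//]]]]]]]]] // _ _ _ _ /=; rewrite ?mul0r ?mul1r//;
    by rewrite du0.
have w2_5 p : carrier p -> X 5 w2 p = 2 * w1 p.
  by move=> cp; rewrite /w2 b7//= => q cq; exact: v1_0.
have w2_0 k p : (0 < k <= 8)%N -> k != 2%N -> k != 7%N -> k != 5%N -> carrier p -> X k w2 p = 0.
  move=> k8 k2 k7 k5 cp; rewrite /w2 b7//; last by move=> q cq; exact: v1_0.
  case: k k8 k2 k7 k5 => [|[|[|[|[|[|[|[|[|//]]]]]]]]] // _ _ _ _ /=; rewrite ?mul0r ?mul1r//;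
    by rewrite v1_0.
have w3_2 p : carrier p -> X 2 w3 p = z3 p.
  move=> cp; rewrite /w3 bracket27// v2_0// mulr0 subr0.
  exact: (frame_der_ext mM som co _ (sX _ sv2) sw2 v2_2 cp).
have w3_5 p : carrier p -> X 5 w3 p = 4 * w2 p.
  move=> cp; rewrite /w3 bracket_7//= (frame_derZ 7 (sX _ sv2) sv1 v2_5 cp) v2_2//.
  by rewrite -/w2; ring.
have w3_0 k p : (0 < k <= 8)%N -> k != 2%N -> k != 7%N -> k != 5%N -> k != 8%N ->
    carrier p -> X k w3 p = 0.
  move=> k8 k2 k7 k5 k8' cp; rewrite /w3 b7//; last by move=> q cq; exact: v2_0.
  case: k k8 k2 k7 k5 k8' => [|[|[|[|[|[|[|[|[|//]]]]]]]]] // _ _ _ _ _ /=;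
    rewrite ?mul0r ?mul1r//; by rewrite v2_0.
have w3_8 p : carrier p -> X 8 w3 p = 2 * v1 p.
  move=> cp; rewrite /w3 b7//= ?mul1r ?v2_5// => q cq; exact: v2_0.
have z4_5 p : carrier p -> X 5 z4 p = 6 * z3 p.
  move=> cp; rewrite /z4 bracket_7//= (frame_derZ 7 (sX _ sw3) sw2 w3_5 cp) w3_2//.
  by rewrite -/z3; ring.
have z4_8 p : carrier p -> X 8 z4 p = 6 * w2 p.
  move=> cp; rewrite /z4 bracket_7//= (frame_derZ 7 (sX _ sw3) sv1 w3_8 cp) w3_5//.
  by rewrite -/w2; ring.
have z4_0 k p : (0 < k <= 8)%N -> k != 2%N -> k != 7%N -> k != 5%N -> k != 8%N ->
    carrier p -> X k z4 p = 0.
  move=> k8 k2 k7 k5 k8' cp; rewrite /z4 b7//; last by move=> q cq; exact: w3_0.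
  case: k k8 k2 k7 k5 k8' => [|[|[|[|[|[|[|[|[|//]]]]]]]]] // _ _ _ _ _ /=;
    rewrite ?mul0r ?mul1r//; by rewrite w3_0.
split.
  by move=> f /=; do 10!(case=> [<-|]; first by repeat apply: sX).
move=> i x xi p w d; have cp : carrier p by exact: carrier_psi.
have dE f : smooth_fun f -> X 1 f p = 0 -> X 3 f p = 0 -> X 4 f p = 0 -> X 6 f p = 0 ->
    d f = X 2 f p *: w^[2] + X 5 f p *: w^[5] + X 7 f p *: w^[7] + X 8 f p *: w^[8].
  move=> sf h1 h3 h4 h6; apply: etrans (dF_nr sf xi) _; rewrite -/w -/p /=.
  by rewrite h1 h3 h4 h6 !scale0r add0r !addr0.
split; last split.
- apply: etrans (dE _ su _ _ _ _) _; [exact: du0|exact: du0|exact: du0|exact: du0|].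
  by rewrite (@du0 5)// (@du0 8)// !scale0r !addr0.
- apply: etrans (dE _ sv1 _ _ _ _) _; [exact: v1_0|exact: v1_0|exact: v1_0|exact: v1_0|].
  by rewrite (v1_0 5%N)// (v1_0 8%N)// !scale0r !addr0.
- apply: etrans (dE _ sv2 _ _ _ _) _; [exact: v2_0|exact: v2_0|exact: v2_0|exact: v2_0|].
  by rewrite (v2_0 8%N)// v2_2// v2_5// scale0r addr0.
- apply: etrans (dE _ sw2 _ _ _ _) _; [exact: w2_0|exact: w2_0|exact: w2_0|exact: w2_0|].
  by rewrite (w2_0 8%N)// w2_5// scale0r addr0.
- apply: etrans (dE _ sw3 _ _ _ _) _; [exact: w3_0|exact: w3_0|exact: w3_0|exact: w3_0|].
  by rewrite w3_2// w3_5// w3_8.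
- apply: etrans (dE _ sz4 _ _ _ _) _; [exact: z4_0|exact: z4_0|exact: z4_0|exact: z4_0|].
  by rewrite z4_5// z4_8.
Qed.

End MongeDerivatives.

(** * Structures with I_2 = 0 depend on one parameter *)

Section OdeRules.
Variables (R : realType) (M : charted R 8) (om : 'I_8 -> form1 M).
Hypothesis okM : chart_ok M.

Definition w7 : form1 M := fun i x => (fun k => om k i x)^[7].

(** As omega^7 is closed it is locally dt, and f is then a function of the parameter
    t with derivative g. *)
Definition ode (f g : M -> R) : Prop :=
  smooth_fun f /\ forall (i : ix M) x, img i x -> dF f i x = g (psi i x) *: w7 i x.

Lemma ode_ext f f' g g' : (forall p, carrier p -> f p = f' p) ->
  (forall p, carrier p -> g p = g' p) -> ode f g -> ode f' g'.
Proof.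
move=> ff gg [sf df]; split; first exact: smooth_fun_ext ff sf.
move=> i x xi; rewrite -gg; last exact: carrier_psi xi.
rewrite -df// /dF; apply: near_dfun; apply: (near_open (img_open okM i) xi) => y yi.
by rewrite ff//; exact: carrier_psi yi.
Qed.

Lemma ode_cst c : ode (fun=> c) (fun=> 0).
Proof.
split; first exact: smooth_fun_cst.
by move=> i x xi; rewrite /dF dfun_cst scale0r.
Qed.

Lemma odeD f g f' g' : ode f f' -> ode g g' ->
  ode (fun p => f p + g p) (fun p => f' p + g' p).
Proof.
move=> [sf df] [sg dg]; split; first exact: smooth_funD.
move=> i x xi; rewrite /dF dfunD; [|exact: smooth_fun_diff sf xi|exact: smooth_fun_diff sg xi].
by rewrite -/(dF f i x) -/(dF g i x) df// dg// scalerDl.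
Qed.

Lemma odeM f g f' g' : ode f f' -> ode g g' ->
  ode (fun p => f p * g p) (fun p => f p * g' p + g p * f' p).
Proof.
move=> [sf df] [sg dg]; split; first exact: smooth_funM.
move=> i x xi; rewrite /dF dfunM; [|exact: smooth_fun_diff sf xi|exact: smooth_fun_diff sg xi].
by rewrite -/(dF f i x) -/(dF g i x) df// dg// scalerDl !scalerA.
Qed.

Lemma odeN f f' : ode f f' -> ode (fun p => - f p) (fun p => - f' p).
Proof.
move=> hf; apply: ode_ext (odeM (ode_cst (-1)) hf) => p _; first by rewrite mulN1r.
by rewrite mulr0 addr0 mulN1r.
Qed.

Lemma odeX f f' n : ode f f' -> ode (fun p => f p ^+ n) (fun p => n%:R * f p ^+ n.-1 * f' p).
Proof.
move=> hf; elim: n => [|n IH].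
  by apply: ode_ext (ode_cst 1) => p _; rewrite ?expr0 ?mul0r.
apply: ode_ext (odeM hf IH) => p _; first by rewrite exprS.
case: n {IH} => [|n] /=; first by rewrite expr0 !mul0r mulr0 !mul1r add0r.
by rewrite -[n.+2%:R]natr1 exprS; ring.
Qed.

Lemma odeV f f' : (forall p, carrier p -> f p != 0) -> ode f f' ->
  ode (fun p => (f p)^-1) (fun p => - f' p / f p ^+ 2).
Proof.
move=> f0 [sf df]; split; first exact: smooth_funV.
move=> i x xi; rewrite /dF dfunV; [|exact/f0/(carrier_psi okM)|exact: smooth_fun_diff sf xi].
by rewrite -/(dF f i x) df// scalerA; congr (_ *: _); rewrite mulNr mulrC mulNr.
Qed.

Lemma ode_powR f f' r : (forall p, carrier p -> 0 < f p) -> ode f f' ->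
  ode (fun p => f p `^ r) (fun p => r * (f p `^ r / f p) * f' p).
Proof.
move=> f0 [sf df]; split; first exact: smooth_fun_powR.
move=> i x xi; have fp := f0 _ (carrier_psi okM xi).
rewrite /dF dfun_powR//; last exact: smooth_fun_diff sf xi.
rewrite -/(dF f i x) df// scalerA; congr (_ * _ *: _).
by rewrite powRD ?lt0r_neq0 ?implybT// powR_inv1 ?ltW.
Qed.

End OdeRules.
Arguments ode_ext {R M om} okM {f f' g g'} _ _ _.
Arguments odeD {R M om} okM {f g f' g'} _ _.
Arguments odeM {R M om} okM {f g f' g'} _ _.
Arguments odeN {R M om} okM {f f'} _.
Arguments odeX {R M om} okM {f f'} n _.
Arguments odeV {R M om} okM {f f'} _ _.
Arguments ode_powR {R M om} okM {f f'} r _ _.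

Section OneParameter.
Variables (R : realType) (M : charted R 8) (om : 'I_8 -> form1 M) (u : M -> R).
Variable D : derived R M.
Hypothesis H : monge_I1_I2 om u D.

Let mU : monge_U om u. Proof. by case: H. Qed.
Let mM : is_manifold M. Proof. by case: mU. Qed.
Let okM := manifold_chart_ok mM.
Let som k : smooth_form (om k). Proof. by case: mU => _ []. Qed.
Let co : coframe om. Proof. by case: mU => _ []. Qed.
Let su : smooth_fun u. Proof. by case: mU. Qed.
Let u0 p : carrier p -> u p != 0. Proof. by case: mU => _ _ _ + _; apply. Qed.
Let I0 p : carrier p -> I1 u D p != 0. Proof. by case: H => _ _ + _; apply. Qed.

Lemma coefs1_nr (i : ix M) x p (j : 'I_8) : img i x -> (0 < p <= 8)%N ->
  coefs1 (coframe_mx om i x) ((fun k => om k i x)^[p]) 0 j = (j == p.-1 :> nat)%:R.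
Proof.
move=> xi; rewrite /nr -row_coframe_mx coefs1_row ?co//.
by case: p => // p /= p8; rewrite mxE eqxx /= -(inj_eq val_inj)/= inordK.
Qed.

Lemma derived_D : derived_eqs om u D. Proof. by case: H. Qed.
Let sD := proj1 derived_D.

Lemma sv1 : smooth_fun (v1 D). Proof. by apply: sD; do ?[by left|right]. Qed.
Lemma sv2 : smooth_fun (v2 D). Proof. by apply: sD; do ?[by left|right]. Qed.
Lemma sw2 : smooth_fun (w2 D). Proof. by apply: sD; do ?[by left|right]. Qed.
Lemma sw3 : smooth_fun (w3 D). Proof. by apply: sD; do ?[by left|right]. Qed.
Lemma sz4 : smooth_fun (z4 D). Proof. by apply: sD; do ?[by left|right]. Qed.

Lemma v10 p : carrier p -> v1 D p = 0.
Proof. by case: H => _ _ _; apply. Qed.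

Lemma near0_dF f (i : ix M) x : (forall p, carrier p -> f p = 0) -> img i x -> dF f i x = 0.
Proof.
move=> f0 xi; rewrite -(dfun_cst 0 x); apply: near_dfun.
by apply: (near_open (img_open okM i) xi) => y /(carrier_psi okM) /f0.
Qed.

(** 0 = dv1 = w1 omega^2 + w2 omega^7. *)
Lemma w120 p : carrier p -> w1 D p = 0 /\ w2 D p = 0.
Proof.
move=> /(carrierE okM)[i [x [xi <-]]].
have [_ /(_ i x xi)[_ E _ _]] := derived_D.
have Z := near0_dF v10 xi; rewrite /dF E in Z.
have h (j : 'I_8) := congr1 (fun v => coefs1 (coframe_mx om i x) v 0 j) Z.
have {}h (j : 'I_8) : w1 D (psi i x) * (j == 1%N :> nat)%:R + w2 D (psi i x) * (j == 6%N :> nat)%:R = 0 :> R.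
  have := h j; rewrite coefs1D !coefs1Z mx_addE !mx_scaleE !coefs1_nr//.
  by rewrite /coefs1 mul0mx mxE.
have := h (inord 1); have := h (inord 6); rewrite !inordK//= !mulr1 !mulr0 addr0 add0r.
by [].
Qed.

Lemma z230 p : carrier p -> z2 D p = 0 /\ z3 D p = 0.
Proof.
move=> cp; have [e1 _] := w120 cp; move: cp e1 => /(carrierE okM)[i [x [xi <-]]] e1.
have [_ /(_ i x xi)[_ _ _ [E _ _]]] := derived_D.
have Z := near0_dF (fun p cp => (w120 cp).2) xi; rewrite /dF E e1 mulr0 scale0r addr0 in Z.
have h (j : 'I_8) := congr1 (fun v => coefs1 (coframe_mx om i x) v 0 j) Z.
have {}h (j : 'I_8) : z2 D (psi i x) * (j == 1%N :> nat)%:R + z3 D (psi i x) * (j == 6%N :> nat)%:R = 0 :> R.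
  have := h j; rewrite coefs1D !coefs1Z mx_addE !mx_scaleE !coefs1_nr//.
  by rewrite /coefs1 mul0mx mxE.
have := h (inord 1); have := h (inord 6); rewrite !inordK//= !mulr1 !mulr0 addr0 add0r.
by [].
Qed.

Lemma ode_u : ode om u (v2 D).
Proof.
split=> // i x xi; have [_ /(_ i x xi)[E _ _ _]] := derived_D; rewrite /dF E.
by rewrite v10 ?scale0r ?add0r//; exact: carrier_psi xi.
Qed.

Lemma ode_v2 : ode om (v2 D) (w3 D).
Proof.
split=> [|i x xi]; first exact: sv2.
have [_ /(_ i x xi)[_ _ E _]] := derived_D; rewrite /dF E.
have cp := carrier_psi okM xi; have [e1 e2] := w120 cp.
by rewrite v10// e2 mulr0 !scale0r !add0r.
Qed.

Lemma ode_w3 : ode om (w3 D) (z4 D).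
Proof.
split=> [|i x xi]; first exact: sw3.
have [_ /(_ i x xi)[_ _ _ [_ E _]]] := derived_D; rewrite /dF E.
have cp := carrier_psi okM xi; have [e1 e2] := w120 cp; have [e3 e4] := z230 cp.
by rewrite v10// e2 e4 !mulr0 !scale0r !add0r addr0.
Qed.

Lemma dw7 (i : ix M) x : img i x -> dform (w7 om i) x = 0.
Proof.
move=> xi; have [_ _ _ _ /(_ i x xi (inord 6))] := mU; rewrite /w7 /nr => -> /=.
by rewrite inordK.
Qed.

(** Apply d to dw3 = z4 omega^7: the coefficient of omega^2 ∧ omega^7 is z8. *)
Lemma z80 p : carrier p -> z8 D p = 0.
Proof.
move=> /(carrierE okM)[i [x [xi <-]]]; have cp := carrier_psi okM xi.
have [s7 _] := som (inord 6).
have d : dform (fun y => z4 D (psi i y) *: w7 om i y) x = 0.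
  rewrite -(dform_dF okM sw3 xi); apply: near_dform.
  by apply: (near_open (img_open okM i) xi) => y yi; rewrite ode_w3.2.
rewrite dformZ in d; last exact: (smooth_form_diff (som (inord 6)) xi).
  rewrite dw7// scaler0 addr0 in d.
  have [_ /(_ i x xi)[_ _ _ [_ _ E]]] := derived_D; rewrite E in d.
  have [e1 e2] := w120 cp; have [e3 e4] := z230 cp.
  rewrite e4 e2 !mulr0 !scale0r !addr0 wedgeDl !wedgeZl wedgexx scaler0 addr0 in d.
  have := congr1 (fun m => coefs2 (coframe_mx om i x) m (inord 1) (inord 6)) d.
  rewrite coefs2Z mx_scaleE (coefs2_nr mU)// coefs20 mx_0E /pairing !inordK//=.
  by rewrite subr0 mulr1.
exact: smooth_fun_diff sz4 xi.
Qed.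

Lemma ode_z4 : ode om (z4 D) (z9 D).
Proof.
split=> [|i x xi]; first exact: sz4.
have [_ /(_ i x xi)[_ _ _ [_ _ E]]] := derived_D; rewrite /dF E.
have cp := carrier_psi okM xi; have [e1 e2] := w120 cp; have [e3 e4] := z230 cp.
by rewrite z80// e2 e4 !mulr0 !scale0r !add0r addr0.
Qed.

Lemma ode_I1 : ode om (I1 u D) (fun p => 6 * v2 D p * w3 D p - 4 * u p * z4 D p).
Proof.
have := odeD okM (odeM okM (ode_cst om 5) (odeX okM 2 ode_v2))
  (odeN okM (odeM okM (odeM okM (ode_cst om 4) ode_u) ode_w3)).
by apply: (ode_ext okM) => p _; rewrite ?/I1 /=; ring.
Qed.

Lemma eps_cases p : carrier p -> eps u D p = 1 \/ eps u D p = -1.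
Proof.
move=> cp; have I := I0 cp; rewrite /eps.
by case: sgrP => [E|_|_]; [rewrite E eqxx in I|left|right].
Qed.

Lemma eps_sqr p : carrier p -> eps u D p ^+ 2 = 1.
Proof. by move=> /eps_cases[] ->; rewrite ?expr1n// sqrrN expr1n. Qed.

Lemma ode_eps : ode om (eps u D) (fun=> 0).
Proof.
have s : smooth_fun (eps u D) := smooth_fun_sg okM I0 ode_I1.1.
by split=> // i x xi; rewrite (dF_sqr1 okM s eps_sqr) ?scale0r.
Qed.

Lemma epsI_gt0 p : carrier p -> 0 < eps u D p * I1 u D p.
Proof. by move=> /I0 I; rewrite /eps -normrEsg normr_gt0. Qed.

Lemma aQ4 p : carrier p -> aQ u D p ^+ 4 * (16 * u p ^+ 4) = eps u D p * I1 u D p.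
Proof.
move=> cp; have J := epsI_gt0 cp; have U := u0 cp.
have E : ((eps u D p * I1 u D p) `^ 4^-1) ^+ 4 = eps u D p * I1 u D p.
  by rewrite -powR_mulrn ?powR_ge0// -powRrM mulVf ?powRr1 ?ltW.
by rewrite /aQ -[RHS]E; field.
Qed.

Lemma aQ_neq0 p : carrier p -> aQ u D p != 0.
Proof.
move=> cp; apply/eqP => a0; have := epsI_gt0 cp.
by rewrite -aQ4// a0 expr0n mul0r ltxx.
Qed.

(** a is the fourth root of eps I1 divided by 2 u, so that its logarithmic derivative
    is I1' / (4 I1) - u' / u. *)
Definition aQ' p : R := aQ u D p *
  ((6 * v2 D p * w3 D p - 4 * u p * z4 D p) / (4 * I1 u D p) - v2 D p / u p).

Lemma ode_aQ : ode om (aQ u D) aQ'.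
Proof.
have u20 p : carrier p -> 2 * u p != 0 by move=> /u0 U; rewrite mulf_neq0.
have := odeM okM (ode_powR okM 4^-1 epsI_gt0 (odeM okM ode_eps ode_I1))
  (odeV okM u20 (odeM okM (ode_cst om 2) ode_u)).
apply: (ode_ext okM) => p cp //; rewrite /aQ' /aQ.
have I := I0 cp; have U := u0 cp; have := epsI_gt0 cp.
move: (_ `^ _) => P; have [->|->] := eps_cases cp => _; by field; rewrite U I.
Qed.

(** eps I1 is the fourth power of 2 u a. *)
Lemma sqrt_aQ p : carrier p ->
  Num.sqrt (eps u D p * I1 u D p ^+ 3) = 64 * u p ^+ 6 * aQ u D p ^+ 6.
Proof.
move=> cp; have <- : (2 * u p * aQ u D p) ^+ 6 = 64 * u p ^+ 6 * aQ u D p ^+ 6 by ring.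
have -> : eps u D p * I1 u D p ^+ 3 = ((2 * u p * aQ u D p) ^+ 6) ^+ 2.
  have -> : ((2 * u p * aQ u D p) ^+ 6) ^+ 2 = (aQ u D p ^+ 4 * (16 * u p ^+ 4)) ^+ 3 by ring.
  rewrite aQ4//; have [->|->] := eps_cases cp; ring.
by rewrite sqrtr_sqr ger0_norm// exprn_even_ge0.
Qed.

(** This lemma, [w3_aQ] and [z4_S4] eliminate I1, w3 and z4 in favour of a and S_4:
    the identities to come are then rational in u, v2, a, S_4, S_5 and eps. *)
Lemma I1_aQ p : carrier p -> I1 u D p = eps u D p * (aQ u D p ^+ 4 * (16 * u p ^+ 4)).
Proof.
move=> cp; rewrite aQ4// mulrA; have [->|->] := eps_cases cp; ring.
Qed.

Lemma w3_aQ p : carrier p ->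
  w3 D p = (5 * v2 D p ^+ 2 - eps u D p * (aQ u D p ^+ 4 * (16 * u p ^+ 4))) / (4 * u p).
Proof. by move=> cp; rewrite -I1_aQ// /I1; have U := u0 cp; field. Qed.

Lemma S4_aQ p : carrier p -> S4 u D p =
  (9 * (eps u D p * (aQ u D p ^+ 4 * (16 * u p ^+ 4))) * v2 D p - 15 * v2 D p ^+ 3
    + 8 * u p ^+ 2 * z4 D p)
  / (2 * (eps u D p * (64 * u p ^+ 6 * aQ u D p ^+ 6))).
Proof. by move=> cp; rewrite /S4 sqrt_aQ// {1}I1_aQ. Qed.

Lemma z4_S4 p : carrier p -> z4 D p =
  (2 * (eps u D p * (64 * u p ^+ 6 * aQ u D p ^+ 6)) * S4 u D p
   - 9 * (eps u D p * (aQ u D p ^+ 4 * (16 * u p ^+ 4))) * v2 D p + 15 * v2 D p ^+ 3)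
  / (8 * u p ^+ 2).
Proof.
move=> cp; rewrite S4_aQ//; have U := u0 cp; have A := aQ_neq0 cp.
by have [->|->] := eps_cases cp; field; rewrite U A.
Qed.

Lemma aQ'_S4 p : carrier p -> aQ' p = aQ u D p *
  (- (v2 D p / (4 * u p)) - S4 u D p * aQ u D p ^+ 2 * u p).
Proof.
move=> cp; rewrite /aQ' z4_S4// I1_aQ// w3_aQ//.
have U := u0 cp; have A := aQ_neq0 cp.
have [->|->] := eps_cases cp; field; rewrite ?U ?A//.
Qed.

Lemma ode_S4 : ode om (S4 u D)
  (fun p => (eps u D p + 3 * S4 u D p ^+ 2 + S5 u D p) * (aQ u D p ^+ 2 * u p)).
Proof.
have E0 p : carrier p -> 2 * (eps u D p * (64 * u p ^+ 6 * aQ u D p ^+ 6)) != 0.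
  move=> cp; have U := u0 cp; have A := aQ_neq0 cp.
  have e0 : eps u D p != 0.
    by have [->|->] := eps_cases cp; rewrite ?oppr_eq0 oner_eq0.
  have n2 : (2 : R) != 0 by rewrite pnatr_eq0.
  have n64 : (64 : R) != 0 by rewrite pnatr_eq0.
  exact: mulf_neq0 n2 (mulf_neq0 e0 (mulf_neq0 (mulf_neq0 n64 (expf_neq0 6 U)) (expf_neq0 6 A))).
have ea4 := odeM okM ode_eps (odeM okM (odeX okM 4 ode_aQ)
  (odeM okM (ode_cst om 16) (odeX okM 4 ode_u))).
have ea6 := odeM okM ode_eps (odeM okM (odeM okM (ode_cst om 64) (odeX okM 6 ode_u))
  (odeX okM 6 ode_aQ)).
(* N and Q are the derivatives of the numerator and of the inverse denominator *)
have N := odeD okM (odeD okM (odeM okM (odeM okM (ode_cst om 9) ea4) ode_v2)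
    (odeN okM (odeM okM (ode_cst om 15) (odeX okM 3 ode_v2))))
  (odeM okM (odeM okM (ode_cst om 8) (odeX okM 2 ode_u)) ode_z4).
have Q := odeV okM E0 (odeM okM (ode_cst om 2) ea6).
apply: (ode_ext okM) (odeM okM N Q) => p cp; first by rewrite S4_aQ.
rewrite /= aQ'_S4// /S5 I1_aQ// w3_aQ// z4_S4//.
move: (S4 u D p) (z9 D p) => s Z9.
have U := u0 cp; have A := aQ_neq0 cp.
have [->|->] := eps_cases cp; field; rewrite ?U ?A//.
Qed.

(** At b = 1, c = 0 the connection forms are Omega_1 = qQ omega^7 and
    Theta = - gQ omega^6; the coefficients solve the torsion equations there. *)
Definition gQ p : R := aQ u D p * v2 D p / (4 * u p) + S4 u D p * aQ u D p ^+ 3 * u p.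
Definition qQ p : R := - (v2 D p / (4 * u p)) - 2 * S4 u D p * aQ u D p ^+ 2 * u p.

Lemma ode_gQ : ode om gQ (fun p => S5 u D p * (aQ u D p ^+ 5 * u p ^+ 2)).
Proof.
have u40 p : carrier p -> 4 * u p != 0 by move=> /u0 U; rewrite mulf_neq0.
have := odeD okM (odeM okM (odeM okM ode_aQ ode_v2) (odeV okM u40 (odeM okM (ode_cst om 4) ode_u)))
   (odeM okM (odeM okM ode_S4 (odeX okM 3 ode_aQ)) ode_u).
apply: (ode_ext okM) => p cp //=; rewrite aQ'_S4// w3_aQ//.
move: (S4 u D p) (S5 u D p) => s s5.
have U := u0 cp; have A := aQ_neq0 cp.
have [->|->] := eps_cases cp; field; rewrite ?U ?A//.
Qed.

End OneParameter.

(** * Torsion along the section b = 1, c = 0 *)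

(** The diagonal of the diagonal matrix H_mx r 1 0. *)
Definition weight (R : realType) (r : R) (k : 'I_8) : R :=
  nth 1 [:: r ^+ 5; r ^+ 4; r ^+ 6; r ^+ 3; r ^+ 2; r ^+ 3; r ^+ 2; 1] k.

Section MatrixOfConnection.
Variables (R : realType) (n : nat).
Implicit Types (O T : 'rV[R]_n) (t : 'I_8 -> 'rV[R]_n).

Definition conn_mx O T (k l : 'I_8) : 'rV[R]_n := table8
    [:: [:: - 2 *: O; - T];
        [:: 0; - 2 *: O];
        [:: - 2 *: T; 0; - 2 *: O];
        [:: 0; 0; 0; - 2 *: O; - T];
        [:: 0; 0; 0; 0; - 2 *: O];
        [:: 0; 0; 0; 2 *: O; 0; 0; - T];
        [:: 0; 0; 0; 0; 2 *: O; 0; 0];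
        [:: 0; 0; 0; 0; 0; 0; 0; - 2 *: O]] k l.

(** The product [conn_mx O T] ∧ t without its zero terms. *)
Definition conn_act O T t (k : 'I_8) : 'M[R]_n := nth 0
  [:: - 2 *: (O ∧ t^[1]) - T ∧ t^[2];
      - 2 *: (O ∧ t^[2]);
      - 2 *: (T ∧ t^[1]) - 2 *: (O ∧ t^[3]);
      - 2 *: (O ∧ t^[4]) - T ∧ t^[5];
      - 2 *: (O ∧ t^[5]);
      2 *: (O ∧ t^[4]) - T ∧ t^[7];
      2 *: (O ∧ t^[5]);
      - 2 *: (O ∧ t^[8])] k.

Lemma nrE t (j : nat) (h : (j < 8)%N) (k : 'I_8) : val k = j -> t k = t^[j.+1].
Proof. by move=> kj; congr (t _); apply/val_inj; rewrite /= kj inordK. Qed.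

Lemma conn_actE O T t k : \sum_l conn_mx O T k l ∧ t l = conn_act O T t k.
Proof.
rewrite !big_ord_recl big_ord0 (@nrE t 0)// (@nrE t 1)// (@nrE t 2)// (@nrE t 3)//
  (@nrE t 4)// (@nrE t 5)// (@nrE t 6)// (@nrE t 7)//.
case: k => -[|[|[|[|[|[|[|[|//]]]]]]]] ? ; rewrite /conn_mx /conn_act /table8 /=.
all: by rewrite ?wedge0l ?add0r ?addr0 ?wedgeZl ?wedgeNl ?scaleNr.
Qed.

End MatrixOfConnection.

(** This is (t^4 + t^6) ∧ (t^5 + t^7).  For the forms theta on the section b = 1,
    c = 0 the two factors are multiples of omega^6 and omega^7. *)
Definition curvQ (R : realType) n (t : 'I_8 -> 'rV[R]_n) : 'M[R]_n :=
  t^[4] ∧ t^[5] + t^[4] ∧ t^[7] - t^[5] ∧ t^[6] + t^[6] ∧ t^[7].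

Lemma ord8P (P : 'I_8 -> Prop) : P (inord 0) -> P (inord 1) -> P (inord 2) ->
  P (inord 3) -> P (inord 4) -> P (inord 5) -> P (inord 6) -> P (inord 7) -> forall k, P k.
Proof.
move=> P0 P1 P2 P3 P4 P5 P6 P7 k; rewrite -(inord_val k).
by case: k => -[|[|[|[|[|[|[|[|//]]]]]]]].
Qed.

Section BaseTorsion.
Variables (R : realType) (M : charted R 8) (om : 'I_8 -> form1 M) (u : M -> R).
Variable D : derived R M.
Hypothesis H : monge_I1_I2 om u D.

Let mU : monge_U om u. Proof. by case: H. Qed.
Let mM : is_manifold M. Proof. by case: mU. Qed.
Let okM := manifold_chart_ok mM.
Let som k : smooth_form (om k). Proof. by case: mU => _ []. Qed.
Let u0 p : carrier p -> u p != 0. Proof. by case: mU => _ _ _ + _; apply. Qed.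

Lemma has_dform_odeM f f' b db : ode om f f' -> has_dform b db ->
  has_dform (fun i x => f (psi i x) *: b i x)
    (fun i x => f' (psi i x) *: (w7 om i x ∧ b i x) + f (psi i x) *: db i x).
Proof.
move=> [sf hf] hb; apply: (has_dform_ext okM) (has_dformM okM sf hb) => // i x xi.
by rewrite hf// wedgeZl.
Qed.

Lemma dform_om k : (0 < k <= 8)%N -> has_dform (fun i x => (fun l => om l i x)^[k])
  (fun i x => let w := fun l => om l i x in nth 0
    [:: - (w^[4] ∧ w^[7]) - w^[5] ∧ w^[6];
        - 2 *: (w^[5] ∧ w^[7]);
        u (psi i x) *: (w^[2] ∧ w^[7]) - 2 *: (w^[4] ∧ w^[6]);
        w^[6] ∧ w^[8];
        w^[7] ∧ w^[8];
        0; 0; 0] k.-1).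
Proof.
move=> k8; split; first exact: som.
move=> i x xi; have [_ _ _ _ /(_ i x xi (inord k.-1))] := mU; rewrite /nr => -> /=.
by rewrite inordK//; case: k k8.
Qed.

(** The forms theta of the hypersurface {a = f}, at b = 1, c = 0. *)
Definition tau (f : M -> R) : 'I_8 -> form1 M :=
  fun k i x => weight (f (psi i x)) k *: bar om u D k i x.

Local Notation a := (aQ u D).

(** [tau] written so that the rules for d of a sum and of a product apply. *)
Definition tau_expr (k : nat) : form1 M := fun i x =>
  let w := fun l => om l i x in let p := psi i x in
  let V := v2 D p in let U := u p in
  nth 0
  [:: (- (a p ^+ 5 * U)) *: w^[1];
      (- (a p ^+ 4 * U)) *: w^[2];
      (- (a p ^+ 6 * U)) *: w^[3];
      (- a p ^+ 3) *: w^[4] + (- (a p ^+ 3 * (V / (4 * U)))) *: w^[1];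
      (- a p ^+ 2) *: w^[5] + (- (a p ^+ 2 * (V / (4 * U)))) *: w^[2];
      (a p ^+ 3 * U) *: w^[6] + a p ^+ 3 *: w^[4] + (a p ^+ 3 * (V / (4 * U))) *: w^[1];
      (a p ^+ 2 * U) *: w^[7] + a p ^+ 2 *: w^[5] + (a p ^+ 2 * (V / (4 * U))) *: w^[2];
      (- U^-1) *: w^[8] + (- (V / (2 * U ^+ 2))) *: w^[5]
        + (- (V ^+ 2 / (16 * U ^+ 3))) *: w^[2]] k.

Lemma tauE k i x : tau a k i x = tau_expr k i x.
Proof.
rewrite /tau /bar /weight /tau_expr.
case: k => -[|[|[|[|[|[|[|[|//]]]]]]]] ? /=.
all: by apply/rowP => j; rewrite !(mx_addE, mx_oppE, mx_scaleE); ring.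
Qed.

Definition Om0 : form1 M := fun i x => qQ u D (psi i x) *: (fun k => om k i x)^[7].
Definition Th0 : form1 M := fun i x => - gQ u D (psi i x) *: (fun k => om k i x)^[6].

Let odea := ode_aQ H.
Let odeu := ode_u H.
Let odeV2 := ode_v2 H.

Lemma ode_V4U : ode om (fun p => v2 D p / (4 * u p))
   (fun p => v2 D p * (- (4 * v2 D p) / (4 * u p) ^+ 2) + w3 D p / (4 * u p)).
Proof.
have u40 p : carrier p -> 4 * u p != 0 by move=> /u0 U; rewrite mulf_neq0.
apply: (ode_ext okM) ((odeM okM) odeV2 ((odeV okM) u40 ((odeM okM) (ode_cst om 4) odeu))) => // p _.
by rewrite mulr0 addr0 [in RHS]mulrC; congr (_ + _); rewrite mulrC.
Qed.

Definition base_torsion k i x : 'M[R]_8 :=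
  torsion_table (eps u D (psi i x)) (S4 u D (psi i x)) (fun l => tau a l i x) k
  - conn_act (Om0 i x) (Th0 i x) (fun l => tau a l i x) k.

Lemma tau_nr k i x : (0 < k <= 8)%N -> (fun l => tau a l i x)^[k] = tau_expr k.-1 i x.
Proof. by case: k => // k k8; rewrite /nr tauE /= inordK. Qed.

Let ca n := odeX okM n odea.
Local Notation oN := (odeN okM).
Local Notation oM := (odeM okM).
Local Notation dD := (has_dformD okM).
Local Notation dM := has_dform_odeM.
Local Notation dw k := (@dform_om k isT).

Ltac generalize_om := rewrite /nr /=; repeat match goal with
  |- context [om ?k ?i ?x] => generalize (om k i x); intro end.

(** Compares the coefficients of omega^p ∧ omega^q: an identity rational in u, v2, a
    and S_4 in which eps occurs linearly only. *)
Ltac tau_by h := apply: (has_dform_ext okM _ _ h) => ? ? ?;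
  [by rewrite tauE inordK
  |lazymatch goal with hx : img ?i ?x |- _ =>
     let cp := constr:(carrier_psi okM hx) in
     rewrite /base_torsion /torsion_table /conn_act !inordK//= !tau_nr//=;
     rewrite /tau_expr /Om0 /Th0 /w7 /qQ /gQ /= ?(aQ'_S4 H cp) ?(w3_aQ H cp);
     move: (u0 cp) (aQ_neq0 H cp);
     generalize (S4 u D (psi i x)) (eps u D (psi i x)) (v2 D (psi i x)) (u (psi i x))
       (a (psi i x)) => ? ? ? ? ? ? ?; generalize_om; wedge_entries; field;
     repeat match goal with h0 : is_true (_ != 0) |- _ => rewrite ?h0; clear h0 end; done
   end].

Lemma dform_tau k : has_dform (tau a k) (base_torsion k).
Proof.
have n2 : (2 : R) != 0 by rewrite pnatr_eq0.
have n16 : (16 : R) != 0 by rewrite pnatr_eq0.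
have u20 p : carrier p -> 2 * u p ^+ 2 != 0.
  by move=> /u0 U; exact: mulf_neq0 n2 (expf_neq0 2 U).
have u16 p : carrier p -> 16 * u p ^+ 3 != 0.
  by move=> /u0 U; exact: mulf_neq0 n16 (expf_neq0 3 U).
move: k; apply: ord8P.
- tau_by (dM (oN (oM (ca 5) odeu)) (dw 1)).
- tau_by (dM (oN (oM (ca 4) odeu)) (dw 2)).
- tau_by (dM (oN (oM (ca 6) odeu)) (dw 3)).
- tau_by (dD (dM (oN (ca 3)) (dw 4)) (dM (oN (oM (ca 3) ode_V4U)) (dw 1))).
- tau_by (dD (dM (oN (ca 2)) (dw 5)) (dM (oN (oM (ca 2) ode_V4U)) (dw 2))).
- tau_by (dD (dD (dM (oM (ca 3) odeu) (dw 6)) (dM (ca 3) (dw 4)))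
             (dM (oM (ca 3) ode_V4U) (dw 1))).
- tau_by (dD (dD (dM (oM (ca 2) odeu) (dw 7)) (dM (ca 2) (dw 5)))
             (dM (oM (ca 2) ode_V4U) (dw 2))).
- tau_by (dD (dD (dM (oN (odeV okM u0 odeu)) (dw 8))
                 (dM (oN (oM odeV2 (odeV okM u20 (oM (ode_cst om 2) (odeX okM 2 odeu))))) (dw 5)))
             (dM (oN (oM (odeX okM 2 odeV2)
                         (odeV okM u16 (oM (ode_cst om 16) (odeX okM 3 odeu))))) (dw 2))).
Qed.

Let u40 p : carrier p -> 4 * u p != 0.
Proof. by move=> /u0 U; rewrite mulf_neq0. Qed.

Lemma dform_Om0 : has_dform Om0 (fun _ _ => 0).
Proof.
have hq := odeD okM (odeN okM ode_V4U) (odeN okM (odeM okM (odeM okM (odeM okM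
  (ode_cst om 2) (ode_S4 H)) (ca 2)) odeu)).
have h := has_dform_odeM (b := fun i x => (fun k => om k i x)^[7]) hq (@dform_om 7 isT).
apply: (has_dform_ext okM _ _ h) => [i x xi //|i x xi].
by rewrite /w7 wedgexx !scaler0 addr0.
Qed.

(** The derivative of gQ is S_5 a^5 u^2, and a^5 u^2 omega^6 ∧ omega^7 is the curvature
    form of tau. *)
Lemma dform_Th0 : has_dform Th0
  (fun i x => S5 u D (psi i x) *: curvQ (fun l => tau a l i x)).
Proof.
have h := has_dform_odeM (odeN okM (ode_gQ H)) (@dform_om 6 isT).
apply: (has_dform_ext okM _ _ h) => [i x xi //|i x xi].
have cp := carrier_psi okM xi.
rewrite /curvQ !tau_nr//= /w7 /tau_expr /=.
move: (S5 u D _) (u0 cp) => s5 U.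
generalize_om; wedge_entries.
by field; rewrite U.
Qed.

End BaseTorsion.

(** * Equivariance under the structure group *)

Section Equivariance.
Variables (R : realType) (n : nat).
Implicit Types (t : 'I_8 -> 'rV[R]_n).

(** The effect on 2-forms of the linear change v |-> v *m P of covectors. *)
Definition congr_mx p (P : 'M[R]_(n, p)) (A : 'M[R]_n) : 'M[R]_p := P^T *m A *m P.

Section CongrMx.
Variables (p : nat) (P : 'M[R]_(n, p)).
Lemma congr_mx_wedge a b : congr_mx P (a ∧ b) = (a *m P) ∧ (b *m P).
Proof. by rewrite wedge_mulmx. Qed.
Lemma congr_mxD A B : congr_mx P (A + B) = congr_mx P A + congr_mx P B.
Proof. by rewrite /congr_mx mulmxDr mulmxDl. Qed.
Lemma congr_mxN A : congr_mx P (- A) = - congr_mx P A.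
Proof. by rewrite /congr_mx mulmxN mulNmx. Qed.
Lemma congr_mxZ r A : congr_mx P (r *: A) = r *: congr_mx P A.
Proof. by rewrite /congr_mx -scalemxAr -scalemxAl. Qed.
End CongrMx.

Lemma torsion_table_mulmx p e s t (P : 'M[R]_(n, p)) k :
  torsion_table e s (fun l => t l *m P) k = congr_mx P (torsion_table e s t k).
Proof.
rewrite /torsion_table /nr.
case: k => -[|[|[|[|[|[|[|[|//]]]]]]]] ? /=.
all: by rewrite !(congr_mx_wedge, congr_mxD, congr_mxN, congr_mxZ).
Qed.

Lemma conn_act_mulmx p (O T : 'rV[R]_n) t (P : 'M[R]_(n, p)) k :
  conn_act (O *m P) (T *m P) (fun l => t l *m P) k = congr_mx P (conn_act O T t k).
Proof.
rewrite /conn_act /nr.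
case: k => -[|[|[|[|[|[|[|[|//]]]]]]]] ? /=.
all: by rewrite !(congr_mx_wedge, congr_mxD, congr_mxN, congr_mxZ).
Qed.

(** The coframe h t for h = H_mx 1 b m. *)
Definition H0_act (b m : R) t (k : 'I_8) : 'rV[R]_n := nth 0
  [:: b *: t^[1] + (b * m) *: t^[2];
      b *: t^[2];
      (2 * b * m) *: t^[1] + (b * m ^+ 2) *: t^[2] + b *: t^[3];
      b *: t^[4] + (b * m) *: t^[5];
      b *: t^[5];
      (1 - b) *: t^[4] + ((1 - b) * m) *: t^[5] + t^[6] + m *: t^[7];
      (1 - b) *: t^[5] + t^[7];
      b *: t^[8]] k.

Lemma H0_actE b m t k : \sum_l H_mx 1 b m k l *: t l = H0_act b m t k.
Proof.
rewrite !big_ord_recl big_ord0 (@nrE _ _ t 0)// (@nrE _ _ t 1)// (@nrE _ _ t 2)//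
  (@nrE _ _ t 3)// (@nrE _ _ t 4)// (@nrE _ _ t 5)// (@nrE _ _ t 6)// (@nrE _ _ t 7)//.
rewrite !mxE /table8.
case: k => -[|[|[|[|[|[|[|[|//]]]]]]]] ? /=; apply/rowP => j;
  rewrite !(mx_addE, mx_scaleE, mx_0E); ring.
Qed.

Lemma weight_actE r t k : \sum_l H_mx r 1 0 k l *: t l = weight r k *: t k.
Proof.
rewrite (bigD1 k)//= big1 ?addr0 => [|l lk].
  congr (_ *: _); rewrite mxE /table8 /weight.
  case: k => -[|[|[|[|[|[|[|[|//]]]]]]]] ? /=; ring.
rewrite (_ : H_mx _ _ _ _ _ = 0) ?scale0r//.
rewrite mxE /table8; move: lk; rewrite -(inj_eq val_inj); case: k => -[|[|[|[|[|[|[|[|//]]]]]]]] kk;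
  case: l => -[|[|[|[|[|[|[|[|//]]]]]]]] ll //= _; rewrite ?subrr ?mulr0 ?mul0r ?expr0n ?mulr0//.
Qed.

End Equivariance.

Lemma H_coord_row (R : realType) (a : R) (h : 'rV[R]_2) :
  H_coord (row_mx (\row_(k < 1) a) h : 'rV[R]_3) = H_mx a (h 0 0) (h 0 1).
Proof.
rewrite /H_coord.
have -> : (2 : 'I_3) = rshift 1 (1 : 'I_2) by apply/val_inj.
have -> : (0 : 'I_3) = lshift 2 (0 : 'I_1) by apply/val_inj.
have -> : (1 : 'I_3) = rshift 1 (0 : 'I_2) by apply/val_inj.
by rewrite (@row_mxEl _ 1 1 2) !(@row_mxEr _ 1 1 2) mxE.
Qed.

Section Reduction.
Variables (R : realType) (M : charted R 8) (om : 'I_8 -> form1 M) (u : M -> R).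
Variable D : derived R M.
Hypothesis mU : monge_U om u.

Let mM : is_manifold M. Proof. by case: mU. Qed.
Let okM := manifold_chart_ok mM.
Let idM := chart_smooth_id mM.

Lemma open_H0_dom : open (@H0_dom R).
Proof.
apply: (@open_comp _ _ (fun h : 'rV[R]_2 => h 0 0) [set x | x != 0]).
  by move=> h _; exact: coord_continuous.
exact: open_neq.
Qed.

Let okQ : chart_ok (Q10 M) := prod_chart_ok okM open_H0_dom.

Lemma chart_smooth_idQ : chart_smooth (@idfun (Q10 M)).
Proof.
apply: (prod_chart_smooth okM open_H0_dom idM) => // l.
exact: (smooth_fun_snd okM open_H0_dom).
Qed.

Definition fb (q : Q10 M) : R := q.2 0 0.
Definition fc (q : Q10 M) : R := q.2 0 1.

Lemma smooth_fb : smooth_fun fb. Proof. exact: (smooth_fun_snd okM open_H0_dom 0). Qed.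
Lemma smooth_fc : smooth_fun fc. Proof. exact: (smooth_fun_snd okM open_H0_dom 1). Qed.

Lemma fb_neq0 q : carrier q -> fb q != 0.
Proof. by case/carrier_prod. Qed.

Definition liftQ (a : form1 M) : form1 (Q10 M) := lift_form a.

(** The forms of M x H are combinations of forms pulled back from M, so that of the
    inclusion of the hypersurface only the projection to M matters. *)
Lemma theta_lift (f : M -> R) k i y : smooth_fun f -> img i y ->
  theta om u D f k i y = \sum_l H_mx (f (psi i y).1) (fb (psi i y)) (fc (psi i y)) k l
     *: liftQ (bar om u D l) i y.
Proof.
move=> sf yi; have [yi' _] := (img_prod i y).1 yi; have oi := img_open okQ i.
pose g (y : 'rV[R]_(8 + 2)) : 'rV[R]_(8 + 3) := @phi R _ (G11 M) i (Defs.incl f (@psi R _ (Q10 M) i y)).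
have nl : {near y, (fun z => lsubmx (g z)) =1 (fun z : 'rV_(8 + 2) => lsubmx z)}.
  apply: (near_open oi yi) => z /img_prod[zi _].
  by rewrite /g /= row_mxKl phiK.
have dg : differentiable g y.
  apply: differentiable_rV => l; case: (split_ordP l) => b ->.
    apply: (@near_eq_differentiable _ _ _ (fun z : 'rV[R]_(8 + 2) => z 0 (lshift 2 b))).
      apply: filterS nl => z /rowP/(_ b); rewrite !mxE => E.
      by rewrite E.
    exact: differentiable_coord.
  case: (@split_ordP 1 2 b) => c ->.
    apply: (@near_eq_differentiable _ _ _ (fun z => f (@psi R _ (Q10 M) i z).1)).
      apply: filterE => z; rewrite /g /= row_mxEr. by rewrite (@row_mxEl _ 1 1 2) mxE.
    exact: (smooth_fun_diff (smooth_fun_fst okM open_H0_dom sf) yi).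
  apply: (@near_eq_differentiable _ _ _ (fun z : 'rV[R]_(8 + 2) => z 0 (rshift 8 c))).
    by apply: filterE => z; rewrite /g /= row_mxEr (@row_mxEr _ 1 1 2) mxE.
  exact: differentiable_coord.
have lg : lsubmx (g y) = lsubmx y by rewrite (nbhs_singleton nl).
have row0 (v : 'rV[R]_8) : row_mx v (0 : 'rV[R]_3) = v *m (jacobian (lsubmx : 'rV[R]_(8 + 3) -> 'rV[R]_8) (g y))^T.
  by rewrite jacobian_lsubmx tr_col_mx trmx1 trmx0 mul_mx_row mulmx1 mulmx0.
rewrite /theta /theta_G /pull -/g mulmx_suml; apply: eq_bigr => l _.
rewrite -scalemxAl -/(g y) lg; congr (_ *: _).
  by rewrite /g /= row_mxKr H_coord_row.
rewrite row0 -mulmxA -trmx_mul -(jacobian_comp dg (differentiable_lsubmx _)).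
have dl : differentiable (fun z => lsubmx (g z)) y.
  exact: (differentiable_comp dg (differentiable_lsubmx _)).
by rewrite (near_jacobian dl nl) /liftQ liftE jacobian_lsubmx.
Qed.

End Reduction.

(** * Torsion on Q *)

Lemma mx_act (R : nzRingType) n (V : lmodType R) (A B : 'M[R]_n) (v : 'I_n -> V) k :
  \sum_l A k l *: (\sum_j B l j *: v j) = \sum_j (A *m B) k j *: v j.
Proof.
under eq_bigr do rewrite scaler_sumr.
rewrite exchange_big; apply: eq_bigr => j _.
by rewrite mxE scaler_suml; apply: eq_bigr => l _; rewrite scalerA.
Qed.

Section QTorsion.
Variables (R : realType) (M : charted R 8) (om : 'I_8 -> form1 M) (u : M -> R).
Variable D : derived R M.
Hypothesis H : monge_I1_I2 om u D.

Let mU : monge_U om u. Proof. by case: H. Qed.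
Let mM : is_manifold M. Proof. by case: mU. Qed.
Let okM := manifold_chart_ok mM.
Let idM := chart_smooth_id mM.
Let oH := @open_H0_dom R.
Let okQ : chart_ok (Q10 M) := prod_chart_ok okM oH.
Let idQ : chart_smooth (@idfun (Q10 M)) := chart_smooth_idQ mU.
Let sb := smooth_fb mU.
Local Notation a := (aQ u D).
Let sa : smooth_fun a := (ode_aQ H).1.

(** H_mx a b c = H_mx 1 b (c a) *m H_mx a 1 0: in the fibre coordinates b and m = c a
    the group H_0 acts on Q as it does on itself. *)
Definition fm (q : Q10 M) : R := fc q * a q.1.

Lemma smooth_fm : smooth_fun fm.
Proof. exact: (smooth_funM okQ (smooth_fc mU) (smooth_fun_fst okM oH sa)). Qed.

(** As H_0 is abelian, a connection is the Maurer-Cartan form of H_0, that is db / 2b and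
    dm in the present normalization, plus the pull-back of its value on a section. *)
Definition conn_Om : form1 (Q10 M) := fun i y =>
  (2 * fb (psi i y))^-1 *: dF (@fb R M) i y + liftQ (Om0 om u D) i y.
Definition conn_Th : form1 (Q10 M) := fun i y => dF fm i y + liftQ (Th0 om u D) i y.

Lemma theta_H0 k i y : img i y -> theta om u D a k i y =
  H0_act (fb (psi i y)) (fm (psi i y)) (fun l => liftQ (tau om u D a l) i y) k.
Proof.
move=> yi; have [ca _] := (carrier_prod _).1 (carrier_psi okQ yi).
rewrite (theta_lift D mU k sa yi) -H0_actE.
have a0 := aQ_neq0 H ca.
have E : H_mx (a (psi i y).1) (fb (psi i y)) (fc (psi i y)) =
    H_mx 1 (fb (psi i y)) (fm (psi i y)) *m H_mx (a (psi i y).1) 1 0.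
  by rewrite H_mx_mul// mul1r mulr1 add0r /fm mulfK.
rewrite E -mx_act//; apply: eq_bigr => l _; congr (_ *: _).
rewrite (weight_actE _ (fun j => liftQ (bar om u D j) i y)).
by rewrite /liftQ /tau /lift_form scale_row_mx scaler0.
Qed.

(** df in terms of the differentials of the fibre coordinates b and m. *)
Definition ode2 (f p q : Q10 M -> R) : Prop := smooth_fun f /\
  forall i y, img i y -> dF f i y = p (psi i y) *: dF (@fb R M) i y + q (psi i y) *: dF fm i y.

Lemma ode2_b : ode2 (@fb R M) (fun=> 1) (fun=> 0).
Proof. by split=> // i y yi; rewrite scale1r scale0r addr0. Qed.

Lemma ode2_m : ode2 fm (fun=> 0) (fun=> 1).
Proof. by split=> [|i y yi]; [exact: smooth_fm|rewrite scale1r scale0r add0r]. Qed.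

Lemma ode2_cst c : ode2 (fun=> c) (fun=> 0) (fun=> 0).
Proof.
split=> [|i y yi]; first exact: smooth_fun_cst.
by rewrite /dF dfun_cst !scale0r addr0.
Qed.

Lemma ode2D f g p q p' q' : ode2 f p q -> ode2 g p' q' ->
  ode2 (fun x => f x + g x) (fun x => p x + p' x) (fun x => q x + q' x).
Proof.
move=> [sf df] [sg dg]; split; first exact: smooth_funD.
move=> i y yi; rewrite /dF dfunD; [|exact: smooth_fun_diff sf yi|exact: smooth_fun_diff sg yi].
by rewrite -/(dF f i y) -/(dF g i y) df// dg// !scalerDl addrACA.
Qed.

Lemma ode2M f g p q p' q' : ode2 f p q -> ode2 g p' q' ->
  ode2 (fun x => f x * g x) (fun x => f x * p' x + g x * p x)
    (fun x => f x * q' x + g x * q x).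
Proof.
move=> [sf df] [sg dg]; split; first exact: smooth_funM.
move=> i y yi; rewrite /dF dfunM; [|exact: smooth_fun_diff sf yi|exact: smooth_fun_diff sg yi].
by rewrite -/(dF f i y) -/(dF g i y) df// dg// !scalerDr !scalerDl !scalerA addrACA.
Qed.

Lemma ode2N f p q : ode2 f p q -> ode2 (fun x => - f x) (fun x => - p x) (fun x => - q x).
Proof.
move=> [sf df]; split; first exact: smooth_funN.
move=> i y yi; have E : dF (fun x => - f x) i y = - dF f i y.
  have d := smooth_fun_diff sf yi.
  rewrite -scaleN1r -[RHS]addr0 -(scaler0 _ (f (psi i y))) -(dfun_cst (-1) y).
  rewrite /dF -dfunM//; apply: near_dfun; apply: filterE => z.
  by rewrite mulN1r.
by rewrite E df// opprD !scaleNr.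
Qed.

Lemma has_dform_ode2M f p q b db : ode2 f p q -> has_dform b db ->
  has_dform (fun i x => f (psi i x) *: b i x)
    (fun i x => (p (psi i x) *: dF (@fb R M) i x + q (psi i x) *: dF fm i x) ∧ b i x
                + f (psi i x) *: db i x).
Proof.
move=> [sf hf] hb; apply: (has_dform_ext okQ) (has_dformM okQ sf hb) => // i x xi.
by rewrite hf.
Qed.

Lemma smooth_liftQ (b : form1 M) : smooth_form b -> smooth_form (liftQ b).
Proof.
move=> sb'; have [s cb] := sb'; split; last first.
  exact: (is_pullback_lift okM oH idM (F := idfun) (L := idfun) _ _ idQ cb).
move=> i k; have oi := img_open okQ i; case: (split_ordP k) => l ->.
  have U y : img i y -> @img R _ M i (lsubmx y) by move=> /img_prod[].
  apply: (smooth_ext oi _ (smooth_comp oi U (fun l => smooth_lsubmx l oi) (s i l))).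
  by move=> y yi; rewrite /liftQ /lift_form row_mxEl.
apply: (smooth_ext oi _ (smooth_cst _ 0)) => y yi.
by rewrite /liftQ /lift_form row_mxEr mxE.
Qed.

Local Notation T l i y := (liftQ (tau om u D a l) i y).

Lemma dform_lift_tau k : has_dform (liftQ (tau om u D a k)) (fun i y =>
  torsion_table (eps u D (psi i y).1) (S4 u D (psi i y).1) (fun l => T l i y) k
  - conn_act (liftQ (Om0 om u D) i y) (liftQ (Th0 om u D) i y) (fun l => T l i y) k).
Proof.
have [st dt] := dform_tau H k; split; first exact: smooth_liftQ.
move=> i y yi; have [yi' _] := (img_prod i y).1 yi.
rewrite (dform_lift okM oH st yi) dt// /base_torsion -[X in X *m _ *m _]trmxK -/(congr_mx _ _).
rewrite congr_mxD congr_mxN -torsion_table_mulmx -conn_act_mulmx.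
have E : (fun l => T l i y) = fun l => tau om u D a l i (lsubmx y) *m (col_mx 1%:M 0)^T.
  by apply/funext => l; exact: liftE.
by rewrite E /liftQ !liftE.
Qed.

Lemma dform_lift_tau_nr j : has_dform (fun i y => (fun l => T l i y)^[j]) (fun i y =>
  torsion_table (eps u D (psi i y).1) (S4 u D (psi i y).1) (fun l => T l i y) (inord j.-1)
  - conn_act (liftQ (Om0 om u D) i y) (liftQ (Th0 om u D) i y) (fun l => T l i y) (inord j.-1)).
Proof. exact: dform_lift_tau. Qed.

(** Passing from tau to theta in two steps, through the unipotent factor H_mx 1 1 m
    and then the diagonal factor H_mx 1 b 0, keeps the polynomial identities small. *)
Definition sigma k : form1 (Q10 M) := fun i y =>
  H0_act 1 (fm (psi i y)) (fun l => T l i y) k.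

Lemma sigma_nr j (i : ix (Q10 M)) y : (0 < j <= 8)%N -> (fun l => sigma l i y)^[j] =
  nth 0 (let m := fm (psi i y) in let t := fun l => T l i y in
  [:: t^[1] + m *: t^[2];
      t^[2];
      (2 * m) *: t^[1] + (m * m) *: t^[2] + t^[3];
      t^[4] + m *: t^[5];
      t^[5];
      t^[6] + m *: t^[7];
      t^[7];
      t^[8]]) j.-1.
Proof.
case: j => // j j8; rewrite /nr /sigma /H0_act inordK// subrr !scale0r !mul0r !scale0r.
by rewrite !add0r !mulr1 !mul1r !scale1r expr2.
Qed.

Definition sigma_torsion k (i : ix (Q10 M)) (y : 'rV[R]_(8 + 2)) :=
  torsion_table (eps u D (psi i y).1) (S4 u D (psi i y).1) (fun l => sigma l i y) k
  - conn_act (liftQ (Om0 om u D) i y) (conn_Th i y) (fun l => sigma l i y) k.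

Let b1 := ode2_b.
Let m1 := ode2_m.

Ltac generalize_forms := rewrite /nr /=; repeat match goal with
  | |- context [liftQ ?f ?i ?x] => generalize (liftQ f i x); intro
  | |- context [sigma ?f ?i ?x] => generalize (sigma f i x); intro
  | |- context [dF ?f ?i ?x] => generalize (dF f i x); intro
  | |- context [eps u D ?p] => generalize (eps u D p); intro
  | |- context [S4 u D ?p] => generalize (S4 u D p); intro
  | |- context [fm ?q] => generalize (fm q); intro
  | |- context [fb ?q] => generalize (fb q); intro
  end.

Ltac sigma_by j h := apply: (has_dform_ext okQ _ _ h) => [? ? _|? ? ?];
  [exact: esym (@sigma_nr j _ _ isT)
  |rewrite /sigma_torsion /torsion_table /conn_act !inordK//= !sigma_nr//= /conn_Th;
   generalize_forms; wedge_entries; ring].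

Lemma dform_sigma k : has_dform (sigma k) (sigma_torsion k).
Proof.
move: k; apply: ord8P.
- sigma_by 1%N (has_dformD okQ (dform_lift_tau_nr 1) (has_dform_ode2M m1 (dform_lift_tau_nr 2))).
- sigma_by 2%N (dform_lift_tau_nr 2).
- sigma_by 3%N (has_dformD okQ
    (has_dformD okQ (has_dform_ode2M (ode2M (ode2_cst 2) m1) (dform_lift_tau_nr 1))
                    (has_dform_ode2M (ode2M m1 m1) (dform_lift_tau_nr 2)))
    (dform_lift_tau_nr 3)).
- sigma_by 4%N (has_dformD okQ (dform_lift_tau_nr 4) (has_dform_ode2M m1 (dform_lift_tau_nr 5))).
- sigma_by 5%N (dform_lift_tau_nr 5).
- sigma_by 6%N (has_dformD okQ (dform_lift_tau_nr 6) (has_dform_ode2M m1 (dform_lift_tau_nr 7))).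
- sigma_by 7%N (dform_lift_tau_nr 7).
- sigma_by 8%N (dform_lift_tau_nr 8).
Qed.

Lemma dform_sigma_nr j : has_dform (fun i y => (fun l => sigma l i y)^[j])
  (fun i y => sigma_torsion (inord j.-1) i y).
Proof. exact: dform_sigma. Qed.

Lemma theta_sigma k i y : img i y -> theta om u D a k i y =
  H0_act (fb (psi i y)) 0 (fun l => sigma l i y) k.
Proof.
move=> yi; rewrite theta_H0// -!H0_actE.
have -> : H_mx 1 (fb (psi i y)) (fm (psi i y)) =
    H_mx 1 (fb (psi i y)) 0 *m H_mx 1 1 (fm (psi i y)).
  by rewrite H_mx_mul ?oner_neq0// !mulr1 mul0r addr0.
rewrite -mx_act; apply: eq_bigr => l _; congr (_ *: _).
by rewrite H0_actE.
Qed.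

Lemma theta_nr j (i : ix (Q10 M)) y : img i y -> (0 < j <= 8)%N ->
  (fun l => theta om u D a l i y)^[j] =
  nth 0 (let b := fb (psi i y) in let t := fun l => sigma l i y in
  [:: b *: t^[1];
      b *: t^[2];
      b *: t^[3];
      b *: t^[4];
      b *: t^[5];
      (1 - b) *: t^[4] + t^[6];
      (1 - b) *: t^[5] + t^[7];
      b *: t^[8]]) j.-1.
Proof.
move=> yi; case: j => // j j8; rewrite /nr theta_sigma// /H0_act inordK//.
by rewrite expr0n /= !mulr0 !scale0r !addr0 !add0r.
Qed.

Definition Q_torsion k (i : ix (Q10 M)) (y : 'rV[R]_(8 + 2)) :=
  torsion_table (eps u D (psi i y).1) (S4 u D (psi i y).1)
    (fun l => theta om u D a l i y) k
  - conn_act (conn_Om i y) (conn_Th i y) (fun l => theta om u D a l i y) k.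

Let b0 (i : ix (Q10 M)) y : img i y -> fb (psi i y) != 0.
Proof. by move=> /(carrier_psi okQ) /fb_neq0. Qed.

(** Writes db through db / 2b, so that the identities contain no quotient. *)
Let dF_fbE (i : ix (Q10 M)) y : img i y -> dF (@fb R M) i y =
  (2 * fb (psi i y)) *: ((2 * fb (psi i y))^-1 *: dF (@fb R M) i y).
Proof.
move=> yi; rewrite scalerA mulfV ?scale1r// mulf_neq0 ?pnatr_eq0//.
exact: b0 yi.
Qed.

Let nb : ode2 (fun q => 1 - fb q) _ _ := ode2D (ode2_cst 1) (ode2N b1).

Ltac theta_by j h := apply: (has_dform_ext okQ _ _ h) => ? ? ?;
  [match goal with hy : img _ _ |- _ => exact: esym (@theta_nr j _ _ hy isT) end
  |match goal with hy : img ?i ?y |- _ =>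
     rewrite /Q_torsion /sigma_torsion /torsion_table /conn_act !inordK//= !theta_nr//=
       /conn_Om; generalize (conn_Th i y); intro;
     move: (dF_fbE hy); move: (_^-1 *: dF _ _ _) => ? ->;
     generalize_forms; wedge_entries; ring end].

Lemma dform_theta k : has_dform (theta om u D a k) (Q_torsion k).
Proof.
move: k; apply: ord8P.
- theta_by 1%N (has_dform_ode2M b1 (dform_sigma_nr 1)).
- theta_by 2%N (has_dform_ode2M b1 (dform_sigma_nr 2)).
- theta_by 3%N (has_dform_ode2M b1 (dform_sigma_nr 3)).
- theta_by 4%N (has_dform_ode2M b1 (dform_sigma_nr 4)).
- theta_by 5%N (has_dform_ode2M b1 (dform_sigma_nr 5)).
- theta_by 6%N (has_dformD okQ (has_dform_ode2M nb (dform_sigma_nr 4)) (dform_sigma_nr 6)).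
- theta_by 7%N (has_dformD okQ (has_dform_ode2M nb (dform_sigma_nr 5)) (dform_sigma_nr 7)).
- theta_by 8%N (has_dform_ode2M b1 (dform_sigma_nr 8)).
Qed.

End QTorsion.

(** * The structure group and its Lie algebra *)

Section StructureGroup.
Variable R : realType.
Implicit Types a b c : R.

Lemma H_mx1 : H_mx 1 1 0 = 1%:M :> 'M[R]_8.
Proof.
apply/matrixP => i j; rewrite !mxE /table8.
case: i => -[|[|[|[|[|[|[|[|//]]]]]]]] hi;
  case: j => -[|[|[|[|[|[|[|[|//]]]]]]]] hj /=; ring.
Qed.

Lemma H_mx_inv a b c : a != 0 -> b != 0 ->
  H_mx a b c *m H_mx a^-1 b^-1 (- (c * a)) = 1%:M.
Proof.
move=> a0 b0; rewrite H_mx_mul ?invr_eq0// !mulfV// invrK.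
by rewrite addrC subrr H_mx1.
Qed.

Lemma H_mx_unit a b c : a != 0 -> b != 0 -> H_mx a b c \in unitmx.
Proof. by move=> a0 b0; have [] := mulmx1_unit (H_mx_inv c a0 b0). Qed.

Lemma invmx_H_mx a b c : a != 0 -> b != 0 ->
  invmx (H_mx a b c) = H_mx a^-1 b^-1 (- (c * a)).
Proof.
move=> a0 b0; apply: (can_inj (mulKmx (H_mx_unit c a0 b0))).
by rewrite mulmxV ?H_mx_unit// H_mx_inv.
Qed.

Lemma h0_mxE (B C : R) : h0_mx B C = B *: h0_mx 1 0 + C *: h0_mx 0 1.
Proof.
apply/matrixP => i j; rewrite !mxE /table8.
case: i => -[|[|[|[|[|[|[|[|//]]]]]]]] hi;
  case: j => -[|[|[|[|[|[|[|[|//]]]]]]]] hj /=; ring.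
Qed.

Lemma h0_mxC (B C B' C' : R) : h0_mx B C *m h0_mx B' C' = h0_mx B' C' *m h0_mx B C.
Proof.
apply/matrixP => i j; rewrite !mxE.
rewrite !big_ord_recl !big_ord0 !mxE /table8.
case: i => -[|[|[|[|[|[|[|[|//]]]]]]]] hi;
  case: j => -[|[|[|[|[|[|[|[|//]]]]]]]] hj /=; ring.
Qed.

Lemma h0_H0C (B C b c : R) : h0_mx B C *m H_mx 1 b c = H_mx 1 b c *m h0_mx B C.
Proof.
apply/matrixP => i j; rewrite !mxE.
rewrite !big_ord_recl !big_ord0 !mxE /table8.
case: i => -[|[|[|[|[|[|[|[|//]]]]]]]] hi;
  case: j => -[|[|[|[|[|[|[|[|//]]]]]]]] hj /=; ring.
Qed.

Lemma conn_mxE n (O T : 'rV[R]_n) k l :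
  conn_mx O T k l = h0_mx 1 0 k l *: (- 2 *: O) + h0_mx 0 1 k l *: (- T).
Proof.
rewrite !mxE /conn_mx /table8.
case: k => -[|[|[|[|[|[|[|[|//]]]]]]]] hk;
  case: l => -[|[|[|[|[|[|[|[|//]]]]]]]] hl /=;
  apply/rowP => j; rewrite !(mx_addE, mx_oppE, mx_scaleE, mx_0E); ring.
Qed.

(** h_0 is abelian. *)
Lemma conn_mx_flat n (O T : 'rV[R]_n) k l :
  \sum_r conn_mx O T k r ∧ conn_mx O T r l = 0.
Proof.
pose A := h0_mx (1 : R) 0; pose B := h0_mx (0 : R) 1.
pose O' := - 2 *: O; pose T' := - T.
transitivity ((A *m B) k l *: (O' ∧ T') + (B *m A) k l *: (T' ∧ O')).
  rewrite !mxE !scaler_suml -big_split; apply: eq_bigr => r _ /=.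
  rewrite !conn_mxE -/O' -/T' -/A -/B !(wedgeDl, wedgeDr, wedgeZl, wedgeZr) !wedgexx.
  by rewrite ?scaler0 ?add0r ?addr0 !scalerA; congr (_ *: _ + _); rewrite mulrAC.
by rewrite (h0_mxC 0 1 1 0 : B *m A = A *m B) (wedgeC T' O') scalerN subrr.
Qed.

End StructureGroup.

Section BarMatrix.
Variable R : realType.

(** The matrix of the forms bar omega in the coframe omega. *)
Definition bar_mx (U V : R) : 'M[R]_8 := \matrix_(i, j) table8
  [:: [:: - U]; [:: 0; - U]; [:: 0; 0; - U];
      [:: - (V / (4 * U)); 0; 0; - 1];
      [:: 0; - (V / (4 * U)); 0; 0; - 1];
      [:: V / (4 * U); 0; 0; 1; 0; U];
      [:: 0; V / (4 * U); 0; 0; 1; 0; U];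
      [:: 0; - (V ^+ 2 / (16 * U ^+ 3)); 0; 0; - (V / (2 * U ^+ 2)); 0; 0; - U^-1]] i j.

Definition bar_inv (U V : R) : 'M[R]_8 := \matrix_(i, j) table8
  [:: [:: - U^-1]; [:: 0; - U^-1]; [:: 0; 0; - U^-1];
      [:: V / (4 * U ^+ 2); 0; 0; - 1];
      [:: 0; V / (4 * U ^+ 2); 0; 0; - 1];
      [:: 0; 0; 0; U^-1; 0; U^-1];
      [:: 0; 0; 0; 0; U^-1; 0; U^-1];
      [:: 0; - (V ^+ 2 / (16 * U ^+ 3)); 0; 0; V / (2 * U); 0; 0; - U]] i j.

Lemma bar_mx_unit U V : U != 0 -> bar_mx U V \in unitmx.
Proof.
move=> U0; have E : bar_mx U V *m bar_inv U V = 1%:M.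
  apply/matrixP => i j; rewrite !mxE.
  rewrite !big_ord_recl !big_ord0 !mxE /table8.
  case: i => -[|[|[|[|[|[|[|[|//]]]]]]]] hi;
    case: j => -[|[|[|[|[|[|[|[|//]]]]]]]] hj /=; field; rewrite ?U0//.
by have [] := mulmx1_unit E.
Qed.

End BarMatrix.

(** * Connection forms, curvature and reductions *)

Lemma dformZc (R : realType) n (c : R) (b : 'rV[R]_n -> 'rV[R]_n) x :
  differentiable b x -> dform (fun y => c *: b y) x = c *: dform b x.
Proof.
move=> db; apply: etrans (dformZ (differentiable_cst c x) db) _.
by rewrite dfun_cst wedge0l add0r.
Qed.

Section Connection.
Variables (R : realType) (M : charted R 8) (om : 'I_8 -> form1 M) (u : M -> R).
Variable D : derived R M.
Hypothesis H : monge_I1_I2 om u D.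

Let mU : monge_U om u. Proof. by case: H. Qed.
Let mM : is_manifold M. Proof. by case: mU. Qed.
Let okM := manifold_chart_ok mM.
Let oH := @open_H0_dom R.
Let okQ : chart_ok (Q10 M) := prod_chart_ok okM oH.
Let idQ : chart_smooth (@idfun (Q10 M)) := chart_smooth_idQ mU.
Let sb := smooth_fb mU.
Local Notation a := (aQ u D).
Let sa : smooth_fun a := (ode_aQ H).1.
Local Notation Om := (conn_Om om u D).
Local Notation Th := (conn_Th om u D).
Local Notation th := (theta om u D a).

Let b2 (q : Q10 M) : carrier q -> 2 * fb q != 0.
Proof. by move=> /fb_neq0 b0; rewrite mulf_neq0 ?pnatr_eq0. Qed.

Let s2b : smooth_fun (fun q : Q10 M => 2 * fb q).
Proof. exact: (smooth_funM okQ (@smooth_fun_cst _ _ _ 2) sb). Qed.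

Let s2bV : smooth_fun (fun q : Q10 M => (2 * fb q)^-1).
Proof. exact: (smooth_funV okQ b2 s2b). Qed.

Lemma smooth_Om : smooth_form Om.
Proof.
apply: (smooth_formD okQ); last exact: (smooth_liftQ H (dform_Om0 H).1).
exact: (smooth_formM okQ s2bV (smooth_form_dF okQ idQ sb)).
Qed.

Lemma smooth_Th : smooth_form Th.
Proof.
apply: (smooth_formD okQ); last exact: (smooth_liftQ H (dform_Th0 H).1).
exact: (smooth_form_dF okQ idQ (smooth_fm H)).
Qed.

(** db / 2b is closed, and so is a function of t times dt. *)
Lemma dform_Om (i : ix (Q10 M)) y : img i y -> dform (Om i) y = 0.
Proof.
move=> yi; rewrite /conn_Om dformD; last first.
- exact: (smooth_form_diff (smooth_liftQ H (dform_Om0 H).1) yi).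
- exact: (smooth_form_diff (smooth_formM okQ s2bV (smooth_form_dF okQ idQ sb)) yi).
rewrite (dform_lift okM oH (dform_Om0 H).1 yi) (dform_Om0 H).2; last first.
  by move/img_prod: yi => [].
rewrite mulmx0 mul0mx addr0 dformZ; last first.
- exact: (smooth_form_diff (smooth_form_dF okQ idQ sb) yi).
- exact: (smooth_fun_diff s2bV yi).
rewrite (dform_dF okQ sb yi) scaler0 addr0.
rewrite dfunV; last exact: (smooth_fun_diff s2b yi).
  rewrite dfunM; last exact: (smooth_fun_diff sb yi).
    by rewrite dfun_cst scaler0 addr0 !wedgeZl -/(dF _ _ _) wedgexx !scaler0.
  exact: differentiable_cst.
exact: b2 (carrier_psi okQ yi).
Qed.

(** H_0 fixes t^5 + t^7 and adds a multiple of it to t^4 + t^6. *)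
Lemma curvQ_H0 n b c (t : 'I_8 -> 'rV[R]_n) : curvQ (H0_act b c t) = curvQ t.
Proof.
rewrite /curvQ /nr /H0_act !inordK//= /nr /=.
generalize (t (inord 3)) (t (inord 4)) (t (inord 5)) (t (inord 6)) => t4 t5 t6 t7.
mx_entries; ring.
Qed.

(** The curvature takes its values in the line of h_0 spanned by h0_mx 0 1. *)
Lemma curvature_tableE n s (t : 'I_8 -> 'rV[R]_n) k l :
  curvature_table s t k l = - h0_mx 0 1 k l *: (s *: curvQ t).
Proof.
rewrite /curvature_table -/(curvQ t); move: (curvQ t) => K; rewrite mxE /table8.
case: k => -[|[|[|[|[|[|[|[|//]]]]]]]] hk;
  case: l => -[|[|[|[|[|[|[|[|//]]]]]]]] hl /=;
  apply/matrixP => p q; rewrite !(mx_addE, mx_oppE, mx_scaleE, mx_0E); ring.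
Qed.

Lemma curvQ_mulmx n p (t : 'I_8 -> 'rV[R]_n) (P : 'M[R]_(n, p)) :
  curvQ (fun l => t l *m P) = congr_mx P (curvQ t).
Proof. by rewrite /curvQ /nr !(congr_mx_wedge, congr_mxD, congr_mxN). Qed.

Lemma dform_Th (i : ix (Q10 M)) y : img i y ->
  dform (Th i) y = S5 u D (psi i y).1 *: curvQ (fun l => th l i y).
Proof.
move=> yi; have [yi' _] := (img_prod i y).1 yi.
rewrite /conn_Th dformD; last first.
- exact: (smooth_form_diff (smooth_liftQ H (dform_Th0 H).1) yi).
- exact: (smooth_form_diff (smooth_form_dF okQ idQ (smooth_fm H)) yi).
rewrite (dform_dF okQ (smooth_fm H) yi) add0r.
rewrite (dform_lift okM oH (dform_Th0 H).1 yi) (dform_Th0 H).2//.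
rewrite -[X in X *m _ *m _]trmxK -/(congr_mx _ _) congr_mxZ; congr (_ *: _).
rewrite -curvQ_mulmx.
have -> : (fun l => th l i y) = H0_act (fb (psi i y)) (fm u D (psi i y))
    (fun l => liftQ (tau om u D a l) i y).
  by apply/funext => l; rewrite (theta_H0 H).
rewrite curvQ_H0; congr curvQ; apply/funext => l.
by rewrite /liftQ liftE.
Qed.

Local Notation G := (Gamma Om Th).

Lemma GammaE k l (i : ix (Q10 M)) y : G k l i y = conn_mx (Om i y) (Th i y) k l.
Proof. by []. Qed.

Lemma smooth_Gamma k l : smooth_form (G k l).
Proof.
have s1 c := smooth_formM okQ (@smooth_fun_cst _ _ (Q10 M) c) smooth_Om.
have s2 c := smooth_formM okQ (@smooth_fun_cst _ _ (Q10 M) c) smooth_Th.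
apply: (smooth_form_eq okQ) (smooth_formD okQ (s1 (h0_mx 1 0 k l * -2)) (s2 (- h0_mx 0 1 k l))).
by move=> i y yi; rewrite GammaE conn_mxE scalerA scalerN scaleNr.
Qed.

Lemma has_torsion_theta :
  has_torsion th G (fun q => eps u D q.1) (fun q => S4 u D q.1).
Proof.
move=> i y yi k; rewrite /torsion.
have [_ ->//] := dform_theta H k; rewrite /Q_torsion.
have -> : \sum_l G k l i y ∧ th l i y = conn_act (Om i y) (Th i y) (fun l => th l i y) k.
  by rewrite -conn_actE.
by rewrite subrK.
Qed.

Lemma dform_Gamma k l (i : ix (Q10 M)) y : img i y ->
  dform (G k l i) y = - h0_mx 0 1 k l *: dform (Th i) y.
Proof.
move=> yi; pose c := h0_mx 1 0 k l * -2 : R; pose d := - h0_mx 0 1 k l : R.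
have E : {near y, G k l i =1 (fun z => c *: Om i z + d *: Th i z)}.
  apply: filterE => z; rewrite GammaE conn_mxE /c /d scalerA scalerN scaleNr//.
have dO := smooth_form_diff smooth_Om yi; have dT := smooth_form_diff smooth_Th yi.
have s1 r := smooth_formM okQ (@smooth_fun_cst _ _ (Q10 M) r) smooth_Om.
have s2 r := smooth_formM okQ (@smooth_fun_cst _ _ (Q10 M) r) smooth_Th.
rewrite (near_dform E) dformD; last first.
- exact: (smooth_form_diff (s2 d) yi).
- exact: (smooth_form_diff (s1 c) yi).
rewrite (dformZc c dO) (dformZc d dT).
by rewrite (dform_Om yi) scaler0 add0r.
Qed.

Lemma has_curvature_theta : has_curvature th G (fun q => S5 u D q.1).
Proof.
move=> i y yi k l; rewrite /curvature (dform_Gamma k l yi).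
have -> : \sum_r G k r i y ∧ G r l i y = 0 := conn_mx_flat (Om i y) (Th i y) k l.
by rewrite addr0 (dform_Th yi) curvature_tableE.
Qed.

Lemma ract_carrier (f : M -> R) (h : 'rV[R]_2) (q : Q10 M) :
  H0_dom h -> carrier q -> carrier (ract f h q).
Proof.
move=> h0 /carrier_prod[cq q0]; apply/carrier_prod; split=> //.
by rewrite /ract /H0_dom /= mxE eqxx mulf_neq0 ?invr_eq0.
Qed.

Lemma pair_rvK (h : 'rV[R]_2) : pair_rv (h 0 0) (h 0 1) = h.
Proof.
apply/rowP => k; rewrite mxE; case: k => -[|[|//]] k2; rewrite -val_eqE /=;
  by congr (h _ _); apply/val_inj.
Qed.

Lemma pair_rvE (b c : R) : (pair_rv b c 0 0 = b) * (pair_rv b c 0 1 = c).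
Proof. by rewrite !mxE. Qed.

Lemma reductionP (f : M -> R) : smooth_fun f -> (forall p, carrier p -> f p != 0) ->
  is_H0_reduction f.
Proof.
move=> sf f0; split=> //.
- move=> h q h0 cq; split; first exact: ract_carrier.
  have [cp q0] := (carrier_prod q).1 cq.
  rewrite /Defs.incl /= !H_coord_row !pair_rvE /H0_coord.
  rewrite invmx_H_mx ?oner_neq0// H_mx_mul ?f0// invr1 mul1r mulr1.
  by congr (H_mx _ _ _); rewrite ?mulNr 1?mulrC.
- move=> q r cq cr qr; have [cp q0] := (carrier_prod q).1 cq.
  have [_ r0] := (carrier_prod r).1 cr.
  exists (pair_rv (q.2 0 0 / r.2 0 0) (f q.1 * (q.2 0 1 - r.2 0 1))); split.
    split; first by rewrite /H0_dom /= pair_rvE mulf_neq0 ?invr_eq0.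
    rewrite /ract !pair_rvE.
    have -> : q.2 0 0 / (q.2 0 0 / r.2 0 0) = r.2 0 0.
      by rewrite invf_div mulrCA mulfV ?mulr1.
    have -> : q.2 0 1 - f q.1 * (q.2 0 1 - r.2 0 1) / f q.1 = r.2 0 1.
      by rewrite mulrAC mulfV ?f0// mul1r opprB addrC subrK.
    by rewrite pair_rvK qr; case: (r).
  move=> h [h0 E]; rewrite -E /ract /= !pair_rvE -[RHS]pair_rvK; congr pair_rv.
    by rewrite invf_div mulrCA mulfV ?mulr1.
  by rewrite opprB addrC subrK mulrC divfK ?f0.
Qed.

Lemma aQ_reduction : is_H0_reduction a.
Proof. exact: reductionP sa (fun p => aQ_neq0 H (p := p)). Qed.

End Connection.

(** * The connection is principal *)

Lemma is_derive_affine (R : realType) (x c C : R) : is_derive x (1 : R) (fun t => c - t * C) (- C).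
Proof.
have h := is_deriveB (is_derive_cst c x 1) (is_deriveZ C (is_derive_id x (1 : R))).
rewrite [C *: 1]mulr1 sub0r in h.
suff -> : (fun t => c - t * C) = cst c - C \*: id by [].
by apply/funext => t; rewrite !fctE mulrC.
Qed.

Lemma is_derive_exp_line (R : realType) (b B : R) :
  is_derive 0 (1 : R) (fun t => b * expR (- (t * B))) (- (b * B)).
Proof.
pose g (t : R) := 0 - t * B.
have h0 := @is_derive1_comp R expR g 0 _ _ (is_derive_expR (g 0)) (is_derive_affine 0 0 B).
have h := is_deriveZ b h0.
rewrite /g mul0r subr0 expR0 mul1r [b *: _]mulrN in h.
suff -> : (fun t => b * expR (- (t * B))) = b \*: (expR \o (fun t => 0 - t * B)) by [].
by apply/funext => t; rewrite !fctE /= sub0r.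
Qed.

Section Principal.
Variables (R : realType) (M : charted R 8) (om : 'I_8 -> form1 M) (u : M -> R).
Variable D : derived R M.
Hypothesis H : monge_I1_I2 om u D.

Let mU : monge_U om u. Proof. by case: H. Qed.
Let mM : is_manifold M. Proof. by case: mU. Qed.
Let okM := manifold_chart_ok mM.
Let co : coframe om. Proof. by case: mU => _ []. Qed.
Let u0 p : carrier p -> u p != 0. Proof. by case: mU => _ _ _ + _; apply. Qed.
Let idM := chart_smooth_id mM.
Let oH := @open_H0_dom R.
Let okQ : chart_ok (Q10 M) := prod_chart_ok okM oH.
Let sb := smooth_fb mU.
Local Notation a := (aQ u D).
Let sa : smooth_fun a := (ode_aQ H).1.
Local Notation Om := (conn_Om om u D).
Local Notation Th := (conn_Th om u D).
Local Notation th := (theta om u D a).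
Local Notation G := (Gamma Om Th).
Local Notation eta := (coframe_Q th Om Th).

Lemma eta_l k : eta (lshift 2 k) = th k.
Proof. by rewrite /coframe_Q -[lshift 2 k]/(unsplit (inl k)) unsplitK. Qed.

Lemma eta_r k : eta (rshift 8 k) = if k == 0 then Om else Th.
Proof. by rewrite /coframe_Q -[rshift 8 k]/(unsplit (inr k)) unsplitK. Qed.

Lemma smooth_eta k : smooth_form (eta k).
Proof.
case: (split_ordP k) => j ->; first by rewrite eta_l; exact: (dform_theta H j).1.
by rewrite eta_r; case: (j == 0); [exact: smooth_Om|exact: smooth_Th].
Qed.

Lemma bar_mxE k (i : ix M) x : bar om u D k i x =
  \sum_l bar_mx (u (psi i x)) (v2 D (psi i x)) k l *: om l i x.
Proof.
rewrite !big_ord_recl big_ord0 (@nrE _ _ (fun l => om l i x) 0)//.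
rewrite (@nrE _ _ (fun l => om l i x) 1)// (@nrE _ _ (fun l => om l i x) 2)//
 (@nrE _ _ (fun l => om l i x) 3)// (@nrE _ _ (fun l => om l i x) 4)//
 (@nrE _ _ (fun l => om l i x) 5)// (@nrE _ _ (fun l => om l i x) 6)//
 (@nrE _ _ (fun l => om l i x) 7)//.
rewrite !mxE /table8 /bar.
case: k => -[|[|[|[|[|[|[|[|//]]]]]]]] hk /=; apply/rowP => j;
  rewrite !(mx_addE, mx_oppE, mx_scaleE, mx_0E); ring.
Qed.

Lemma dF_snd l i y : dF (fun q : Q10 M => q.2 0 l) i y = row_mx 0 (delta_mx 0 l).
Proof.
rewrite /dF (@near_dfun _ _ _ (fun z : 'rV[R]_(8 + 2) => z 0 (rshift 8 l))); last first.
  by apply: filterE => z; rewrite /= mxE.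
rewrite dfun_coord; apply/rowP => k; case: (split_ordP k) => j ->.
  by rewrite row_mxEl !mxE eq_sym eq_rlshift andbF.
by rewrite row_mxEr !mxE (inj_eq (@rshift_inj _ _)).
Qed.

Lemma rsub_Om (i : ix (Q10 M)) y : rsubmx (Om i y) = (2 * fb (psi i y))^-1 *: delta_mx 0 0.
Proof.
rewrite /conn_Om /fb dF_snd /liftQ /lift_form scale_row_mx add_row_mx row_mxKr addr0.
by [].
Qed.

Lemma rsub_Th (i : ix (Q10 M)) y : img i y ->
  rsubmx (Th i y) = a (psi i y).1 *: delta_mx 0 1.
Proof.
move=> yi; rewrite /conn_Th /dF.
rewrite dfunM; last first.
- exact: (smooth_fun_diff (smooth_fun_fst okM oH sa) yi).
- exact: (smooth_fun_diff (smooth_fc mU) yi).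
rewrite -/(dF (@fc R M) i y) /fc dF_snd -/(dF (fun q : Q10 M => a q.1) i y) (dF_fst sa yi).
rewrite /liftQ /lift_form !scale_row_mx !add_row_mx row_mxKr.
by rewrite !scaler0 !addr0 add0r.
Qed.

(** The matrix of eta is block triangular: theta is horizontal, and the vertical
    parts of Omega_1 and Theta are multiples of db and dc. *)
Lemma coframe_eta : coframe eta.
Proof.
move=> i y yi; have [yi' _] := (img_prod i y).1 yi.
have cq := carrier_psi okQ yi; have [cp _] := (carrier_prod _).1 cq.
have b0 := fb_neq0 cq; have a0 := aQ_neq0 H cp.
pose A := H_mx (a (psi i y).1) (fb (psi i y)) (fc (psi i y))
  *m bar_mx (u (psi i y).1) (v2 D (psi i y).1) *m coframe_mx om i (lsubmx y).
have uA : A \in unitmx.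
  by rewrite !unitmx_mul H_mx_unit// bar_mx_unit ?u0//= co.
pose E := coframe_mx eta i y.
have Eul : ulsubmx E = A.
  apply/matrixP => k l; rewrite mxE mxE [LHS]mxE eta_l (theta_lift D mU k sa yi).
  rewrite /A -mulmxA mxE summxE; apply: eq_bigr => j _.
  rewrite mx_scaleE /liftQ /lift_form row_mxEl; congr (_ * _).
  rewrite bar_mxE summxE mxE; apply: eq_bigr => j' _.
  by rewrite mx_scaleE [coframe_mx _ _ _ _ _]mxE.
have Eur : ursubmx E = 0.
  apply/matrixP => k l; rewrite mxE mxE [LHS]mxE eta_l (theta_lift D mU k sa yi).
  rewrite summxE mx_0E big1 // => j _.
  by rewrite mx_scaleE /liftQ /lift_form row_mxEr mx_0E mulr0.
have Edr k : row k (drsubmx E) = rsubmx ((if k == 0 then Om else Th) i y).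
  apply/rowP => l; rewrite mxE; transitivity (E (rshift 8 k) (rshift 8 l)).
    by rewrite -[E in RHS]submxK block_mxEdr.
  by rewrite mxE eta_r [RHS]mxE.
rewrite -/E unitmxE -(submxK E) Eur det_lblock unitrM -!unitmxE Eul uA /=.
pose d : 'rV[R]_2 := \row_k (if k == 0 then (2 * fb (psi i y))^-1 else a (psi i y).1).
have -> : drsubmx E = diag_mx d.
  apply/row_matrixP => k; rewrite Edr; apply/rowP => l; rewrite [RHS]mxE [RHS]mxE [X in _ = X *+ _]mxE.
  case: k => -[|[|//]] k2; rewrite -(inj_eq val_inj)/=.
    by rewrite rsub_Om mx_scaleE mxE eqxx -(inj_eq val_inj) [in RHS]eq_sym mulr_natr.
  rewrite (rsub_Th yi) mx_scaleE mxE eqxx -(inj_eq val_inj) [in RHS]eq_sym.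
  by rewrite -[in RHS](inj_eq val_inj) mulr_natr.
rewrite unitmxE det_diag unitfE; apply/prodf_neq0 => k _; rewrite mxE.
by case: ifP => _ //; rewrite invr_eq0 mulf_neq0// pnatr_eq0.
Qed.

Lemma fundamentalE (B C : R) (i : ix (Q10 M)) y : img i y ->
  fundamental a B C i y =
  row_mx 0 (pair_rv (- (fb (psi i y) * B)) (- (C / a (psi i y).1))).
Proof.
move=> yi; have [yi' _] := (img_prod i y).1 yi.
set b := fb (psi i y); set c := fc (psi i y); set a0 := a (psi i y).1.
pose P (t : R) : 'rV[R]_(8 + 2) :=
  row_mx (lsubmx y) (pair_rv (b * expR (- (t * B))) (c - t * (C / a0))).
have E : (fun t : R => @phi R _ (Q10 M) i (ract a (exp_h0 B C t) (@psi R _ (Q10 M) i y))) = P.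
  apply/funext => t; rewrite /P /= /ract /exp_h0 /= phiK//; congr (row_mx _ _).
  by rewrite !pair_rvE expRN mulrA.
rewrite /fundamental E derive1E.
have D0 j : is_derive (0 : R) (1 : R) (fun t => P t 0 j)
    (row_mx (0 : 'rV[R]_8) (pair_rv (- (b * B)) (- (C / a0))) 0 j).
  case: (split_ordP j) => l ->.
    rewrite row_mxEl mxE (_ : (fun t => _) = cst (lsubmx y 0 l)); first exact: is_derive_cst.
    by apply/funext => t; rewrite /P row_mxEl.
  rewrite row_mxEr mxE.
  have -> : (fun t => P t 0 (rshift 8 l)) = fun t =>
      if l == 0 then b * expR (- (t * B)) else c - t * (C / a0).
    by apply/funext => t; rewrite /P row_mxEr mxE.
  by case: ifP => _; [exact: is_derive_exp_line|exact: is_derive_affine].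
have dP : derivable P 0 1.
  by apply/derivable_mxP => k j; rewrite (ord1 k); case: (D0 j).
rewrite (derive_mx dP); apply/rowP => j; rewrite mxE.
by case: (D0 j).
Qed.

Lemma mul_row0_tr n m (v : 'rV[R]_(n + m)) (w : 'rV[R]_m) :
  v *m (row_mx 0 w)^T = rsubmx v *m w^T.
Proof.
by rewrite -{1}(hsubmxK v) tr_row_mx mul_row_col trmx0 mulmx0 add0r.
Qed.

Lemma ev_Gamma (i : ix (Q10 M)) y (X : 'rV[R]_(8 + 2)) :
  \matrix_(k, l) (G k l i y *m X^T) 0 0 =
  h0_mx (- 2 * (Om i y *m X^T) 0 0) (- (Th i y *m X^T) 0 0).
Proof.
rewrite h0_mxE; apply/matrixP => k l; rewrite mxE GammaE conn_mxE.
rewrite mulmxDl -!scalemxAl mulNmx !(mx_addE, mx_scaleE, mx_oppE).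
by congr (_ + _); rewrite mulrC.
Qed.

Section RightAction.
Variable h : 'rV[R]_2.
Hypothesis h0 : H0_dom h.
Let L : Q10 M -> Q10 M := ract a h.

Let cL q : carrier q -> carrier (L q). Proof. exact: ract_carrier. Qed.

Let cstQ c : smooth_fun (fun _ : Q10 M => c : R).
Proof. exact: smooth_fun_cst. Qed.

Let saV : smooth_fun (fun q : Q10 M => (a q.1)^-1).
Proof.
apply: (smooth_funV okQ); last exact: (smooth_fun_fst okM oH sa).
by move=> q /carrier_prod[cq _]; exact: (aQ_neq0 H cq).
Qed.

Let sbL : smooth_fun (fun q => fb (L q)).
Proof.
apply: (smooth_fun_ext okQ) (smooth_funM okQ sb (cstQ (h 0 0)^-1)) => q cq.
by rewrite /fb /L /ract /= !pair_rvE.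
Qed.

Let scL : smooth_fun (fun q => fc (L q)).
Proof.
apply: (smooth_fun_ext okQ)
  (smooth_funD okQ (smooth_fc mU) (smooth_funN okQ (smooth_funM okQ (cstQ (h 0 1)) saV))) => q cq.
by rewrite /fc /L /ract /= !pair_rvE.
Qed.

Lemma chart_smooth_ract : chart_smooth L.
Proof.
apply: (prod_chart_smooth okM oH idM cL) => // l.
have [->|->] : l = 0 \/ l = 1.
  by case: l => -[|[|//]] hl; [left|right]; apply/val_inj.
- exact: sbL.
- exact: scL.
Qed.

Lemma is_pullback_ract_lift (b : form1 M) : smooth_form b ->
  is_pullback L (liftQ b) (liftQ b).
Proof.
move=> [_ cb].
exact: (is_pullback_lift okM oH idM cL (fun _ _ => erefl) chart_smooth_ract cb).
Qed.

(** The action multiplies b by a constant, which does not change db / b. *)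
Lemma is_pullback_ract_Om : is_pullback L Om Om.
Proof.
have s2bV : smooth_fun (fun q : Q10 M => (2 * fb q)^-1).
  apply: (smooth_funV okQ); last exact: (smooth_funM okQ (cstQ 2) sb).
  by move=> q /fb_neq0 b0; rewrite mulf_neq0 ?pnatr_eq0.
have p1 := is_pullbackM okQ (fun q : Q10 M => (2 * fb q)^-1)
   (is_pullback_dF okQ chart_smooth_ract sb).
have p := is_pullbackD p1 (is_pullback_ract_lift (dform_Om0 H).1).
apply: is_pullback_eq p => // i y yi; rewrite /conn_Om; congr (_ + _).
have -> : dF (fun q => fb (L q)) i y = (h 0 0)^-1 *: dF (@fb R M) i y.
  rewrite /dF -[RHS]addr0 -(scaler0 _ (fb (psi i y))) -(dfun_cst (h 0 0)^-1 y) addrC.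
  rewrite -dfunM; last exact: differentiable_cst.
    apply: near_dfun; apply: filterE => z.
    by rewrite /fb /L /ract /= !pair_rvE.
  exact: (smooth_fun_diff sb yi).
rewrite scalerA; congr (_ *: _).
have b0 := fb_neq0 (carrier_psi okQ yi); have hh : h 0 0 != 0 := h0.
rewrite {1}/fb /L /ract /= !pair_rvE -/(fb (psi i y)).
by field; rewrite hh b0.
Qed.

(** The action translates m = c a by a constant. *)
Lemma is_pullback_ract_Th : is_pullback L Th Th.
Proof.
have p := is_pullbackD (is_pullback_dF okQ chart_smooth_ract (smooth_fm H))
  (is_pullback_ract_lift (dform_Th0 H).1).
apply: is_pullback_eq p => // i y yi; rewrite /conn_Th; congr (_ + _).
rewrite /dF -[RHS]addr0 -(dfun_cst (- h 0 1) y) -dfunD.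
- apply: near_dfun; apply: (near_open (img_open okQ i) yi) => z zi.
  have [cp _] := (carrier_prod _).1 (carrier_psi okQ zi).
  rewrite /fm /fc /L /ract /= !pair_rvE mulrBl divfK//.
  exact: (aQ_neq0 H cp).
- exact: (smooth_fun_diff (smooth_fm H) yi).
- exact: differentiable_cst.
Qed.

Lemma is_pullback_ract_Gamma k l : is_pullback L (G k l) (G k l).
Proof.
have p1 := is_pullbackM okQ (fun=> h0_mx 1 0 k l * -2) is_pullback_ract_Om.
have p2 := is_pullbackM okQ (fun=> - h0_mx 0 1 k l) is_pullback_ract_Th.
apply: is_pullback_eq (is_pullbackD p1 p2) => i y yi;
  by rewrite GammaE conn_mxE scalerA scalerN scaleNr.
Qed.

End RightAction.

Lemma principal_Gamma : principal_connection a G.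
Proof.
split.
- exact: smooth_Gamma.
- by move=> i y yi X; rewrite ev_Gamma; do 2!eexists.
- move=> i y yi B C; rewrite ev_Gamma (fundamentalE B C yi) !mul_row0_tr.
  have cq := carrier_psi okQ yi; have [cp _] := (carrier_prod _).1 cq.
  have b0 := fb_neq0 cq; have a0 := aQ_neq0 H cp.
  rewrite rsub_Om (rsub_Th yi) -!scalemxAl -!rowE !mx_scaleE.
  rewrite ![row _ _ _ _]mxE ![_^T _ _]mxE !pair_rvE.
  by congr h0_mx; field; rewrite ?b0 ?a0.
(* G is invariant, and Ad(h^-1) is the identity on h_0 *)
- move=> h h0 k l; apply: is_pullback_eq (is_pullback_ract_Gamma h0 k l) => // i y yi.
  have hu : H0_coord h \in unitmx by rewrite H_mx_unit ?oner_neq0.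
  apply/rowP => j; rewrite summxE.
  have E r s : G r s i y 0 j = h0_mx (- 2 * Om i y 0 j) (- Th i y 0 j) r s.
    rewrite h0_mxE GammaE conn_mxE !(mx_addE, mx_scaleE, mx_oppE).
    by congr (_ + _); rewrite mulrC.
  set B := - 2 * Om i y 0 j in E; set C := - Th i y 0 j in E.
  have := congr1 (fun A : 'M[R]_8 => A k l) (mulKmx hu (h0_mx B C)).
  rewrite -h0_H0C E => <-; rewrite mxE; apply: eq_bigr => r _.
  rewrite summxE mxE mulr_sumr; apply: eq_bigr => s _.
  by rewrite mx_scaleE E mulrA mulrAC.
Qed.

End Principal.

(** * What the torsion determines *)

(** N is the matrix of a coframe that contains the eight forms t^k, at the places
    given by idx. *)
Section TorsionAlgebra.
Variables (R : realType) (n : nat) (N : 'M[R]_n) (idx : 'I_8 -> 'I_n).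
Hypotheses (uN : N \in unitmx) (idx_inj : injective idx).
Let t (k : 'I_8) : 'rV[R]_n := row (idx k) N.
Implicit Types (O T : 'rV[R]_n) (X : 'I_8 -> 'M[R]_n).

Let cf O j := coefs1 N O 0 j.

Let d0E (k j : 'I_n) : (delta_mx 0 k : 'rV[R]_n) 0 j = (j == k)%:R.
Proof. by rewrite mxE eqxx. Qed.

Lemma coefs2_row O k i j : coefs2 N (O ∧ row k N) i j =
  cf O i * (j == k)%:R - cf O j * (i == k)%:R.
Proof.
rewrite coefs2_wedge_coefs// wedgeE coefs1_row// !d0E.
by rewrite [X in _ - X]mulrC.
Qed.

Lemma wedge_row_eq0 O k : O ∧ row k N = 0 -> forall j, j != k -> cf O j = 0.
Proof.
move=> E j /negbTE jk; have := coefs2_row O k j k.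
by rewrite E coefs20 mx_0E eqxx jk mulr0 subr0 mulr1.
Qed.

Lemma coefs2_nr_row p q i j : coefs2 N (t^[p] ∧ t^[q]) i j =
  (i == idx (o8 p))%:R * (j == idx (o8 q))%:R - (j == idx (o8 p))%:R * (i == idx (o8 q))%:R.
Proof. by rewrite coefs2_row /cf coefs1_row// !d0E. Qed.

Lemma idx_eq (j k : nat) : (0 < j <= 8)%N -> (0 < k <= 8)%N ->
  (idx (o8 j) == idx (o8 k)) = (j == k).
Proof.
move=> j8 k8; rewrite (inj_eq idx_inj) /o8 -(inj_eq val_inj)/= !inordK; last 2 first.
- by case: k k8.
- by case: j j8.
by case: j j8 => // j _; case: k k8.
Qed.

Let T8 (e s r : R) : 'M[R]_n :=
  (4 * s * r ^+ 2) *: (t^[5] ∧ t^[8] + t^[7] ∧ t^[8]) + (2 * e * r ^+ 4) *: (t^[5] ∧ t^[7]).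

Lemma torsion_table8 e s r :
  torsion_table e s (fun k => weight r k *: t k) (inord 7) = T8 e s r.
Proof.
rewrite /torsion_table inordK//= /T8 /nr /= /weight !inordK//= scale1r.
generalize (t (inord 4)) (t (inord 6)) (t (inord 7)) => t5 t7 t8.
mx_entries; ring.
Qed.

Let coefs2_O8 O p q : coefs2 N (O ∧ t^[8]) (idx (o8 p)) (idx (o8 q)) =
  cf O (idx (o8 p)) * (idx (o8 q) == idx (o8 8))%:R
  - cf O (idx (o8 q)) * (idx (o8 p) == idx (o8 8))%:R.
Proof. exact: coefs2_row. Qed.

(** Compare the coefficients of t^5 ∧ t^7: the connection enters only through multiples
    of t^8. *)
Lemma torsion8_eps (D8 : 'M[R]_n) O O' (e s e' s' r : R) :
  D8 - 2 *: (O ∧ t^[8]) = T8 e s 1 -> D8 - 2 *: (O' ∧ t^[8]) = T8 e' s' r ->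
  e = e' * r ^+ 4.
Proof.
move=> E E'; have {E E'} : 2 *: (O' ∧ t^[8]) + T8 e' s' r = 2 *: (O ∧ t^[8]) + T8 e s 1.
  by rewrite -E -E' addrCA subrr addr0 addrCA subrr addr0.
move=> /(congr1 (fun A : 'M[R]_n => coefs2 N A (idx (o8 5)) (idx (o8 7)))).
move: (coefs2_O8 O 5 7) (coefs2_O8 O' 5 7) (coefs2_nr_row 5 7) (coefs2_nr_row 5 8) (coefs2_nr_row 7 8).
move=> h1 h2 /(_ (idx (o8 5)) (idx (o8 7))) h3 /(_ (idx (o8 5)) (idx (o8 7))) h4 /(_ (idx (o8 5)) (idx (o8 7))) h5.
rewrite /T8.
move: h1 h2 h3 h4 h5.
move: (O ∧ _) (O' ∧ _) (t^[5] ∧ t^[7]) (t^[5] ∧ t^[8]) (t^[7] ∧ t^[8]) => A1 A2 A3 A4 A5.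
rewrite !idx_eq// => h1 h2 h3 h4 h5.
rewrite !(coefs2D, coefs2Z) !(mx_addE, mx_scaleE) h1 h2 h3 h4 h5 /=.
move=> h; have : 2 * e' * r ^+ 4 = 2 * e by move: h; rewrite !expr1n; lra.
by rewrite -mulrA => /(mulfI (lt0r_neq0 (ltr0n R 2)))/esym.
Qed.

(** The coframes t and [weight r] t share their eighth form, hence its differential. *)
Lemma torsion_ratio (D8 : 'M[R]_n) O T O' T' (e s e' s' r : R) :
  D8 + conn_act O T t (inord 7) = torsion_table e s t (inord 7) ->
  D8 + conn_act O' T' (fun k => weight r k *: t k) (inord 7) =
    torsion_table e' s' (fun k => weight r k *: t k) (inord 7) ->
  e = e' * r ^+ 4.
Proof.
have c O1 T1 r1 : conn_act O1 T1 (fun k => weight r1 k *: t k) (inord 7) = - 2 *: (O1 ∧ t^[8]).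
  by rewrite /conn_act inordK//= /nr /= /weight inordK//= scale1r.
have w1 : (fun k => weight 1 k *: t k) = t.
  apply/funext => k; rewrite (_ : weight 1 k = 1) ?scale1r// /weight.
  by case: k => -[|[|[|[|[|[|[|[|//]]]]]]]] ? /=; rewrite ?expr1n.
have c1 := c O T 1; have t1 := torsion_table8 e s 1; rewrite w1 in c1 t1.
rewrite c1 t1 c torsion_table8 !scaleNr; exact: torsion8_eps.
Qed.

(** The differences o, w of the connection forms satisfy o ∧ t^2 = 0 and
    o ∧ t^8 = - 2 (s' - s) (t^5 + t^7) ∧ t^8; comparing coefficients yields s' = s and
    o = 0.  Then w ∧ t^1 = w ∧ t^2 = 0, which leaves w = 0. *)
Lemma torsion_unique X O T O' T' (e s s' : R) :
  (forall k, X k + conn_act O T t k = torsion_table e s t k) ->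
  (forall k, X k + conn_act O' T' t k = torsion_table e s' t k) ->
  [/\ O = O', T = T' & s = s'].
Proof.
move=> E E'; pose o := O' - O; pose w := T' - T.
have dE k : conn_act O' T' t k - conn_act O T t k = torsion_table e s' t k - torsion_table e s t k.
  by rewrite -E -E' opprD addrACA subrr add0r.
have e2 : o ∧ t^[2] = 0.
  have := dE (inord 1); rewrite /conn_act /torsion_table !inordK//= subrr.
  rewrite -scalerBr => /eqP; rewrite scaler_eq0 oppr_eq0 pnatr_eq0/= => /eqP.
  by rewrite /o wedgeDl wedgeNl.
have e8 : o ∧ t^[8] = (- 2 * (s' - s)) *: (t^[5] ∧ t^[8] + t^[7] ∧ t^[8]).
  have := dE (inord 7); rewrite /conn_act /torsion_table !inordK//=.
  have -> : o ∧ t^[8] = O' ∧ t^[8] - O ∧ t^[8] by rewrite /o wedgeDl wedgeNl.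
  move: (O ∧ t^[8]) (O' ∧ t^[8]) (t^[5] ∧ t^[8] + t^[7] ∧ t^[8]) (t^[5] ∧ t^[7]) => A1 A2 A3 A4 h.
  apply/matrixP => i j; have := congr1 (fun A : 'M[R]_n => A i j) h.
  by rewrite !(mx_addE, mx_oppE, mx_scaleE); lra.
have o2 := wedge_row_eq0 e2.
have ss : s = s'.
  have := congr1 (fun A : 'M[R]_n => coefs2 N A (idx (o8 5)) (idx (o8 8))) e8.
  move: (coefs2_O8 o 5 8) (coefs2_nr_row 5 8 (idx (o8 5)) (idx (o8 8))) (coefs2_nr_row 7 8 (idx (o8 5)) (idx (o8 8))).
  move: (o ∧ _) (t^[5] ∧ t^[8]) (t^[7] ∧ t^[8]) => A1 A2 A3.
  rewrite !idx_eq//= (o2 (idx (o8 5))); last by rewrite -/(o8 2) idx_eq.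
  move=> h1 h2 h3; rewrite coefs2Z coefs2D mx_scaleE mx_addE h1 h2 h3.
  by lra.
have o0 : o = 0.
  rewrite ss subrr mulr0 scale0r in e8; have o8' := wedge_row_eq0 e8.
  rewrite -(coefs1E o uN) (_ : coefs1 N o = 0) ?mul0mx//.
  apply/rowP => j; rewrite mx_0E; have [->|j2] := eqVneq j (idx (o8 2)).
    by apply: o8'; rewrite -/(o8 8) idx_eq.
  exact: o2.
have OO : O = O' by apply/esym/eqP; rewrite -subr_eq0; apply/eqP.
have w1 : w ∧ t^[1] = 0.
  have := dE (inord 2); rewrite /conn_act /torsion_table !inordK//= ss OO subrr.
  have -> : w ∧ t^[1] = T' ∧ t^[1] - T ∧ t^[1] by rewrite /w wedgeDl wedgeNl.
  move: (T ∧ t^[1]) (T' ∧ t^[1]) (O' ∧ t^[3]) => A1 A2 A3 h.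
  apply/matrixP => i j; have := congr1 (fun A : 'M[R]_n => A i j) h.
  by rewrite !(mx_addE, mx_oppE, mx_scaleE, mx_0E); lra.
have w2 : w ∧ t^[2] = 0.
  have := dE (inord 0); rewrite /conn_act /torsion_table !inordK//= ss OO subrr.
  have -> : w ∧ t^[2] = T' ∧ t^[2] - T ∧ t^[2] by rewrite /w wedgeDl wedgeNl.
  move: (T ∧ t^[2]) (T' ∧ t^[2]) (O' ∧ t^[1]) => A1 A2 A3 h.
  apply/matrixP => i j; have := congr1 (fun A : 'M[R]_n => A i j) h.
  by rewrite !(mx_addE, mx_oppE, mx_scaleE, mx_0E); lra.
have w0 : w = 0.
  have w1' := wedge_row_eq0 w1; have w2' := wedge_row_eq0 w2.
  rewrite -(coefs1E w uN) (_ : coefs1 N w = 0) ?mul0mx//.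
  apply/rowP => j; rewrite mx_0E; have [->|j2] := eqVneq j (idx (o8 1)).
    by apply: w2'; rewrite -/(o8 2) idx_eq.
  exact: w1'.
by split=> //; apply/esym/eqP; rewrite -subr_eq0; apply/eqP.
Qed.

End TorsionAlgebra.

(** * Uniqueness, and the derivative of S_4 *)

Lemma generated_sub (R : realType) n (X : charted R n) (eta : 'I_n -> form1 X)
    (S S' : (X -> R) -> Prop) : (forall f, S f -> generated eta S' f) ->
  forall f, generated eta S f -> generated eta S' f.
Proof.
move=> SS f; elim=> {f} [f /SS //|r|f g _ hf _ hg|f g _ hf _ hg|k f g _ hf d|f g _ hf fg].
- exact: gen_const.
- exact: gen_add.
- exact: gen_mul.
- exact: gen_deriv hf d.
- exact: gen_ext hf fg.
Qed.

Section Invariants.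
Variables (R : realType) (M : charted R 8) (om : 'I_8 -> form1 M) (u : M -> R).
Variable D : derived R M.
Hypothesis H : monge_I1_I2 om u D.

Let mU : monge_U om u. Proof. by case: H. Qed.
Let mM : is_manifold M. Proof. by case: mU. Qed.
Let okM := manifold_chart_ok mM.
Let oH := @open_H0_dom R.
Let okQ : chart_ok (Q10 M) := prod_chart_ok okM oH.
Local Notation a := (aQ u D).
Let sa : smooth_fun a := (ode_aQ H).1.
Local Notation Om := (conn_Om om u D).
Local Notation Th := (conn_Th om u D).
Local Notation th := (theta om u D a).
Local Notation eta := (coframe_Q th Om Th).
Local Notation e := (fun q : Q10 M => eps u D q.1).
Local Notation s4 := (fun q : Q10 M => S4 u D q.1).
Local Notation s5 := (fun q : Q10 M => S5 u D q.1).
Local Notation N := (coframe_mx eta).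

Lemma torsion_Gamma t Om' Th' k (i : ix (Q10 M)) y :
  torsion t (Gamma Om' Th') k i y =
  dform (t k i) y + conn_act (Om' i y) (Th' i y) (fun l => t l i y) k.
Proof. by rewrite /torsion -conn_actE. Qed.

Lemma th_row (i : ix (Q10 M)) y : (fun l => th l i y) = (fun l => row (lshift 2 l) (N i y)).
Proof. by apply/funext => l; rewrite row_coframe_mx eta_l. Qed.

Lemma connection_unique (Om' Th' : form1 (Q10 M)) (s' : Q10 M -> R) :
  has_torsion th (Gamma Om' Th') e s' -> form_eq Om' Om /\ form_eq Th' Th.
Proof.
move=> h'; have h := has_torsion_theta H.
suff E (i : ix (Q10 M)) y : img i y -> Om' i y = Om i y /\ Th' i y = Th i y.
  by split=> i y yi; have [] := E i y yi.
move=> yi; have uN := coframe_eta H yi.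
have [] := @torsion_unique R _ (N i y) (lshift 2) uN (@lshift_inj 8 2)
  (fun k => dform (th k i) y) (Om i y) (Th i y) (Om' i y) (Th' i y)
  (e (psi i y)) (s4 (psi i y)) (s' (psi i y)); last by [].
  by move=> k; have := h i y yi k; rewrite torsion_Gamma th_row.
by move=> k; have := h' i y yi k; rewrite torsion_Gamma th_row.
Qed.

Lemma theta_weight (f : M -> R) k (i : ix (Q10 M)) y : smooth_fun f -> img i y ->
  theta om u D f k i y = weight (f (psi i y).1 / a (psi i y).1) k *: th k i y.
Proof.
move=> sf yi; have [cp _] := (carrier_prod _).1 (carrier_psi okQ yi).
have a0 := aQ_neq0 H cp.
rewrite (theta_lift D mU k sf yi) -(weight_actE _ (fun l => th l i y)).
under [RHS]eq_bigr do rewrite (theta_lift D mU _ sa yi).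
rewrite mx_act; apply: eq_bigr => l _; congr (_ k l *: _).
by rewrite H_mx_mul// divfK// mul1r mul0r addr0.
Qed.

(** With r = f / a, the ratio of the weights, eps = e' r^4 forces r^2 = 1. *)
Lemma reduction_unique (f : M -> R) : smooth_fun f ->
  (exists (Om Th : form1 (Q10 M)) (e' s' : Q10 M -> R),
     (forall q, carrier q -> e' q = 1 \/ e' q = -1) /\
     has_torsion (theta om u D f) (Gamma Om Th) e' s') ->
  forall p, carrier p -> f p = a p \/ f p = - a p.
Proof.
move=> sf [Om' [Th' [e' [s' [e1 h']]]]] p cp.
pose q : Q10 M := (p, pair_rv 1 0).
have cq : carrier q.
  by apply/carrier_prod; split=> //; rewrite /H0_dom /= pair_rvE oner_neq0.
have [i [y [yi yq]]] := carrierE okQ cq.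
have uN := coframe_eta H yi; have h := has_torsion_theta H.
pose r := f p / a p.
have wE k : theta om u D f k i y = weight r k *: th k i y.
  by rewrite theta_weight// yq.
(* the eighth weight is 1 *)
have E8 : form_eq (theta om u D f (inord 7)) (th (inord 7)).
  by move=> i' y' yi'; rewrite theta_weight// /weight inordK// scale1r.
have h1 := h i y yi (inord 7); have h2 := h' i y yi (inord 7).
rewrite torsion_Gamma th_row in h1.
have wth : (fun l => theta om u D f l i y) =
    (fun l => weight r l *: row (lshift 2 l) (N i y)).
  by apply/funext => l; rewrite wE row_coframe_mx eta_l.
rewrite torsion_Gamma (near_form_eq okQ E8 yi) wth in h2.
have := torsion_ratio uN (@lshift_inj 8 2) h1 h2; rewrite yq => E.
have r2 : r ^+ 2 = 1.
  have [e1'|e1'] := e1 q cq; have [e2|e2] := eps_cases H cp;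
    rewrite e1' /= e2 in E; nra.
have a0 := aQ_neq0 H cp.
move/eqP: r2; rewrite sqrf_eq1 => /orP[] /eqP; rewrite /r => /(canRL (divfK a0)) ->.
  by left; rewrite mul1r.
by right; rewrite mulN1r.
Qed.

(** The form that appears in dS_4 is a multiple of omega^7, of which S_4 is a function. *)
Lemma theta57 (i : ix (Q10 M)) y : img i y ->
  (fun k => th k i y)^[5] + (fun k => th k i y)^[7] =
  (a (psi i y).1 ^+ 2 * u (psi i y).1) *: liftQ (w7 om) i y.
Proof.
move=> yi; rewrite /nr !(theta_H0 H)// /H0_act !inordK//= /nr /= /liftQ /lift_form.
rewrite !scale_row_mx !add_row_mx !scaler0 !addr0; congr row_mx.
rewrite !tauE /tau_expr !inordK//= /w7.
apply/rowP => j; rewrite !(mx_addE, mx_scaleE); ring.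
Qed.

Lemma dS4 (i : ix (Q10 M)) y : img i y ->
  dfun (fun y' => s4 (psi i y')) y =
  (e (psi i y) + 3 * s4 (psi i y) ^+ 2 + s5 (psi i y)) *:
   ((fun k => th k i y)^[5] + (fun k => th k i y)^[7]).
Proof.
move=> yi; have [yi' _] := (img_prod i y).1 yi; have [ss ds] := ode_S4 H.
rewrite theta57//; apply: etrans (dF_fst ss yi) _.
rewrite /lift_form ds// scalerA.
by rewrite /liftQ /lift_form scale_row_mx scaler0.
Qed.

End Invariants.

(** * Fundamental invariants *)

Section ConstantCoefficients.
Variables (R : realType) (n : nat).
Implicit Types (N : 'M[R]_n) (t : 'I_8 -> 'rV[R]_n).

Lemma coefs2_congr N X : N \in unitmx -> coefs2 N (congr_mx N X) = X.
Proof.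
move=> uN; rewrite /coefs2 /congr_mx !mulmxA -trmx_mul mulmxV// trmx1 mul1mx.
by rewrite mulmxK.
Qed.

Lemma torsion_table_affine e s t k : torsion_table e s t k =
  torsion_table 0 0 t k + e *: (torsion_table 1 0 t k - torsion_table 0 0 t k)
  + s *: (torsion_table 0 1 t k - torsion_table 0 0 t k).
Proof.
rewrite /torsion_table /nr.
generalize (t (inord 1.-1)) (t (inord 2.-1)) (t (inord 3.-1)) (t (inord 4.-1))
 (t (inord 5.-1)) (t (inord 6.-1)) (t (inord 7.-1)) (t (inord 8.-1)).
move=> t1 t2 t3 t4 t5 t6 t7 t8.
by case: k => -[|[|[|[|[|[|[|[|//]]]]]]]] ? /=; wedge_entries; ring.
Qed.

End ConstantCoefficients.

Section Generators.
Variables (R : realType) (M : charted R 8) (om : 'I_8 -> form1 M) (u : M -> R).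
Variable D : derived R M.
Hypothesis H : monge_I1_I2 om u D.

Let mU : monge_U om u. Proof. by case: H. Qed.
Let mM : is_manifold M. Proof. by case: mU. Qed.
Let okM := manifold_chart_ok mM.
Let oH := @open_H0_dom R.
Let okQ : chart_ok (Q10 M) := prod_chart_ok okM oH.
Local Notation a := (aQ u D).
Local Notation Om := (conn_Om om u D).
Local Notation Th := (conn_Th om u D).
Local Notation th := (theta om u D a).
Local Notation G := (Gamma Om Th).
Local Notation eta := (coframe_Q th Om Th).
Local Notation e := (fun q : Q10 M => eps u D q.1).
Local Notation s4 := (fun q : Q10 M => S4 u D q.1).
Local Notation s5 := (fun q : Q10 M => S5 u D q.1).
Local Notation N := (coframe_mx eta).
Local Notation GC := (generated eta (fun f => f = e \/ f = s4)).

(** In the coframe eta the forms theta^k have constant coefficients, so that torsion and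
    curvature are evaluated on these unit rows. *)
Definition unit_row (l : 'I_8) : 'rV[R]_(8 + 2) := delta_mx 0 (lshift 2 l).

Lemma th_unit_row (i : ix (Q10 M)) y :
  (fun l => th l i y) = (fun l => unit_row l *m N i y).
Proof. by apply/funext => l; rewrite -rowE row_coframe_mx eta_l. Qed.

Lemma Om_unit_row (i : ix (Q10 M)) y : Om i y = delta_mx 0 (rshift 8 0) *m N i y.
Proof. by rewrite -rowE row_coframe_mx eta_r. Qed.

Lemma Th_unit_row (i : ix (Q10 M)) y : Th i y = delta_mx 0 (rshift 8 1) *m N i y.
Proof. by rewrite -rowE row_coframe_mx eta_r. Qed.

Definition conn_const (k : 'I_8) : 'M[R]_(8 + 2) :=
  conn_act (delta_mx 0 (rshift 8 0)) (delta_mx 0 (rshift 8 1)) unit_row k.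

Lemma coefs2_torsion k (i : ix (Q10 M)) y : img i y ->
  coefs2 (N i y) (torsion th G k i y) =
  torsion_table (e (psi i y)) (s4 (psi i y)) unit_row k.
Proof.
move=> yi; rewrite has_torsion_theta// th_unit_row torsion_table_mulmx.
by rewrite coefs2_congr//; exact: coframe_eta.
Qed.

Lemma coefs2_dtheta k (i : ix (Q10 M)) y : img i y ->
  coefs2 (N i y) (dform (th k i) y) =
  torsion_table (e (psi i y)) (s4 (psi i y)) unit_row k - conn_const k.
Proof.
move=> yi; have uN := coframe_eta H yi; have := coefs2_torsion k yi.
rewrite torsion_Gamma coefs2D th_unit_row Om_unit_row Th_unit_row conn_act_mulmx.
by rewrite coefs2_congr// => <-; rewrite addrK.
Qed.

Lemma coefs2_curvQ (i : ix (Q10 M)) y c : img i y ->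
  coefs2 (N i y) (c *: curvQ (fun l => th l i y)) = c *: curvQ unit_row.
Proof.
move=> yi; have uN := coframe_eta H yi.
by rewrite th_unit_row curvQ_mulmx coefs2Z coefs2_congr.
Qed.

(** S_5 is obtained from the coefficient of dS_4 along theta^5. *)
Lemma generated_s5 : GC s5.
Proof.
have ge : GC e by apply: gen_base; left.
have gs : GC s4 by apply: gen_base; right.
have g : GC (fun q => e q + 3 * s4 q ^+ 2 + s5 q).
  apply: (gen_deriv (k := lshift 2 (o8 5)) gs) => i y yi; have uN := coframe_eta H yi.
  have nrN p : (0 < p <= 8)%N -> coefs1 (N i y) ((fun k => th k i y)^[p]) 0 (lshift 2 (o8 5)) = (5 == p)%:R.
    move=> p8; rewrite -[(fun k => th k i y)^[p]]/(th (o8 p) i y) -eta_l -row_coframe_mx.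
    by rewrite coefs1_row// mxE eqxx (idx_eq (@lshift_inj 8 2)).
  rewrite (dS4 H yi) coefs1Z coefs1D mx_scaleE mx_addE !nrN//.
  by rewrite addr0 mulr1.
have gc (c : R) f : GC f -> GC (fun q => c * f q) by move=> gf; apply: gen_mul gf; exact: gen_const.
have g2 := gen_add g (gen_add (gc (-1) _ ge) (gc (-3) _ (gen_mul gs gs))).
apply: (gen_ext g2) => q _ /=; ring.
Qed.

Lemma generated_affine f (c1 c2 c3 c4 : R) :
  (forall (i : ix (Q10 M)) y, img i y -> f (psi i y) =
     c1 + c2 * e (psi i y) + c3 * s4 (psi i y) + c4 * s5 (psi i y)) -> GC f.
Proof.
move=> E; have ge : GC e by apply: gen_base; left.
have gs : GC s4 by apply: gen_base; right.
have gc (c : R) g : GC g -> GC (fun q => c * g q) by move=> gf; apply: gen_mul gf; exact: gen_const.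
have g := gen_add (gen_add (gen_add (gen_const _ _ c1) (gc c2 _ ge)) (gc c3 _ gs)) (gc c4 _ generated_s5).
by apply: (gen_ext g) => q /(carrierE okQ)[i [y [yi <-]]]; rewrite E.
Qed.

Lemma structure_function_generated f : structure_function eta f -> GC f.
Proof.
case=> k [p [q E]]; case: (split_ordP k) E => j -> E.
  rewrite eta_l in E.
  pose T c d := torsion_table c d unit_row j p q.
  apply: (@generated_affine f (T 0 0 - conn_const j p q) (T 1 0 - T 0 0) (T 0 1 - T 0 0) 0).
  move=> i y yi; rewrite E// coefs2_dtheta// torsion_table_affine.
  by rewrite /T !(mx_addE, mx_oppE, mx_scaleE); ring.
rewrite eta_r in E.
apply: (@generated_affine f 0 0 0 (if j == 0 then 0 else curvQ unit_row p q)) => i y yi.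
rewrite E//; case: ifP => _; first by rewrite dform_Om// coefs20 mx_0E; ring.
by rewrite dform_Th// coefs2_curvQ// mx_scaleE; ring.
Qed.

Lemma torsion_curvature_generated f : torsion_or_curvature_function th G eta f -> GC f.
Proof.
case=> [[j [p [q E]]]|[k [l [p [q E]]]]].
  pose T c d := torsion_table c d unit_row j p q.
  apply: (@generated_affine f (T 0 0) (T 1 0 - T 0 0) (T 0 1 - T 0 0) 0).
  move=> i y yi; rewrite E// coefs2_torsion// torsion_table_affine.
  by rewrite /T !(mx_addE, mx_oppE, mx_scaleE); ring.
apply: (@generated_affine f 0 0 0 (- h0_mx 0 1 k l * curvQ unit_row p q)) => i y yi.
rewrite E// has_curvature_theta// curvature_tableE scalerA coefs2_curvQ// mx_scaleE.
ring.
Qed.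

Lemma unit_rowE p q : (0 < p <= 8)%N -> (0 < q <= 8)%N ->
  unit_row^[p] 0 (lshift 2 (o8 q)) = (q == p)%:R.
Proof.
by move=> p8 q8; rewrite mxE eqxx -[inord _]/(o8 p) (idx_eq (@lshift_inj 8 2)).
Qed.

(** The fifth torsion form shows both eps and S_4, at places where the connection
    does not contribute to d theta^5. *)
Let entry5 e' s' p q := torsion_table e' s' unit_row (inord 4) (lshift 2 (o8 p)) (lshift 2 (o8 q)).

Lemma torsion5_e e' s' : entry5 e' s' 2 5 = e'.
Proof.
rewrite /entry5 /torsion_table inordK//=.
rewrite !(wedgeE, mx_addE, mx_oppE, mx_scaleE) !unit_rowE//=; ring.
Qed.

Lemma torsion5_s e' s' : entry5 e' s' 5 7 = - 2 * s'.
Proof.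
rewrite /entry5 /torsion_table inordK//=.
rewrite !(wedgeE, mx_addE, mx_oppE, mx_scaleE) !unit_rowE//=; ring.
Qed.

Lemma conn_const5 p q : (0 < p <= 8)%N -> (0 < q <= 8)%N ->
  conn_const (inord 4) (lshift 2 (o8 p)) (lshift 2 (o8 q)) = 0.
Proof.
move=> p8 q8; rewrite /conn_const /conn_act inordK//= mx_scaleE wedgeE !unit_rowE//.
rewrite ![delta_mx _ _ _ _]mxE !eq_lrshift /= !mul0r !mulr0.
by rewrite subr0 mulr0.
Qed.

Lemma invariants_from_torsion f : f = e \/ f = s4 ->
  generated eta (torsion_or_curvature_function th G eta) f.
Proof.
case=> ->.
  apply: gen_base; left; exists (inord 4), (lshift 2 (o8 2)), (lshift 2 (o8 5)).
  by move=> i y yi; rewrite coefs2_torsion// -/(entry5 _ _ 2 5) torsion5_e.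
have g : generated eta (torsion_or_curvature_function th G eta) (fun q => - 2 * s4 q).
  apply: gen_base; left; exists (inord 4), (lshift 2 (o8 5)), (lshift 2 (o8 7)).
  by move=> i y yi; rewrite coefs2_torsion// -/(entry5 _ _ 5 7) torsion5_s.
apply: (gen_ext (gen_mul (gen_const _ _ (- 2^-1)) g)) => q _ /=; by field.
Qed.

Lemma invariants_from_structure f : f = e \/ f = s4 ->
  generated eta (structure_function eta) f.
Proof.
case=> ->.
  apply: gen_base; exists (lshift 2 (inord 4)), (lshift 2 (o8 2)), (lshift 2 (o8 5)).
  move=> i y yi; rewrite eta_l coefs2_dtheta// mx_addE mx_oppE -/(entry5 _ _ 2 5) torsion5_e.
  by rewrite conn_const5// subr0.
have g : generated eta (structure_function eta) (fun q => - 2 * s4 q).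
  apply: gen_base; exists (lshift 2 (inord 4)), (lshift 2 (o8 5)), (lshift 2 (o8 7)).
  move=> i y yi; rewrite eta_l coefs2_dtheta// mx_addE mx_oppE -/(entry5 _ _ 5 7) torsion5_s.
  by rewrite conn_const5// subr0.
apply: (gen_ext (gen_mul (gen_const _ _ (- 2^-1)) g)) => q _ /=; by field.
Qed.

Lemma generated_invariants F :
  (generated eta (structure_function eta) F <->
   generated eta (torsion_or_curvature_function th G eta) F) /\
  (generated eta (torsion_or_curvature_function th G eta) F <->
   generated eta (fun f => f = e \/ f = s4) F).
Proof.
have AC := generated_sub structure_function_generated.
have BC := generated_sub torsion_curvature_generated.
have CA := generated_sub invariants_from_structure.
have CB := generated_sub invariants_from_torsion.
split; split.
- by move=> /AC/CB.
- by move=> /BC/CA.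
- exact: BC.
- exact: CB.
Qed.

End Generators.

(** * Maps that respect the coframes up to weights *)

Section WeightSigns.
Variables (R : realType) (r : R).
Hypothesis r2 : r ^+ 2 = 1.

Let r1 : r = 1 \/ r = -1.
Proof. by move/eqP: r2; rewrite sqrf_eq1 => /orP[] /eqP ->; [left|right]. Qed.

Lemma weight_sqr1 k : weight r k ^+ 2 = 1.
Proof.
rewrite /weight; case: k => -[|[|[|[|[|[|[|[|//]]]]]]]] ? /=.
all: by case: r1 => rE; rewrite ?rE; ring.
Qed.

(** The reflection H_mx (-1) 1 0 preserves the form of the torsion. *)
Lemma weight_torsion_table n e s (t : 'I_8 -> 'rV[R]_n) k :
  torsion_table e s (fun l => weight r l *: t l) k = weight r k *: torsion_table e s t k.
Proof.
rewrite /torsion_table /nr /weight !inordK//=.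
generalize (t (inord 0)) (t (inord 1)) (t (inord 2)) (t (inord 3)) (t (inord 4))
  (t (inord 5)) (t (inord 6)) (t (inord 7)) => t1 t2 t3 t4 t5 t6 t7 t8.
case: k => -[|[|[|[|[|[|[|[|//]]]]]]]] ? /=.
all: by wedge_entries; case: r1 => rE; rewrite ?rE; ring.
Qed.

(** The reflection H_mx (-1) 1 0 acts on the connection by a change of sign of Theta. *)
Lemma weight_conn_act n O T (t : 'I_8 -> 'rV[R]_n) k :
  conn_act O T (fun l => weight r l *: t l) k = weight r k *: conn_act O (r *: T) t k.
Proof.
rewrite /conn_act /nr /weight !inordK//=.
generalize (t (inord 0)) (t (inord 1)) (t (inord 2)) (t (inord 3)) (t (inord 4))
  (t (inord 5)) (t (inord 6)) (t (inord 7)) => t1 t2 t3 t4 t5 t6 t7 t8.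
case: k => -[|[|[|[|[|[|[|[|//]]]]]]]] ? /=.
all: by wedge_entries; case: r1 => rE; rewrite ?rE; ring.
Qed.

End WeightSigns.

Section Nondegenerate.
Variables (R : realType) (M : charted R 8) (om : 'I_8 -> form1 M) (u : M -> R).
Variable D : derived R M.
Hypothesis H : monge_I1_I2 om u D.
Local Notation th := (theta om u D (aQ u D)).

Lemma theta57_neq0 (i : ix (Q10 M)) y : img i y ->
  (fun k => th k i y)^[5] + (fun k => th k i y)^[7] != 0.
Proof.
move=> yi; have uN := coframe_eta H yi; apply/eqP.
move/(congr1 (fun v => coefs1 (coframe_mx (coframe_Q th (conn_Om om u D) (conn_Th om u D)) i y) v
  0 (lshift 2 (o8 5)))).
rewrite coefs1D /nr -/(o8 5) -/(o8 7).
rewrite -[th (o8 5)](eta_l om u D) -[th (o8 7)](eta_l om u D) -!row_coframe_mx.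
rewrite !coefs1_row// -(scale0r (0 : 'rV[R]_(8 + 2))) coefs1Z mx_scaleE mul0r.
rewrite mx_addE !mxE !eqxx (idx_eq (@lshift_inj 8 2))// addr0.
by move/eqP; rewrite oner_eq0.
Qed.

Lemma smooth_weight (r : M -> R) k : smooth_fun r ->
  smooth_fun (fun q : Q10 M => weight (r q.1) k).
Proof.
have mU : monge_U om u by case: H.
have mM : is_manifold M by case: mU.
have okM := manifold_chart_ok mM; have oH := @open_H0_dom R.
have okQ : chart_ok (Q10 M) := prod_chart_ok okM oH.
move=> sr; have sq := smooth_fun_fst okM oH sr.
rewrite /weight; case: k => -[|[|[|[|[|[|[|[|//]]]]]]]] ? /=.
all: try exact: smooth_funX.
exact: smooth_fun_cst.
Qed.

End Nondegenerate.

Section WeightedPullback.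
Variables (R : realType) (M M' : charted R 8).
Variables (om : 'I_8 -> form1 M) (u : M -> R) (D : derived R M).
Variables (om' : 'I_8 -> form1 M') (u' : M' -> R) (D' : derived R M').
Hypotheses (H : monge_I1_I2 om u D) (H' : monge_I1_I2 om' u' D').
Variables (Om' Th' : form1 (Q10 M')) (F : M -> M').
Local Notation th := (theta om u D (aQ u D)).
Local Notation th' := (theta om' u' D' (aQ u' D')).
Hypothesis h' : has_torsion th' (Gamma Om' Th')
  (fun q => eps u' D' q.1) (fun q => S4 u' D' q.1).
Variables (L : Q10 M -> Q10 M') (r : M -> R).
Hypotheses (sr : smooth_fun r) (sL : chart_smooth L).
Hypothesis cL : forall q, carrier q -> carrier (L q).
Hypothesis LF : forall q, carrier q -> (L q).1 = F q.1.
Hypothesis pth : forall k, is_pullback L (th' k)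
  (fun i y => weight (r (psi i y).1) k *: th k i y).

Let mU : monge_U om u. Proof. by case: H. Qed.
Let mM : is_manifold M. Proof. by case: mU. Qed.
Let okM := manifold_chart_ok mM.
Let mU' : monge_U om' u'. Proof. by case: H'. Qed.
Let mM' : is_manifold M'. Proof. by case: mU'. Qed.
Let okM' := manifold_chart_ok mM'.
Let oH := @open_H0_dom R.
Let okQ : chart_ok (Q10 M) := prod_chart_ok okM oH.
Let okQ' : chart_ok (Q10 M') := prod_chart_ok okM' oH.

Let lift_pt p : Q10 M := (p, pair_rv 1 0).

Let carrier_lift_pt p : carrier p -> carrier (lift_pt p).
Proof.
by move=> cp; apply/carrier_prod; split=> //; rewrite /H0_dom /= pair_rvE oner_neq0.
Qed.

Let P (b : form1 (Q10 M')) (i : ix (Q10 M)) (j : ix (Q10 M')) y :=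
  pull (fun z => phi j (L (psi i z))) (b j) y.

(** Both sides of the torsion equations are natural under pull-backs. *)
Lemma pulled_torsion k (i : ix (Q10 M)) (j : ix (Q10 M')) y :
  img i y -> dom j (L (psi i y)) ->
  dform (fun z => weight (r (psi i z).1) k *: th k i z) y
    + conn_act (P Om' i j y) (P Th' i j y)
        (fun l => weight (r (psi i y).1) l *: th l i y) k =
  torsion_table (eps u' D' (F (psi i y).1)) (S4 u' D' (F (psi i y).1))
    (fun l => weight (r (psi i y).1) l *: th l i y) k.
Proof.
move=> yi yj; have zj := img_phi yj.
set J := jacobian (fun z => phi j (L (psi i z))) y.
have := h' zj k; rewrite torsion_Gamma (psiK okQ' yj) (LF (carrier_psi okQ yi)).
move/(congr1 (congr_mx J^T)).
rewrite congr_mxD -conn_act_mulmx -torsion_table_mulmx {1}/congr_mx trmxK.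
rewrite -(dform_is_pullback sL (fun j k => (dform_theta H' _).1.1 j k) (pth k) yi yj).
have -> : (fun l => th' l j (phi j (L (psi i y))) *m J^T) =
    (fun l => weight (r (psi i y).1) l *: th l i y).
  by apply/funext => l; apply/esym; exact: (pth l yi yj).
by [].
Qed.

Lemma weight_ratio p : carrier p -> eps u D p = eps u' D' (F p) * r p ^+ 4.
Proof.
move=> cp; have cq := carrier_lift_pt cp.
have [i [y [yi yq]]] := carrierE okQ cq.
have [j yj] : carrier (L (psi i y)) by apply: cL; rewrite yq.
have uN := coframe_eta H yi; have h1 := has_torsion_theta H yi (inord 7).
have h2 := pulled_torsion (inord 7) yi yj.
have E8 : dform (fun z => weight (r (psi i z).1) (inord 7) *: th (inord 7) i z) y =
    dform (th (inord 7) i) y.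
  by apply: near_dform; apply: filterE => z; rewrite /weight inordK// scale1r.
rewrite torsion_Gamma th_row in h1.
have wth : (fun l => weight (r (psi i y).1) l *: th l i y) =
    (fun l => weight (r (psi i y).1) l *: row (lshift 2 l)
      (coframe_mx (coframe_Q th (conn_Om om u D) (conn_Th om u D)) i y)).
  by apply/funext => l; rewrite row_coframe_mx eta_l.
rewrite E8 wth in h2.
by have := torsion_ratio uN (@lshift_inj 8 2) h1 h2; rewrite yq.
Qed.

(** eps = eps' r^4, and both signs have absolute value 1. *)
Lemma weight_sign p : carrier p -> r p ^+ 2 = 1 /\ eps u' D' (F p) = eps u D p.
Proof.
move=> cp; have E := weight_ratio cp.
have cF : carrier (F p).
  have := cL (carrier_lift_pt cp) => /carrier_prod[].
  by rewrite (LF (carrier_lift_pt cp)).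
have [e|e] := eps_cases H cp; have [e'|e'] := eps_cases H' cF;
  rewrite e e' in E *; split=> //; nra.
Qed.

(** r^2 = 1 makes r locally constant.  The pulled back forms therefore satisfy the
    torsion equations of theta, with Theta replaced by r Theta; these determine the
    connection and S_4. *)
Lemma pulled_connection (i : ix (Q10 M)) (j : ix (Q10 M')) y :
  img i y -> dom j (L (psi i y)) ->
  [/\ P Om' i j y = conn_Om om u D i y,
      P Th' i j y = r (psi i y).1 *: conn_Th om u D i y &
      S4 u' D' (F (psi i y).1) = S4 u D (psi i y).1].
Proof.
move=> yi yj; have uN := coframe_eta H yi.
have [cp _] := (carrier_prod _).1 (carrier_psi okQ yi).
have [r2 ee] := weight_sign cp.
have w2 k : weight (r (psi i y).1) k * weight (r (psi i y).1) k = 1.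
  by rewrite -expr2 weight_sqr1.
(* each weight is a power of r, hence locally constant *)
have hd k : dform (fun z => weight (r (psi i z).1) k *: th k i z) y =
    weight (r (psi i y).1) k *: dform (th k i) y.
  have sw := smooth_weight H k sr.
  rewrite dformZ.
  - rewrite -/(dF (fun q : Q10 M => weight (r q.1) k) i y) (dF_sqr1 okQ sw _ yi).
      by rewrite wedge0l add0r.
    by move=> q /carrier_prod[cq _]; rewrite weight_sqr1//; have [] := weight_sign cq.
  - exact: smooth_fun_diff sw yi.
  - exact: smooth_form_diff (dform_theta H k).1 yi.
have h k : dform (th k i) y + conn_act (P Om' i j y) (r (psi i y).1 *: P Th' i j y)
    (fun l => th l i y) k =
    torsion_table (eps u D (psi i y).1) (S4 u' D' (F (psi i y).1)) (fun l => th l i y) k.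
  have := pulled_torsion k yi yj.
  rewrite hd (weight_conn_act r2) (weight_torsion_table r2) -scalerDr ee.
  by move/(congr1 (fun A => weight (r (psi i y).1) k *: A)); rewrite !scalerA w2 !scale1r.
have [] := @torsion_unique R _ (coframe_mx (coframe_Q th (conn_Om om u D) (conn_Th om u D)) i y)
  (lshift 2) uN (@lshift_inj 8 2) (fun k => dform (th k i) y)
  (conn_Om om u D i y) (conn_Th om u D i y) (P Om' i j y) (r (psi i y).1 *: P Th' i j y)
  (eps u D (psi i y).1) (S4 u D (psi i y).1) (S4 u' D' (F (psi i y).1)).
- by move=> k; have := has_torsion_theta H yi k; rewrite torsion_Gamma th_row.
- by move=> k; have := h k; rewrite th_row.
by move=> <- -> <-; split=> //; rewrite scalerA -expr2 r2 scale1r.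
Qed.

Lemma weighted_S4 p : carrier p -> S4 u' D' (F p) = S4 u D p.
Proof.
move=> cp; have [i [y [yi yq]]] := carrierE okQ (carrier_lift_pt cp).
have [j yj] : carrier (L (psi i y)) by apply: cL; rewrite yq; exact: carrier_lift_pt.
by have [_ _] := pulled_connection yi yj; rewrite yq.
Qed.

(** Compare the two formulas for dS_4; the form theta^5 + theta^7 has no zero. *)
Lemma weighted_S5 p : carrier p -> S5 u' D' (F p) = S5 u D p.
Proof.
move=> cp; have cq := carrier_lift_pt cp.
have [i [y [yi yq]]] := carrierE okQ cq.
have [j yj] : carrier (L (psi i y)) by apply: cL; rewrite yq.
have [r2 ee] := weight_sign cp.
have ss' := smooth_fun_fst okM' oH (ode_S4 H').1.
have := is_pullback_dF okQ' sL ss' yi yj.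
rewrite /pull {2}/dF (dS4 H' (img_phi yj)) (psiK okQ' yj) -scalemxAl mulmxDl.
have P57 k : (fun l => th' l j (phi j (L (psi i y))))^[k] *m
    (jacobian (fun z => phi j (L (psi i z))) y)^T = weight (r (psi i y).1) (inord k.-1) *: (fun l => th l i y)^[k].
  exact: esym (pth (inord k.-1) yi yj).
have yp : (psi i y).1 = p by exact: (congr1 fst yq).
rewrite !P57 {P57} yp /weight !inordK//= r2 !scale1r.
have -> : dF (fun q => S4 u' D' (L q).1) i y = dfun (fun z => S4 u D (psi i z).1) y.
  apply: near_dfun; apply: (near_open (img_open okQ i) yi) => z zi.
  have cz := carrier_psi okQ zi; have [cp' _] := (carrier_prod _).1 cz.
  apply: etrans (congr1 (S4 u' D') (LF cz)) _; exact: weighted_S4.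
rewrite (dS4 H yi) yq (LF (carrier_psi okQ yi)) yq /= => /eqP.
rewrite -subr_eq0 -scalerBl scaler_eq0 (negbTE (theta57_neq0 H yi)) orbF subr_eq0 => /eqP.
by rewrite ee (weighted_S4 cp) => /addrI.
Qed.

Lemma weighted_invariants p : carrier p ->
  [/\ eps u' D' (F p) = eps u D p, S4 u' D' (F p) = S4 u D p &
      S5 u' D' (F p) = S5 u D p].
Proof.
move=> cp; have [_ ee] := weight_sign cp.
by split=> //; [exact: weighted_S4|exact: weighted_S5].
Qed.

End WeightedPullback.

(** * Equivalences and lifts to Q *)

Lemma mx_act_inv (R : fieldType) n (V : lmodType R) (A B : 'M[R]_n) (v w : 'I_n -> V) :
  B \in unitmx -> (forall k, \sum_l A k l *: v l = \sum_l B k l *: w l) ->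
  forall k, w k = \sum_l (invmx B *m A) k l *: v l.
Proof.
move=> uB E k; rewrite -mx_act; under eq_bigr do rewrite E.
rewrite mx_act mulVmx// (bigD1 k)//= big1 ?addr0 ?mxE ?eqxx ?scale1r// => l lk.
by rewrite mxE eq_sym (negbTE lk) scale0r.
Qed.

Lemma pair_rv_delta (R : realType) (b c : R) :
  pair_rv b c = b *: delta_mx 0 0 + c *: delta_mx 0 1.
Proof.
apply/rowP => k; rewrite !mxE /= .
by case: k => -[|[|//]] hk /=; rewrite ?mulr1 ?mulr0 ?addr0 ?add0r.
Qed.

Section SmoothContinuous.
Variables (R : realType) (n : nat) (X : charted R n).
Hypothesis mX : is_manifold X.

Lemma smooth_fun_continuous (f : X -> R) p : smooth_fun f -> carrier p ->
  {for p, continuous f}.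
Proof.
move=> sf [i dp]; have okX := manifold_chart_ok mX.
have [_ _ oX hX _] := mX; have [cX _] := hX.
have c : {for p, continuous ((fun x => f (psi i x)) \o @phi R n X i)}.
  apply: continuous_comp; first by have [] := cX i p dp.
  exact/differentiable_continuous/(smooth_fun_diff sf)/img_phi.
rewrite /prop_for /continuous_at; move: c; rewrite /prop_for /continuous_at /= (psiK okX dp).
apply: cvg_trans; apply: near_eq_cvg; have [oi _] := oX i.
by apply: filterS (open_nbhs_nbhs (conj oi dp)) => z dz /=; rewrite (psiK okX dz).
Qed.

End SmoothContinuous.

Section Equivalence.
Variables (R : realType) (M M' : charted R 8).
Variables (om : 'I_8 -> form1 M) (u : M -> R) (D : derived R M).
Variables (om' : 'I_8 -> form1 M') (u' : M' -> R) (D' : derived R M').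
Hypotheses (H : monge_I1_I2 om u D) (H' : monge_I1_I2 om' u' D').
Variables (Om' Th' : form1 (Q10 M')) (F : M -> M').
Hypothesis mF : smooth_map F.
Local Notation a := (aQ u D).
Local Notation a' := (aQ u' D').
Local Notation th := (theta om u D a).
Local Notation th' := (theta om' u' D' a').
Hypothesis h' : has_torsion th' (Gamma Om' Th')
  (fun q => eps u' D' q.1) (fun q => S4 u' D' q.1).

Let mU : monge_U om u. Proof. by case: H. Qed.
Let mM : is_manifold M. Proof. by case: mU. Qed.
Let okM := manifold_chart_ok mM.
Let mU' : monge_U om' u'. Proof. by case: H'. Qed.
Let mM' : is_manifold M'. Proof. by case: mU'. Qed.
Let okM' := manifold_chart_ok mM'.
Let oH := @open_H0_dom R.
Let okQ : chart_ok (Q10 M) := prod_chart_ok okM oH.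
Let okQ' : chart_ok (Q10 M') := prod_chart_ok okM' oH.
Let sF : chart_smooth F := smooth_map_charts mM mM' mF.
Let cF p (cp : carrier p) : carrier (F p) := (mF.1 p cp).1.
Let sa : smooth_fun a := (ode_aQ H).1.
Let sa' : smooth_fun a' := (ode_aQ H').1.
Let saF : smooth_fun (fun p => a' (F p)) := smooth_fun_comp okM okM' sF cF sa'.
Let fst_smooth (f : M -> R) : smooth_fun f -> smooth_fun (fun q : Q10 M => f q.1).
Proof. exact: smooth_fun_fst. Qed.

Section Prolongation.
Variables (a0 b0 c0 : M -> R).
Hypotheses (sa0 : smooth_fun a0) (sb0 : smooth_fun b0) (sc0 : smooth_fun c0).
Hypothesis ab0 : forall p, carrier p -> a0 p * b0 p != 0.
Hypothesis pb : forall k, is_pullback F (bar om' u' D' k) (fun i x =>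
  \sum_l H_mx (a0 (psi i x)) (b0 (psi i x)) (c0 (psi i x)) k l *: bar om u D l i x).

Let f p := a' (F p) * a0 p.

Let sf : smooth_fun f. Proof. exact: smooth_funM. Qed.

(** The fibre coordinates b', c' are the solutions of
    H_mx a' b' c' *m H_mx a0 b0 c0 = H_mx (a' a0) b c. *)
Definition prolong (q : Q10 M) : Q10 M' :=
  (F q.1, pair_rv (fb q / b0 q.1) (a0 q.1 * (fc q - c0 q.1))).

Let a0_neq0 p : carrier p -> a0 p != 0.
Proof. by move=> /ab0; rewrite mulf_eq0 negb_or => /andP[]. Qed.

Let b0_neq0 p : carrier p -> b0 p != 0.
Proof. by move=> /ab0; rewrite mulf_eq0 negb_or => /andP[]. Qed.

Lemma carrier_prolong q : carrier q -> carrier (prolong q).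
Proof.
move=> /carrier_prod[cq b]; apply/carrier_prod; split; first exact: cF.
by rewrite /H0_dom /= pair_rvE mulf_neq0// invr_neq0// b0_neq0.
Qed.

Let sb0V : smooth_fun (fun q : Q10 M => (b0 q.1)^-1).
Proof.
apply: (smooth_funV okQ); last exact: fst_smooth.
by move=> q /carrier_prod[cq _]; exact: b0_neq0.
Qed.

Let s1 : smooth_fun (fun q : Q10 M => fb q / b0 q.1).
Proof. exact: (smooth_funM okQ (smooth_fb mU) sb0V). Qed.

Let s2 : smooth_fun (fun q : Q10 M => a0 q.1 * (fc q - c0 q.1)).
Proof.
apply: (smooth_funM okQ (fst_smooth sa0)).
exact: (smooth_funD okQ (smooth_fc mU) (smooth_funN okQ (fst_smooth sc0))).
Qed.

Lemma chart_smooth_prolong : chart_smooth prolong.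
Proof.
apply: (prod_chart_smooth okM oH sF carrier_prolong) => // l.
have [->|->] : l = 0 \/ l = 1.
- by case: l => -[|[|//]] hl; [left|right]; exact/val_inj.
- by apply: (smooth_fun_ext okQ _ s1) => q _; rewrite pair_rvE.
- by apply: (smooth_fun_ext okQ _ s2) => q _; rewrite pair_rvE.
Qed.

Lemma smooth_map_prolong : smooth_map prolong.
Proof.
split; last by move=> i j; exact: (chart_smooth_prolong i j).2.
move=> q cq; split; first exact: carrier_prolong.
have [cp _] := (carrier_prod _).1 cq.
have cfst (Y : topologicalType) (g : M -> Y) : {for q.1, continuous g} ->
    {for q, continuous (fun q : Q10 M => g q.1)}.
  by move=> cg; apply: (@continuous_comp _ _ _ fst g) => //; exact: cvg_fst.
have csnd l : {for q, continuous (fun q : Q10 M => q.2 0 l)}.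
  apply: (@continuous_comp _ _ _ snd (fun h : 'rV[R]_2 => h 0 l)); first exact: cvg_snd.
  exact: coord_continuous.
have cm g : smooth_fun g -> {for q, continuous (fun q : Q10 M => g q.1)}.
  by move=> sg; apply: cfst; exact: (smooth_fun_continuous mM sg cp).
have cb : {for q, continuous (fun q : Q10 M => fb q / b0 q.1)}.
  apply: cvgM; first exact: csnd.
  by apply: cvgV; [exact: b0_neq0|exact: cm].
have cc : {for q, continuous (fun q : Q10 M => a0 q.1 * (fc q - c0 q.1))}.
  apply: cvgM; first exact: cm.
  by apply: cvgB; [exact: csnd|exact: cm].
have c2 : {for q, continuous (fun q : Q10 M => pair_rv (fb q / b0 q.1) (a0 q.1 * (fc q - c0 q.1)))}.
  rewrite (_ : (fun q : Q10 M => pair_rv _ _) = fun q : Q10 M =>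
    (fb q / b0 q.1) *: delta_mx 0 0 + (a0 q.1 * (fc q - c0 q.1)) *: delta_mx 0 1).
    by apply: cvgD; [exact: cvgZr_tmp cb|exact: cvgZr_tmp cc].
  by apply/funext => x; rewrite pair_rv_delta.
exact: cvg_pair (cfst _ F (mF.1 _ cp).2) c2.
Qed.

(** Being a product in H, the matrix of the pulled back forms is that of the
    hypersurface {a = f}, with f the product of a' o F and a0. *)
Lemma prolong_theta k : is_pullback prolong (th' k) (theta om u D f k).
Proof.
have pl l := is_pullback_lift okM oH sF carrier_prolong (fun q _ => erefl)
  chart_smooth_prolong (pb l).
apply: is_pullback_eq (is_pullback_sum (fun l => is_pullbackM okQ'
  (fun q => H_mx (a' q.1) (fb q) (fc q) k l) (pl l))).
  by move=> j z zj; rewrite (theta_lift D' mU' k sa' zj).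
move=> i y yi; rewrite (theta_lift D mU k sf yi).
have [cp _] := (carrier_prod _).1 (carrier_psi okQ yi).
transitivity (\sum_l H_mx (a' (F (psi i y).1)) (fb (psi i y) / b0 (psi i y).1)
    (a0 (psi i y).1 * (fc (psi i y) - c0 (psi i y).1)) k l *:
  \sum_m H_mx (a0 (psi i y).1) (b0 (psi i y).1) (c0 (psi i y).1) l m *:
    liftQ (bar om u D m) i y).
  apply: eq_bigr => l _; rewrite /fb /fc /prolong /= !pair_rvE; congr (_ *: _).
  rewrite lift_sum; apply: eq_bigr => m _.
  by rewrite /liftQ /lift_form scale_row_mx scaler0.
rewrite mx_act; apply: eq_bigr => m _; congr (_ k m *: _).
have [A B] := (a0_neq0 cp, b0_neq0 cp).
rewrite H_mx_mul; last exact: A.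
by rewrite (divfK B) [X in _ + X]mulrAC (divff A) mul1r addrCA subrr addr0.
Qed.

Let r p := f p / a p.

Let sr : smooth_fun r.
Proof. exact: (smooth_funM okM sf (smooth_funV okM (fun p cp => aQ_neq0 H cp) sa)). Qed.

Lemma prolong_weight k : is_pullback prolong (th' k)
  (fun i y => weight (r (psi i y).1) k *: th k i y).
Proof.
apply: is_pullback_eq (prolong_theta k) => // i y yi.
exact: (theta_weight H k sf yi).
Qed.

Lemma prolong_lifts :
  lifts_to_Q th (conn_Om om u D) (conn_Th om u D) th' Om' Th' F.
Proof.
have cP := carrier_prolong; have sP := chart_smooth_prolong.
have pw := prolong_weight; have LF q : carrier q -> (prolong q).1 = F q.1 by [].
exists r, prolong; split.
- split=> // p cp; have [/eqP] := weight_sign H H' h' sP cP LF pw cp.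
  by rewrite sqrf_eq1 => /orP[] /eqP; [left|right].
- by split=> //; exact: smooth_map_prolong.
- move=> k; apply: is_pullback_eq (pw k) => // i y yi.
  by rewrite (weight_actE _ (fun l => th l i y)).
- move=> i j y yi yj.
  by have [] := pulled_connection H H' h' sr sP cP LF pw yi yj.
- move=> i j y yi yj.
  by have [] := pulled_connection H H' h' sr sP cP LF pw yi yj.
Qed.

Lemma prolong_invariants p : carrier p ->
  [/\ eps u' D' (F p) = eps u D p, S4 u' D' (F p) = S4 u D p &
      S5 u' D' (F p) = S5 u D p].
Proof.
exact: (weighted_invariants H H' h' sr chart_smooth_prolong carrier_prolong
  (fun q _ => erefl) prolong_weight).
Qed.

End Prolongation.

Section Descent.
Variables (s : M -> R) (L : Q10 M -> Q10 M').
Hypotheses (ss : smooth_fun s) (s_neq0 : forall p, carrier p -> s p != 0).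
Hypotheses (mL : smooth_map L) (LF : forall q, carrier q -> (L q).1 = F q.1).
Hypothesis pth : forall k, is_pullback L (th' k) (fun i y =>
  \sum_l H_mx (s (psi i y).1) 1 0 k l *: th l i y).

Let cL q (cq : carrier q) : carrier (L q) := (mL.1 q cq).1.
Let sL : chart_smooth L := prod_smooth_map_charts okM oH sF cL LF mL.

(** A lift is read off along this section of Q. *)
Definition unit_section (p : M) : Q10 M := (p, pair_rv 1 0).

Lemma carrier_unit_section p : carrier p -> carrier (unit_section p).
Proof.
by move=> cp; apply/carrier_prod; split=> //; rewrite /H0_dom /= pair_rvE oner_neq0.
Qed.

Lemma chart_smooth_unit_section : chart_smooth unit_section.
Proof.
move=> i j; have [oi sid] := chart_smooth_id mM i j.
have E : [set x | img i x /\ dom j (unit_section (psi i x))] =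
    [set x | img i x /\ @dom R _ M j (psi i x)].
  apply/seteqP; split=> x [xi]; first by case.
  move=> xj; split=> //; split=> //.
  by rewrite /H0_dom /= pair_rvE oner_neq0.
rewrite E; split=> // k; case: (split_ordP k) => l ->.
  by apply: (smooth_ext oi _ (sid l)) => x _; rewrite /= row_mxEl.
by apply: (smooth_ext oi _ (smooth_cst _ (pair_rv (1 : R) 0 0 l))) => x _; rewrite /= row_mxEr.
Qed.

Let b1 p := fb (L (unit_section p)).
Let c1 p := fc (L (unit_section p)).

Let sb1 : smooth_fun b1.
Proof.
exact: (@smooth_fun_comp _ _ _ _ _ unit_section okM okQ chart_smooth_unit_section
  (fun q => fb (L q)) carrier_unit_section
  (smooth_fun_comp okQ okQ' sL cL (smooth_fb mU'))).
Qed.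

Let sc1 : smooth_fun c1.
Proof.
exact: (@smooth_fun_comp _ _ _ _ _ unit_section okM okQ chart_smooth_unit_section
  (fun q => fc (L q)) carrier_unit_section
  (smooth_fun_comp okQ okQ' sL cL (smooth_fc mU'))).
Qed.

Let b1_neq0 p : carrier p -> b1 p != 0.
Proof. by move=> cp; exact: (fb_neq0 (cL (carrier_unit_section cp))). Qed.

Let a_neq0 p : carrier p -> a p != 0. Proof. exact: (aQ_neq0 H). Qed.
Let aF_neq0 p : carrier p -> a' (F p) != 0.
Proof. by move=> cp; exact: (aQ_neq0 H' (cF cp)). Qed.

Lemma descent_bar (i : ix M) (j : ix M') x k : img i x -> dom j (F (psi i x)) ->
  \sum_l H_mx (s (psi i x) * a (psi i x)) 1 0 k l *: bar om u D l i x =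
  \sum_l H_mx (a' (F (psi i x))) (b1 (psi i x)) (c1 (psi i x)) k l *:
    pull (fun x => phi j (F (psi i x))) (bar om' u' D' l j) x.
Proof.
move=> xi xj; pose y : 'rV[R]_(8 + 2) := row_mx x (pair_rv 1 0).
have yE : @psi R _ (Q10 M) i y = unit_section (psi i x).
  by rewrite /= /y row_mxKl row_mxKr.
have yi : @img R _ (Q10 M) i y.
  apply/img_prod; rewrite /y row_mxKl row_mxKr; split=> //.
  by rewrite /H0_dom /= pair_rvE oner_neq0.
have yl : lsubmx y = x by rewrite /y row_mxKl.
have xj' : @dom R _ M' j (F (@psi R _ M i (lsubmx y))) by rewrite yl.
have [_ yj] := (prod_overlapE okM oH cL LF i j y).2 (conj yi xj').
have cx := carrier_psi okM xi; have cs := carrier_unit_section cx.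
have Er : pull (fun z => @phi R _ (Q10 M') j (L (@psi R _ (Q10 M) i z))) (th' k j) y =
    \sum_l H_mx (a' (F (psi i x))) (b1 (psi i x)) (c1 (psi i x)) k l *:
      row_mx (pull (fun x => phi j (F (psi i x))) (bar om' u' D' l j) x) 0.
  rewrite {1}/pull (theta_lift D' mU' k sa' (img_phi yj)) mulmx_suml.
  rewrite (psiK okQ' yj) yE; apply: eq_bigr => l _; rewrite -scalemxAl (LF cs).
  have Pl := pull_lift okM oH sF cL LF (bar om' u' D' l) sL yi yj.
  rewrite yl in Pl; congr (_ *: _).
  by apply: etrans Pl; rewrite [in RHS]/pull yE.
have El : \sum_l H_mx (s (@psi R _ (Q10 M) i y).1) 1 0 k l *: th l i y =
    \sum_l H_mx (s (psi i x) * a (psi i x)) 1 0 k l *: row_mx (bar om u D l i x) 0.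
  rewrite yE; under eq_bigr do rewrite (theta_lift D mU _ sa yi).
  rewrite mx_act; apply: eq_bigr => l _; rewrite yE /fb /fc /= !pair_rvE /liftQ /lift_form yl.
  by rewrite H_mx_mul ?a_neq0// mul1r mul0r addr0.
have := pth k yi yj; rewrite El Er => /(congr1 lsubmx).
have ls (A : 'M[R]_8) (v : 'I_8 -> 'rV[R]_8) :
    lsubmx (\sum_l A k l *: row_mx (v l) (0 : 'rV[R]_2)) = \sum_l A k l *: v l.
  rewrite (raddf_sum lsubmx); apply: eq_bigr => l _.
  by apply: etrans (congr1 _ (scale_row_mx _ _ _)) _; exact: row_mxKl.
by rewrite !ls.
Qed.

Lemma descent_equivalence : equivalence om u D om' u' D' F.
Proof.
have c : forall p, carrier p -> s p * a p != 0 by move=> p cp; rewrite mulf_neq0 ?s_neq0 ?a_neq0.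
have ssa : smooth_fun (fun p => s p * a p) by exact: smooth_funM.
have ssaV := smooth_funV okM c ssa.
have saFV := smooth_funV okM aF_neq0 saF.
exists (fun p => (a' (F p))^-1 * (s p * a p)), (fun p => (b1 p)^-1),
  (fun p => - (c1 p * a' (F p)) * (s p * a p)^-1); split.
- exact: smooth_funM.
- exact: smooth_funV.
- apply: (smooth_funM okM _ ssaV); apply: (smooth_funN okM).
  exact: smooth_funM.
- move=> p cp; apply: mulf_neq0; last exact: invr_neq0 (b1_neq0 cp).
  by apply: mulf_neq0 (c p cp); exact: invr_neq0 (aF_neq0 cp).
move=> k i j x xi xj; have cx := carrier_psi okM xi.
have uB := H_mx_unit (c1 (psi i x)) (aF_neq0 cx) (b1_neq0 cx).
apply/esym; have := mx_act_inv uB (fun k => descent_bar k xi xj) k => ->.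
rewrite invmx_H_mx ?aF_neq0 ?b1_neq0// H_mx_mul ?c// mulr1 add0r.
by [].
Qed.

End Descent.

Theorem equivalence_iff_lift :
  (equivalence om u D om' u' D' F <->
   lifts_to_Q th (conn_Om om u D) (conn_Th om u D) th' Om' Th' F) /\
  (equivalence om u D om' u' D' F -> forall p, carrier p ->
    [/\ eps u' D' (F p) = eps u D p, S4 u' D' (F p) = S4 u D p &
        S5 u' D' (F p) = S5 u D p]).
Proof.
split; [split|] => [[a0 [b0 [c0 [sa0 sb0 sc0 ab0 pb]]]]|[s [L [[ss s1] [mL LF] pth _ _]]]|].
- exact: (prolong_lifts sa0 sb0 sc0 ab0 pb).
- apply: (descent_equivalence ss _ mL LF pth) => p cp.
  by have [->|->] := s1 p cp; rewrite ?oppr_eq0 oner_neq0.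
- by move=> [a0 [b0 [c0 [sa0 sb0 sc0 ab0 pb]]]] p cp; exact: (prolong_invariants sa0 sb0 sc0 ab0 pb).
Qed.

End Equivalence.

Theorem theorem4p7 (R : realType) (M : charted R 8)
    (om : 'I_8 -> form1 M) (u : M -> R) :
  monge_U om u ->
  (exists D, derived_eqs om u D) /\
  forall D : derived R M,
  derived_eqs om u D ->
  (forall p, carrier p -> I1 u D p != 0) ->
  (forall p, carrier p -> I2 D p = 0) ->
  let a := aQ u D in
  let th := theta om u D a in
  let e := fun q : Q10 M => eps u D q.1 in
  let s4 := fun q : Q10 M => S4 u D q.1 in
  let s5 := fun q : Q10 M => S5 u D q.1 in
  (* the reduction Q = {a = aQ}, and its uniqueness *)
  is_H0_reduction a /\
  (forall f : M -> R, is_H0_reduction f ->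
     (exists (Om Th : form1 (Q10 M)) (e' s' : Q10 M -> R),
        (forall q, carrier q -> e' q = 1 \/ e' q = -1) /\
        has_torsion (theta om u D f) (Gamma Om Th) e' s') ->
     forall p, carrier p -> f p = a p \/ f p = - a p) /\
  exists Om Th : form1 (Q10 M),
  let G := Gamma Om Th in
  let eta := coframe_Q th Om Th in
  (* the connection, its torsion and its curvature *)
  [/\ (forall k, smooth_form (eta k)) /\ coframe eta,
      principal_connection a G,
      has_torsion th G e s4 &
      has_curvature th G s5] /\
  (* uniqueness of the connection *)
  (forall (Om' Th' : form1 (Q10 M)) (s' : Q10 M -> R),
     has_torsion th (Gamma Om' Th') e s' -> form_eq Om' Om /\ form_eq Th' Th) /\
  (* torsion and curvature give all invariants of the coframe, hence (last
     clause) of the structure, and these come from S4 by differentiation *)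
  (forall (i : ix (Q10 M)) y, img i y ->
     let q := psi i y in
     dfun (fun y' => s4 (psi i y')) y =
     (e q + 3 * s4 q ^+ 2 + s5 q) *:
       ((fun k => th k i y)^[5] + (fun k => th k i y)^[7])) /\
  (forall F : Q10 M -> R,
     (generated eta (structure_function eta) F <->
      generated eta (torsion_or_curvature_function th G eta) F) /\
     (generated eta (torsion_or_curvature_function th G eta) F <->
      generated eta (fun f => f = e \/ f = s4) F)) /\
  forall (M' : charted R 8) (om' : 'I_8 -> form1 M') (u' : M' -> R)
         (D' : derived R M') (Om' Th' : form1 (Q10 M')),
    monge_I1_I2 om' u' D' ->
    let th' := theta om' u' D' (aQ u' D') in
    smooth_form Om' -> smooth_form Th' ->
    has_torsion th' (Gamma Om' Th')
      (fun q => eps u' D' q.1) (fun q => S4 u' D' q.1) ->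
    forall F : M -> M', smooth_map F ->
      (equivalence om u D om' u' D' F <-> lifts_to_Q th Om Th th' Om' Th' F) /\
      (equivalence om u D om' u' D' F -> forall p, carrier p ->
         [/\ eps u' D' (F p) = eps u D p, S4 u' D' (F p) = S4 u D p &
             S5 u' D' (F p) = S5 u D p]).
Proof.
move=> mU; split; first by exists (derived_of om u); exact: derived_exists.
move=> D dD I1n I2z a th e s4 s5.
have H : monge_I1_I2 om u D by split.
split; first exact: (aQ_reduction H).
split; first by move=> f [sf _ _ _]; exact: (reduction_unique H sf).
exists (conn_Om om u D), (conn_Th om u D) => G eta.
split.
  split.
  - by split; [exact: (smooth_eta H)|exact: (coframe_eta H)].
  - exact: (principal_Gamma H).
  - exact: (has_torsion_theta H).
  - exact: (has_curvature_theta H).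
split; first by move=> Om' Th' s' h; exact: (connection_unique H h).
split; first by move=> i y yi; exact: (dS4 H yi).
split; first by move=> F; exact: (generated_invariants H F).
move=> M' om' u' D' Om' Th' H' th' _ _ h' F mF.
exact: (equivalence_iff_lift H H' mF h').
Qed.
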